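(* Let $\nu > 0$. There exists $\beta_0 = \beta_0(\nu) \in (0,\pi/2]$ such that for every $0 < \beta \le \beta_0$ the minimizer $\theta_\beta$ of $E_\beta$ over $\mathcal{A}_\beta$ is unique, and $\theta_\beta \to 0$ uniformly on $[0,+\infty)$ as $\beta \to 0$.
   Context: Notation: $\mathbb{R}^+ = (0,\infty)$ and $\overline{\mathbb{R}^+} = [0,\infty)$; all functions are real valued. $\mathring{H}^1_0(\mathbb{R}^+)$ is the Hilbert space obtained as the completion of $C^\infty_c(\mathbb{R}^+)$ with respect to the norm $\|u\|^2_{\mathring{H}^1_0(\mathbb{R}^+)} := \int_0^\infty |u'|^2\,dx$; its elements are identified with continuous functions on $[0,\infty)$ vanishing at $x=0$. For $\beta \in (0,\pi/2]$ the admissible class is $$\mathcal{A}_\beta := \{ \theta \in C(\overline{\mathbb{R}^+}) : \theta - \beta \in \mathring{H}^1_0(\mathbb{R}^+) \}.$$ For each $\beta\in(0,\pi/2]$, $\eta_\beta : \mathbb{R} \to [0,\beta]$ is a fixed smooth cutoff function with $\eta_\beta(x) = \beta$ for $x \le 0$, $\eta_\beta(x) = 0$ for $x \ge 1$, and $\eta_\beta'(x) \le 0$ for all $x \in \mathbb{R}$ (the set of minimizers below does not depend on the choice of $\eta_\beta$). For $\beta \in (0,\pi/2]$, $\nu>0$ and $\theta \in \mathcal{A}_\beta$ the renormalized energy is $$E_\beta(\theta) = \int_0^\infty \left( \tfrac12 |\theta'|^2 + \tfrac12 \sin^2\theta + \frac{\nu}{4\pi}\cdot\frac{\sin^2(\theta-\beta)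 - \sin^2(\eta_\beta - \beta)}{x} \right) dx + \frac{\nu}{8\pi}\int_0^\infty\int_0^\infty \frac{(\sin(\theta(x)-\beta) - \sin(\theta(y)-\beta))^2}{(x-y)^2}\,dx\,dy - \frac{\nu}{8\pi}\int_0^\infty\int_0^\infty \frac{(\sin(\eta_\beta(x)-\beta) - \sin(\eta_\beta(y)-\beta))^2}{(x-y)^2}\,dx\,dy.$$ The integrand of the first integral is bounded from below by an integrable function not depending on $\theta$, the second term is nonnegative, and the last term is a finite constant, so $E_\beta(\theta) \in (-\infty,+\infty]$ is well defined on $\mathcal{A}_\beta$. A minimizer of $E_\beta$ over $\mathcal A_\beta$ is a $\theta\in\mathcal A_\beta$ with $E_\beta(\theta)=\inf_{\tilde\theta\in\mathcal A_\beta}E_\beta(\tilde\theta)$ (this infimum is finite, and a minimizer exists for every $\beta\in(0,\pi/2]$ and $\nu>0$). *)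

(* Defs.v *)
(* MathComp-Analysis.  A function on (0, oo) or on [0, oo) is represented by a
   function on R whose values outside of that domain are irrelevant. *)
From HB Require Import structures.
From mathcomp Require Import all_boot all_order all_algebra.
From mathcomp Require Import all_classical all_reals all_analysis.

Set Implicit Arguments.
Unset Strict Implicit.
Unset Printing Implicit Defensive.

Import Order.TTheory GRing.Theory Num.Theory.
Import numFieldNormedType.Exports.

Local Open Scope classical_set_scope.
Local Open Scope ring_scope.

Definition Rpos {R : realType} : set R := `]0, +oo[%classic.
Definition Rnneg {R : realType} : set R := `[0, +oo[%classic.

Definition smooth {R : realType} (f : R -> R) : Prop :=
  forall (n : nat) (x : R), derivable (derive1n n f) x 1.

Definition test_function {R : realType} (phi : R -> R) : Prop :=
  smooth phi /\
  (let supp := closure [set x | phi x != 0] in compact supp /\ supp `<=` Rpos).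

Definition H10_norm {R : realType} (phi : R -> R) : R :=
  Num.sqrt (\int[lebesgue_measure]_(x in Rpos) derive1 phi x ^+ 2).

(* The completion of the test functions for H10_norm.  By Cauchy-Schwarz,
   `|phi x| <= Num.sqrt x * H10_norm phi for every test function phi and
   0 <= x, so a Cauchy sequence of test functions converges locally uniformly
   on [0, oo); its class in the completion is identified with the limit. *)
Definition in_H10 {R : realType} (u : R -> R) : Prop :=
  exists phi : nat -> R -> R,
    [/\ forall n, test_function (phi n),
        forall e : R, 0 < e -> exists N : nat, forall m n : nat,
          (N <= m)%N -> (N <= n)%N -> H10_norm (phi m \- phi n) < e
      & forall x, Rnneg x -> phi n x @[n --> \oo] --> u x].

Definition is_weak_derivative {R : realType} (u g : R -> R) : Prop :=
  locally_integrable Rpos g /\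
  forall phi : R -> R, test_function phi ->
    \int[lebesgue_measure]_(x in Rpos) (u x * derive1 phi x) =
    - \int[lebesgue_measure]_(x in Rpos) (g x * phi x).

(* A representative of the weak derivative on (0, oo), which is unique up to
   equality almost everywhere; the zero function if there is none. *)
Definition weak_derivative {R : realType} (u : R -> R) : R -> R :=
  xget (cst 0) [set g | is_weak_derivative u g].

Definition admissible {R : realType} (beta : R) : set (R -> R) :=
  [set theta | {within Rnneg, continuous theta} /\
               in_H10 (fun x => theta x - beta)].

Definition cutoff {R : realType} (beta : R) (eta : R -> R) : Prop :=
  [/\ smooth eta,
      forall x, 0 <= eta x <= beta,
      forall x, x <= 0 -> eta x = beta,
      forall x, 1 <= x -> eta x = 0
    & forall x, derive1 eta x <= 0].

(* The value of the integrand at x = y is 0, since 0^-1 = 0. *)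
Definition gagliardo {R : realType} (f : R -> R) : \bar R :=
  (\int[lebesgue_measure]_(x in Rpos) \int[lebesgue_measure]_(y in Rpos)
     ((f x - f y) ^+ 2 / (x - y) ^+ 2)%:E)%E.

Definition energy {R : realType} (nu beta : R) (eta theta : R -> R) : \bar R :=
  (\int[lebesgue_measure]_(x in Rpos)
     (2^-1 * weak_derivative theta x ^+ 2 + 2^-1 * sin (theta x) ^+ 2
      + nu / (4 * pi)
        * ((sin (theta x - beta) ^+ 2 - sin (eta x - beta) ^+ 2) / x))%R%:E
   + (nu / (8 * pi))%R%:E * gagliardo (fun x => sin (theta x - beta)%R)
   - (nu / (8 * pi))%R%:E * gagliardo (fun x => sin (eta x - beta)%R))%E.

Definition minimizer {R : realType} (nu beta : R) (eta theta : R -> R) : Prop :=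
  admissible beta theta /\
  energy nu beta eta theta =
    ereal_inf [set energy nu beta eta t | t in admissible beta].

(* Main.v *)
(* In the variable u = sin(theta - beta) the nonlocal and the 1/x terms of the
   energy are convex, and the kinetic term becomes (u')^2 / (1 - u^2), which is
   uniformly convex in u' for |u| <= 1/2; the anisotropy sin(theta)^2 is convex in
   u when beta is small.  A competitor shows that the infimum is O(beta^2), once
   the theta-independent terms are removed, and |theta'| |sin theta| being dominated
   by the local energy, cos theta stays within O(beta^2) of cos beta for every
   theta of such an energy; so theta is uniformly small and |u| <= 1/2.  On
   that sublevel the midpoint inequality for u makes minimizing sequences Cauchy and
   minimizers unique. *)
Require Import Defs.
From HB Require Import structures.
From mathcomp Require Import all_boot all_order all_algebra.
From mathcomp Require Import ring lra.
From mathcomp Require Import all_classical all_reals all_analysis.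
From mathcomp Require Import measurable_realfun.

Set Implicit Arguments.
Unset Strict Implicit.
Unset Printing Implicit Defensive.

Import Order.TTheory GRing.Theory Num.Theory.
Import numFieldNormedType.Exports.

Local Open Scope classical_set_scope.
Local Open Scope ring_scope.

(** * Square integrable functions *)

(** An admissible function is handled as a pair: [ac c u g] says that u is the primitive of a square
    integrable g starting from c. Passing from the completion to such pairs rests on the
    completeness of L^2; coming back, as every constructed competitor must, rests on the density of
    derivatives of test functions in L^2(0, oo).

    The energy has a signed local integrand. Up to an additive real number independent of theta it
    equals [reduced_energy], whose integrand is nonnegative, so that Fatou's lemma and comparison
    apply even to infinite values.

    Weak compactness is avoided: a plain multiple of p^2, with p = u', is set aside in the kinetic
    density and leaves the gain (p1 - p2)^2 / 16 in the midpoint inequality, hence strong L^2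
    convergence of p. The midpoint of two functions u is sent back to an angle by beta + asin; it
    satisfies |u| <= 1/2 whatever its energy.

    Levels: the competitor has energy at most K beta^2, the sublevel is taken at (K + 1) beta^2 to
    contain it strictly, and (3 K + 4) beta < 1 - cos(1/4) yields |theta| < 1/4 there. *)

Section fatou_le.
Context d (T : measurableType d) (R : realType).
Variables (mu : {measure set T -> \bar R}) (D : set T) (mD : measurable D).
Variable M : \bar R.

Section extended_valued.
Variables (f : (T -> \bar R)^nat) (g : T -> \bar R).
Hypothesis mf : forall n, measurable_fun D (f n).
Hypothesis f0 : forall n x, D x -> (0 <= f n x)%E.
Hypothesis mg : measurable_fun D g.
Hypothesis g0 : forall x, D x -> (0 <= g x)%E.
Hypothesis gf : {ae mu, forall x, D x -> (g x <= limn_einf (f ^~ x))%E}.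
Hypothesis fM : \forall n \near \oo, (\int[mu]_(x in D) f n x <= M)%E.

(** Fatou's lemma as lower semicontinuity: it is enough that g lies below the liminf almost
    everywhere, as limits of derivatives exist only almost everywhere, and that M bounds the
    integrals eventually. *)
Lemma fatou_ae_le : (\int[mu]_(x in D) g x <= M)%E.
Proof.
have mlim : measurable_fun D (fun x => limn_einf (f ^~ x)).
  rewrite /limn_einf; apply: measurableT_comp => //.
  by apply: measurable_fun_limn_esup => n; apply: measurableT_comp (mf n).
apply: (@le_trans _ _ (\int[mu]_(x in D) limn_einf (f ^~ x))%E).
  apply: ae_ge0_le_integral => // x Dx; rewrite limn_einf_lim.
  apply: lime_ge; first exact: is_cvg_einfs.
  by apply: nearW => n; apply: le_ereal_inf_tmp => _ [m _ <-]; exact: f0.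
apply: (le_trans (fatou mu mD mf f0)).
rewrite limn_einf_lim; apply: lime_le; first exact: is_cvg_einfs.
case: fM => N _ leM; apply: nearW => n.
apply: (le_trans _ (leM (maxn N n) (leq_maxl _ _))).
by apply: ereal_inf_lbound; exists (maxn N n) => //=; exact: leq_maxr.
Qed.

End extended_valued.

Section real_valued.
Variables (f : (T -> R)^nat) (g : T -> R).
Hypothesis mf : forall n, measurable_fun D (f n).
Hypothesis f0 : forall n x, D x -> 0 <= f n x.
Hypothesis mg : measurable_fun D g.
Hypothesis g0 : forall x, D x -> 0 <= g x.
Hypothesis fg : {ae mu, forall x, D x -> f n x @[n --> \oo] --> g x}.
Hypothesis fM : \forall n \near \oo, (\int[mu]_(x in D) (f n x)%:E <= M)%E.

Lemma fatou_cvg_le : (\int[mu]_(x in D) (g x)%:E <= M)%E.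
Proof.
apply: (@fatou_ae_le (fun n x => (f n x)%:E)) => //.
- by move=> n; exact/measurable_EFinP.
- exact/measurable_EFinP.
- apply: filterS fg => x fgx Dx.
  have /cvg_limn_einf_sup[-> _] : (f n x)%:E @[n --> \oo] --> (g x)%:E.
    by apply: cvg_EFin; [exact: nearW | exact: fgx].
  by [].
Qed.

End real_valued.

End fatou_le.

Lemma geometric_increments_cvg {R : realType} (a : nat -> R) (K : R) :
  (forall n, `|a n.+1 - a n| <= K * 2^-1 ^+ n) -> cvgn a.
Proof.
move=> aK.
have -> : a = (fun n => a 0%N + series (telescope a) n).
  by apply/funext => n; exact: eq_sum_telescope.
apply: is_cvgD; first exact: is_cvg_cst.
apply: normed_cvg; apply: (@series_le_cvg _ _ (geometric K 2^-1)) => [n|n|n|].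
- exact: normr_ge0.
- exact: le_trans (aK n).
- exact: aK.
- by apply: is_cvg_geometric_series; rewrite ger0_norm ?invr_ge0// invf_lt1 ?ltr1n.
Qed.

Section square_integrable.
Context {d} {T : measurableType d} {R : realType}.
Variables (mu : {measure set T -> \bar R}) (D : set T).
Hypothesis mD : measurable D.

Definition sqint (f : T -> R) :=
  measurable_fun D f /\ mu.-integrable D (fun x => (f x ^+ 2)%:E).

Definition sqnorm (f : T -> R) := \int[mu]_(x in D) (f x ^+ 2).

Implicit Types f g : T -> R.

Lemma sqnorm_ge0 f : 0 <= sqnorm f.
Proof. by apply: Rintegral_ge0 => x _; exact: sqr_ge0. Qed.

Lemma sqintP f : measurable_fun D f ->
  sqint f <-> (\int[mu]_(x in D) (f x ^+ 2)%:E < +oo)%E.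
Proof.
move=> mf; split.
  by move=> [_ /integrable_lty]; exact.
move=> foo; split => //; apply/integrableP; split.
  by apply/measurable_EFinP; exact: measurable_funX.
rewrite [ltLHS](_ : _ = (\int[mu]_(x in D) (f x ^+ 2)%:E)%E)//.
by apply: eq_integral => x _; rewrite gee0_abs// lee_fin sqr_ge0.
Qed.

Lemma sqnormE f : sqint f -> (\int[mu]_(x in D) (f x ^+ 2)%:E)%E = (sqnorm f)%:E.
Proof. by move=> [mf fi]; rewrite /sqnorm fineK//; exact: integrable_fin_num. Qed.

Lemma sqint_mul f g : sqint f -> sqint g ->
  mu.-integrable D (fun x => (f x * g x)%:E).
Proof.
move=> [mf fi] [mg gi].
apply: (@le_integrable _ _ _ mu D mD _ (fun x => (f x ^+ 2)%:E + (g x ^+ 2)%:E)%E).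
- by apply/measurable_EFinP; exact: measurable_funM.
- move=> x Dx; rewrite -EFinD lee_fin [leRHS]ger0_norm ?addr_ge0 ?sqr_ge0//.
  rewrite normrM; have := sqr_ge0 (`|f x| - `|g x|).
  rewrite -(real_normK (num_real (f x))) -(real_normK (num_real (g x))).
  by have := normr_ge0 (f x); have := normr_ge0 (g x); nra.
- exact: integrableD.
Qed.

Lemma sqintD f g : sqint f -> sqint g -> sqint (fun x => f x + g x).
Proof.
move=> sf sg; have [mf fi] := sf; have [mg gi] := sg.
split; first exact: measurable_funD.
apply: (@eq_integrable _ _ _ mu D mD
  (fun x => ((f x ^+ 2)%:E + (g x ^+ 2)%:E) + 2%:E * (f x * g x)%:E)%E).
  by move=> x _; rewrite -EFinM -!EFinD; congr EFin; ring.
apply: integrableD => //; first exact: integrableD.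
by apply: integrableZl => //; exact: sqint_mul.
Qed.

Lemma sqintZ (c : R) f : sqint f -> sqint (fun x => c * f x).
Proof.
move=> [mf fi]; split; first exact: measurable_funM.
apply: (@eq_integrable _ _ _ mu D mD (fun x => (c ^+ 2)%:E * (f x ^+ 2)%:E)%E).
  by move=> x _; rewrite -EFinM; congr EFin; ring.
exact: integrableZl.
Qed.

Lemma sqint_eq f g : {in D, f =1 g} -> sqint f -> sqint g.
Proof.
move=> fg [mf fi]; split; first exact: eq_measurable_fun mf.
by apply: eq_integrable fi => // x xD; rewrite fg.
Qed.

Lemma sqintB f g : sqint f -> sqint g -> sqint (fun x => f x - g x).
Proof.
move=> sf sg; apply: (@sqint_eq (fun x => f x + (-1) * g x)).
  by move=> x _; rewrite mulN1r.
exact: sqintD sf (sqintZ _ sg).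
Qed.

Lemma sqint0 : sqint (fun _ => 0).
Proof.
split => //; apply: (@eq_integrable _ _ _ mu D mD (cst 0%E)).
  by move=> x _; rewrite expr0n.
exact: integrable0.
Qed.

Lemma sqnormZ (c : R) f : sqint f -> sqnorm (fun x => c * f x) = c ^+ 2 * sqnorm f.
Proof.
move=> [mf fi]; rewrite /sqnorm -RintegralZl//.
by apply: eq_Rintegral => x _; ring.
Qed.

Lemma integrableZl_EFin (c : R) f : mu.-integrable D (EFin \o f) ->
  mu.-integrable D (fun x => (c * f x)%:E).
Proof.
by move=> fi; apply: (@eq_integrable _ _ _ mu D mD (fun x => c%:E * (f x)%:E)%E);
  [move=> x _; rewrite EFinM | exact: integrableZl].
Qed.

Lemma integrableD_EFin f g : mu.-integrable D (EFin \o f) ->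
  mu.-integrable D (EFin \o g) -> mu.-integrable D (fun x => (f x + g x)%:E).
Proof.
move=> fi gi; apply: (@eq_integrable _ _ _ mu D mD (fun x => (f x)%:E + (g x)%:E)%E).
  by move=> x _; rewrite EFinD.
exact: integrableD.
Qed.

Lemma integrableB_EFin f g : mu.-integrable D (EFin \o f) ->
  mu.-integrable D (EFin \o g) -> mu.-integrable D (fun x => (f x - g x)%:E).
Proof.
move=> fi gi; apply: (@eq_integrable _ _ _ mu D mD (fun x => (f x)%:E - (g x)%:E)%E).
  by move=> x _; rewrite EFinB.
exact: integrableB.
Qed.

Lemma sqnormD f g : sqint f -> sqint g ->
  sqnorm (fun x => f x + g x) =
  sqnorm f + 2 * \int[mu]_(x in D) (f x * g x) + sqnorm g.
Proof.
move=> sf sg; have [mf fi] := sf; have [mg gi] := sg; have fg := sqint_mul sf sg.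
rewrite /sqnorm -RintegralZl// -RintegralD//; last exact: integrableZl_EFin.
rewrite -RintegralD//; last by apply: integrableD_EFin => //; exact: integrableZl_EFin.
by apply: eq_Rintegral => x _; ring.
Qed.

Lemma sqnormDZ (t : R) f g : sqint f -> sqint g ->
  sqnorm (fun x => f x + t * g x) =
  sqnorm f + 2 * t * \int[mu]_(x in D) (f x * g x) + t ^+ 2 * sqnorm g.
Proof.
move=> sf sg; rewrite sqnormD ?sqnormZ//; last exact: sqintZ.
congr (_ + _ + _); rewrite -mulrA; congr (_ * _).
rewrite -RintegralZl//; last exact: sqint_mul.
by apply: eq_Rintegral => x _; ring.
Qed.

Lemma sqnormB f g : sqint f -> sqint g ->
  sqnorm (fun x => f x - g x) =
  sqnorm f - 2 * \int[mu]_(x in D) (f x * g x) + sqnorm g.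
Proof.
move=> sf sg; rewrite [LHS](_ : _ = sqnorm (fun x => f x + (-1) * g x)).
  by rewrite sqnormDZ//; ring.
by apply: eq_Rintegral => x _; rewrite mulN1r.
Qed.

Lemma sqnorm_triangle f g : sqint f -> sqint g ->
  sqnorm (fun x => f x + g x) <= 2 * sqnorm f + 2 * sqnorm g.
Proof.
move=> sf sg.
have := sqnorm_ge0 (fun x => f x - g x); rewrite sqnormB// sqnormD//; lra.
Qed.

(** The discriminant criterion, source of Cauchy-Schwarz and of the near orthogonality in Riesz'
    projection argument. For 0 < c the polynomial is evaluated at its minimum - b / c. *)
Lemma quad_ge0 (a b c : R) :
  (forall t, 0 <= a + 2 * t * b + t ^+ 2 * c) -> b ^+ 2 <= a * c.
Proof.
move=> h; have [c0|c0|c0] := ltrgt0P c.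
- have := h (- b / c).
  have -> : a + 2 * (- b / c) * b + (- b / c) ^+ 2 * c = a - b ^+ 2 / c.
    by field; rewrite gt_eqF.
  by rewrite subr_ge0 ler_pdivrMr.
- have a0 : 0 <= a by have := h 0; lra.
  have t2 : 1 + (a + 1) / - c >= 1 by rewrite lerDl divr_ge0 ?oppr_ge0 ?(ltW c0)//; lra.
  have cm : (a + 1) / - c * c = - (a + 1) by field; rewrite lt_eqF.
  set s := (a + 1) / - c in t2 cm.
  have s1 : (1 + s) ^+ 2 * c <= (1 + s) * c by rewrite ler_nM2r//; nra.
  (* The values at 1 + s and - (1 + s) add up to at most 2 (c - 1) < 0, as the linear terms
     cancel. *)
  have := h (1 + s); have := h (- (1 + s)); nra.
- rewrite c0 mulr0; have [->|b0] := eqVneq b 0; first by rewrite expr0n.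
  have := h ((- a - 1) / (2 * b)); rewrite c0.
  have -> : a + 2 * ((- a - 1) / (2 * b)) * b + ((- a - 1) / (2 * b)) ^+ 2 * 0 = -1.
    by field.
  by rewrite oppr_ge0 ler10.
Qed.

Lemma cauchy_schwarz f g : sqint f -> sqint g ->
  (\int[mu]_(x in D) (f x * g x)) ^+ 2 <= sqnorm f * sqnorm g.
Proof.
move=> sf sg; apply: quad_ge0 => t; rewrite -sqnormDZ//; exact: sqnorm_ge0.
Qed.

Definition sqcauchy (f : nat -> T -> R) := forall e : R, 0 < e ->
  exists N, forall m n, (N <= m)%N -> (N <= n)%N ->
    sqnorm (fun x => f m x - f n x) < e.

Lemma sqcauchy_subseq (f : nat -> T -> R) (eps : nat -> R) :
  (forall n, 0 < eps n) -> sqcauchy f ->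
  exists k : nat -> nat, (forall n, (n <= k n)%N) /\
    forall n, sqnorm (fun x => f (k n.+1) x - f (k n) x) < eps n.
Proof.
move=> eps0 fC.
have /choice[N NP] n : exists N, forall p q, (N <= p)%N -> (N <= q)%N ->
    sqnorm (fun x => f p x - f q x) < eps n by exact: fC.
pose k := fix k n := if n is m.+1 then maxn (k m).+1 (N n) else N 0%N.
have kN n : (N n <= k n)%N by case: n => //= n; exact: leq_maxr.
have kS n : (k n < k n.+1)%N by rewrite /=; exact: leq_maxl.
exists k; split.
  by elim=> // n IH; exact: leq_ltn_trans IH (kS n).
by move=> n; apply: NP => //; apply: leq_trans (kN n) (ltnW (kS n)).
Qed.

(** The series of 4^n (f (n + 1) - f n)^2 has integral at most the sum of the 2^-(n + 1), so its sum
    S is finite almost everywhere; wherever it is, the n-th increment is at most sqrt S / 2^n. *)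
Lemma ae_cvg_fast (f : nat -> T -> R) : (forall n, sqint (f n)) ->
  (forall n, sqnorm (fun x => f n.+1 x - f n x) < (4 ^+ n * 2 ^+ n.+1)^-1) ->
  {ae mu, forall x, D x -> cvgn (f ^~ x)}.
Proof.
move=> fs fast.
pose h n x := (4 ^+ n * (f n.+1 x - f n x) ^+ 2)%:E.
have h0 n x : (0 <= h n x)%E by rewrite lee_fin mulr_ge0 ?sqr_ge0 ?exprn_ge0.
have ds n : sqint (fun x => f n.+1 x - f n x) by exact: sqintB.
have mh n : measurable_fun D (h n).
  apply/measurable_EFinP; apply: measurable_funM => //.
  by apply: measurable_funX; have [] := ds n.
have hoo : (\int[mu]_(x in D) (\sum_(n <oo) h n x) < +oo)%E.
  rewrite integral_nneseries//; apply: (@le_lt_trans _ _ 1%:E); last exact: ltry.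
  apply: le_trans (epsilon_trick0 xpredT ler01).
  apply: lee_nneseries => [n _ _|n _]; first by apply: integral_ge0 => x _; exact: h0.
  rewrite /h; under eq_integral do rewrite EFinM.
  rewrite ge0_integralZl_EFin//; last 2 first.
  - by move=> x _; rewrite lee_fin sqr_ge0.
  - by apply/measurable_EFinP/measurable_funX; have [] := ds n.
  rewrite sqnormE// -EFinM lee_fin; apply: le_trans (ler_wpM2l _ (ltW (fast n))) _.
    by rewrite exprn_ge0.
  by rewrite invfM mulrA divff ?mul1r ?natrX// expf_neq0.
have hi : mu.-integrable D (fun x => \sum_(n <oo) h n x)%E.
  apply/integrableP; split; first exact: ge0_emeasurable_sum.
  by under eq_integral do rewrite gee0_abs ?nneseries_ge0//.
have := integrable_ae mD hi; apply: filterS => x /[apply] sfin.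
pose S := fine (\sum_(n <oo) h n x)%E.
have hS n : 4 ^+ n * (f n.+1 x - f n x) ^+ 2 <= S.
  rewrite -lee_fin /S fineK//.
  apply: le_trans (nneseries_lim_ge n.+1 (fun i _ _ => h0 i x)).
  by rewrite big_nat_recr//= leeDr// sume_ge0.
apply: (@geometric_increments_cvg _ _ (Num.sqrt S)) => n.
rewrite exprVn ler_pdivlMr ?exprn_gt0//.
have -> : `|f n.+1 x - f n x| * 2 ^+ n =
    Num.sqrt (4 ^+ n * (f n.+1 x - f n x) ^+ 2).
  rewrite [4](_ : _ = 2 ^+ 2); last by rewrite expr2 -natrM.
  rewrite exprAC -exprMn sqrtr_sqr normrM mulrC ger0_norm//.
by rewrite ler_wsqrtr.
Qed.

(** The limit is found along a fast subsequence. Fatou's lemma with the first index fixed then turns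
    the Cauchy bound into a bound on f m - g, which gives both the square integrability of g and the
    convergence of the whole sequence. *)
Theorem riesz_fischer (f : nat -> T -> R) : (forall n, sqint (f n)) -> sqcauchy f ->
  exists (g : T -> R) (k : nat -> nat), [/\ sqint g, forall n, (n <= k n)%N,
    {ae mu, forall x, D x -> f (k n) x @[n --> \oo] --> g x} &
    sqnorm (fun x => f n x - g x) @[n --> \oo] --> 0].
Proof.
move=> fs fC.
have [k [kn kfast]] := @sqcauchy_subseq f (fun n => (4 ^+ n * 2 ^+ n.+1)^-1)
  (fun n => ltac:(by rewrite invr_gt0 mulr_gt0 ?exprn_gt0)) fC.
have ks n : sqint (f (k n)) by exact: fs.
(* A limsup is measurable, and it is the limit wherever there is one; the values changed by [fine]
   lie, within D, in a null set. *)
pose g x := fine (limn_esup (fun n => (f (k n) x)%:E)).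
have mg : measurable_fun D g.
  apply: measurableT_comp => //; apply: measurable_fun_limn_esup => n.
  by apply/measurable_EFinP; have [] := ks n.
have kg : {ae mu, forall x, D x -> f (k n) x @[n --> \oo] --> g x}.
  apply: filterS (ae_cvg_fast ks kfast) => x /[apply] /cvg_ex[/= l fl].
  suff -> : g x = l by [].
  have /cvg_limn_einf_sup[_ gl] : (f (k n) x)%:E @[n --> \oo] --> l%:E.
    by apply: cvg_EFin; [exact: nearW | exact: fl].
  by rewrite /g gl.
have close e : 0 < e -> exists N, forall m, (N <= m)%N ->
    (\int[mu]_(x in D) ((f m x - g x) ^+ 2)%:E <= e%:E)%E.
  move=> /fC[N NP]; exists N => m Nm.
  apply: (@fatou_cvg_le _ _ _ mu D mD _ (fun n x => (f m x - f (k n) x) ^+ 2)).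
  - by move=> n; have [] := sqintB (fs m) (ks n); move=> ? _; exact: measurable_funX.
  - by move=> n x _; exact: sqr_ge0.
  - by apply: measurable_funX; apply: measurable_funB => //; have [] := fs m.
  - by move=> x _; exact: sqr_ge0.
  - apply: filterS kg => x /[apply] fg; rewrite expr2; under eq_fun do rewrite expr2.
    by apply: cvgM; apply: cvgB => //; exact: cvg_cst.
  - exists N => // n /= Nn; rewrite sqnormE; last exact: sqintB.
    by rewrite lee_fin ltW// NP//; exact: leq_trans Nn (kn n).
have sg : sqint g.
  have [N /(_ N (leqnn _)) NP] := close 1 ltr01.
  have : sqint (fun x => f N x - g x).
    apply/sqintP; last exact: le_lt_trans NP (ltry _).
    by apply: measurable_funB => //; have [] := fs N.
  move=> /(sqintB (fs N)); apply: sqint_eq => x _ /=; ring.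
exists g, k; split => //.
apply/cvgrPdist_le => e /close[N NP]; exists N => // m /= /NP.
rewrite sqnormE; last exact: sqintB.
by rewrite sub0r normrN ger0_norm ?sqnorm_ge0.
Qed.


End square_integrable.

(** * Differentiation rules in one variable *)

Lemma derive1_val {R : realType} (f : R -> R) (x l : R) :
  is_derive x 1 f l -> derive1 f x = l.
Proof. by move=> h; rewrite derive1E; apply: derive_val. Qed.

Lemma is_derive1D {R : realType} (f g : R -> R) (x a b : R) :
  is_derive x 1 f a -> is_derive x 1 g b -> is_derive x 1 (fun y => f y + g y) (a + b).
Proof. by move=> hf hg; exact: is_deriveD. Qed.

Lemma is_derive1M {R : realType} (f g : R -> R) (x a b : R) :
  is_derive x 1 f a -> is_derive x 1 g b ->
  is_derive x 1 (fun y => f y * g y) (f x * b + g x * a).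
Proof. by move=> hf hg; exact: is_deriveM. Qed.

Lemma is_derive1Z {R : realType} (f : R -> R) (c x a : R) :
  is_derive x 1 f a -> is_derive x 1 (fun y => c * f y) (c * a).
Proof. by move=> hf; exact: is_deriveZ. Qed.

Lemma is_derive1_affine {R : realType} (f : R -> R) (c d x a : R) :
  is_derive (c * x + d) 1 f a -> is_derive x 1 (fun y => f (c * y + d)) (c * a).
Proof.
move=> hf.
have hg : is_derive x 1 (fun y : R => c * y + d) c.
  rewrite -[c in is_derive _ _ _ c]addr0 -[c in c + 0]mulr1.
  by apply: (@is_derive1D _ (fun y => c * y) (fun=> d)); exact: is_derive1Z.
by rewrite mulrC; exact: (@is_derive1_comp _ f (fun y => c * y + d)).
Qed.

(** * Test functions *)

Section finite_smoothness.
Context {R : realType}.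
Implicit Types f g : R -> R.

(** Smoothness truncated at order n, so that closure under products can be proved by induction on
    the order: the derivative of a product is a sum of products of one order less. *)
Definition times_derivable (n : nat) f :=
  forall k x, (k <= n)%N -> derivable (derive1n k f) x 1.

Lemma smooth_times f : (forall n, times_derivable n f) <-> smooth f.
Proof. by split=> [h n x | h n k x _]; [exact: h (leqnn n) | exact: h]. Qed.

Lemma times_derivableS n f :
  times_derivable n.+1 f <->
  (forall x : R, derivable f x 1) /\ times_derivable n (derive1 f).
Proof.
split=> [h|[d h]].
  split=> [x|k x kn]; first exact: (h 0%N).
  by rewrite -derive1Sn; exact: h.
by case=> [|k] x kn; [exact: d | rewrite derive1Sn; exact: h].
Qed.

Lemma times_derivableW n f : times_derivable n.+1 f -> times_derivable n f.
Proof. by move=> h k x kn; apply: h; exact: leqW. Qed.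

Lemma times_derivable0 f : times_derivable 0 f <-> forall x : R, derivable f x 1.
Proof.
by split=> [h x | h k x]; [exact: (h 0%N) | rewrite leqn0 => /eqP ->; exact: h].
Qed.

Lemma times_derivable_is n f (df : R -> R) : (forall x : R, is_derive x 1 f (df x)) ->
  times_derivable n df -> times_derivable n.+1 f.
Proof.
move=> fd dfn; apply/times_derivableS; split=> [x|].
  by have [] := fd x.
by rewrite (_ : derive1 f = df)//; apply/funext => x; exact: derive1_val.
Qed.

Lemma times_derivable_is0 f (df : R -> R) : (forall x : R, is_derive x 1 f (df x)) ->
  times_derivable 0 f.
Proof. by move=> fd; apply/times_derivable0 => x; have [] := fd x. Qed.

Lemma derivable_is f (x : R) : derivable f x 1 -> is_derive x 1 f (derive1 f x).
Proof. by move=> h; rewrite derive1E; exact: derivableP. Qed.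

Lemma times_derivableD n f g : times_derivable n f -> times_derivable n g ->
  times_derivable n (fun x => f x + g x).
Proof.
elim: n f g => [|n IH] f g.
  move=> /times_derivable0 hf /times_derivable0 hg.
  apply: (@times_derivable_is0 _ (fun x => derive1 f x + derive1 g x)) => x.
  by apply: is_derive1D; exact: derivable_is.
move=> /times_derivableS[df hf] /times_derivableS[dg hg].
apply: (@times_derivable_is _ _ (fun x => derive1 f x + derive1 g x)) => [x|].
  by apply: is_derive1D; exact: derivable_is.
exact: IH.
Qed.

Lemma times_derivableM n f g : times_derivable n f -> times_derivable n g ->
  times_derivable n (fun x => f x * g x).
Proof.
elim: n f g => [|n IH] f g.
  move=> /times_derivable0 hf /times_derivable0 hg.
  apply: (@times_derivable_is0 _ (fun x => f x * derive1 g x + g x * derive1 f x)) => x.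
  by apply: is_derive1M; exact: derivable_is.
move=> nf ng; have /times_derivableS[df hf] := nf.
have /times_derivableS[dg hg] := ng.
apply: (@times_derivable_is _ _ (fun x => f x * derive1 g x + g x * derive1 f x)) => [x|].
  by apply: is_derive1M; exact: derivable_is.
exact: times_derivableD (IH _ _ (times_derivableW nf) hg) (IH _ _ (times_derivableW ng) hf).
Qed.

Lemma times_derivable_cst n (c : R) : times_derivable n (fun _ => c).
Proof.
elim: n c => [|n IH] c; first by apply: (@times_derivable_is0 _ (fun=> 0)).
exact: (@times_derivable_is _ _ (fun=> 0)).
Qed.

Lemma times_derivableZ n (c : R) f : times_derivable n f ->
  times_derivable n (fun x => c * f x).
Proof. exact/times_derivableM/times_derivable_cst. Qed.

Lemma times_derivable_affine n (c d : R) f : times_derivable n f ->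
  times_derivable n (fun x => f (c * x + d)).
Proof.
elim: n f => [|n IH] f.
  move=> /times_derivable0 hf.
  apply: (@times_derivable_is0 _ (fun x => c * derive1 f (c * x + d))) => x.
  by apply: is_derive1_affine; exact: derivable_is.
move=> /times_derivableS[df hf].
apply: (@times_derivable_is _ _ (fun x => c * derive1 f (c * x + d))) => [x|].
  by apply: is_derive1_affine; exact: derivable_is.
exact/times_derivableZ/IH.
Qed.

End finite_smoothness.

Section smooth_closure.
Context {R : realType}.
Implicit Types f g : R -> R.

Lemma smoothD f g : smooth f -> smooth g -> smooth (fun x => f x + g x).
Proof.
by move=> /smooth_times hf /smooth_times hg; apply/smooth_times => n;
  exact: times_derivableD.
Qed.

Lemma smoothM f g : smooth f -> smooth g -> smooth (fun x => f x * g x).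
Proof.
by move=> /smooth_times hf /smooth_times hg; apply/smooth_times => n;
  exact: times_derivableM.
Qed.

Lemma smooth_cst (c : R) : smooth (fun _ : R => c).
Proof. by apply/smooth_times => n; exact: times_derivable_cst. Qed.

Lemma smooth_affine (c d : R) f : smooth f -> smooth (fun x => f (c * x + d)).
Proof.
by move=> /smooth_times hf; apply/smooth_times => n; exact: times_derivable_affine.
Qed.

Lemma smooth_derive1 f : smooth f -> smooth (derive1 f).
Proof. by move=> hf n x; rewrite -derive1Sn; exact: hf. Qed.

Lemma smooth_is f (df : R -> R) :
  (forall x : R, is_derive x 1 f (df x)) -> smooth df -> smooth f.
Proof.
move=> fd /smooth_times dfs; apply/smooth_times => -[|n].
  exact: times_derivable_is0 fd.
exact: times_derivable_is fd (dfs n).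
Qed.

Lemma smooth_derivable f (x : R) : smooth f -> derivable f x 1.
Proof. by move=> /(_ 0%N x). Qed.

Lemma smooth_continuous f : smooth f -> continuous f.
Proof. by move=> hf x; apply: differentiable_continuous; apply/derivable1_diffP; exact: smooth_derivable. Qed.

End smooth_closure.

(** * Smooth bumps built from exp(-1/x) *)

Section flat_exponential.
Context {R : realType}.
Implicit Types x : R.

(* Multiplying by powers of 1 / x makes the family closed under differentiation. *)
Definition flat_exp (n : nat) x := if 0 < x then x^-1 ^+ n * expR (- x^-1) else 0.

Lemma flat_exp_ge0 n x : 0 <= flat_exp n x.
Proof.
rewrite /flat_exp; case: ifPn => // x0.
by rewrite mulr_ge0 ?expR_ge0// exprn_ge0// invr_ge0 ltW.
Qed.

(** With t = 1/x this is t^(n + 2) / (n + 2)! <= e^t. Vanishing to second order at 0 is all that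
    differentiability there requires. *)
Lemma flat_exp_le n x : flat_exp n x <= (n.+2)`!%:R * x ^+ 2.
Proof.
rewrite /flat_exp; case: ifPn => x0; last by rewrite mulr_ge0// sqr_ge0.
have t0 : 0 < x^-1 by rewrite invr_gt0.
rewrite -[X in _ <= _ * X ^+ 2]invrK; move: x^-1 t0 => t t0.
rewrite exprVn ler_pdivlMr ?exprn_gt0// mulrAC -exprD addn2 expRN.
rewrite ler_pdivrMr ?expR_gt0// mulrC -ler_pdivrMr ?ltr0n ?fact_gt0//.
by apply: le_trans (expR_ge1Dxn n.+1 (ltW t0)); rewrite lerDr.
Qed.

(** Carathéodory's criterion: the slope f z / z is of order z, hence continuous at 0 with value
    0. *)
Lemma is_derive_flat0 (f : R -> R) (C : R) :
  (forall x, `|f x| <= C * x ^+ 2) -> is_derive (0 : R) 1 f 0.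
Proof.
move=> fC; have f0 : f 0 = 0.
  by apply/normr0_eq0/le_anti; rewrite normr_ge0 (le_trans (fC 0))// expr0n mulr0.
apply/is_derive1_caratheodory; exists (fun z => f z / z); split.
- move=> z; rewrite f0 !subr0; have [->|z0] := eqVneq z 0; first by rewrite mulr0.
  by rewrite divfK.
- rewrite /prop_for /continuous_at invr0 mulr0; apply/cvgrPdist_le => e e0.
  have C0 : 0 < `|C| + 1 by rewrite ltr_pwDr.
  near=> z; rewrite sub0r normrN.
  have [->|z0] := eqVneq z 0; first by rewrite invr0 mulr0 normr0 ltW.
  rewrite normrM normfV ler_pdivrMr ?normr_gt0//.
  apply: (le_trans (fC z)); apply: (@le_trans _ _ ((`|C| + 1) * (`|z| * `|z|))).
    rewrite -expr2 real_normK ?num_real// ler_wpM2r ?sqr_ge0//.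
    by rewrite (le_trans (ler_norm _))// lerDl.
  rewrite mulrA ler_wpM2r// mulrC -ler_pdivlMr//.
  near: z; have := @nbhs0_le _ R^o (e / (`|C| + 1)); apply; exact: divr_gt0.
- by rewrite invr0 mulr0.
Unshelve. all: by end_near. Qed.

Lemma is_derive_flat_exp n x :
  is_derive x 1 (flat_exp n) (- n%:R * flat_exp n.+1 x + flat_exp n.+2 x).
Proof.
have [x0|x0|->] := ltrgt0P x.
- rewrite {2 3}/flat_exp x0.
  apply: (@near_eq_is_derive _ _ _ (fun x : R => x^-1 ^+ n * expR (- x^-1))).
    near=> y; rewrite /flat_exp ifT//; near: y; exact: lt_nbhsr.
  have dV : is_derive x 1 (fun y : R => y^-1) (- x ^- 2).
    rewrite -[- x ^- 2]mulr1.
    exact: (@is_deriveV R id x 1 1 (lt0r_neq0 x0) (is_derive_id _ _)).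
  have dX : is_derive x 1 (fun y : R => y^-1 ^+ n) (n%:R * x^-1 ^+ n.-1 * - x ^- 2).
    by have := @is_deriveX _ _ (fun y : R => y^-1) n x 1 _ dV; rewrite exprfctE.
  have dE := @is_derive1_comp R expR (fun y => - y^-1) x _ _ (is_derive_expR _) (is_deriveN dV).
  apply: (is_derive_eq (is_derive1M dX dE)).
  rewrite /= -exprVn; case: n {dX} => [|n] /=; rewrite ?exprS; ring.
- rewrite /flat_exp !ifN -?leNgt ?ltW// mulr0 addr0.
  apply: (@near_eq_is_derive _ _ _ (fun=> 0)) => //.
  near=> y; rewrite ifN// -leNgt ltW//; near: y; exact: lt_nbhsl.
- rewrite /flat_exp ltxx mulr0 addr0; apply: (@is_derive_flat0 _ ((n.+2)`!%:R)) => y.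
  by rewrite ger0_norm ?flat_exp_ge0// flat_exp_le.
Unshelve. all: by end_near. Qed.

Lemma smooth_flat_exp n : smooth (flat_exp n).
Proof.
apply/smooth_times => m; elim: m n => [|m IH] n.
  exact: times_derivable_is0 (is_derive_flat_exp n).
apply: times_derivable_is (is_derive_flat_exp n) _.
by apply: times_derivableD => //; exact: times_derivableZ.
Qed.

Lemma flat_exp0_le1 x : flat_exp 0 x <= 1.
Proof.
rewrite /flat_exp; case: ifPn => // x0; rewrite expr0 mul1r -expR0 ler_expR.
by rewrite oppr_le0 invr_ge0 ltW.
Qed.

(** Positive exactly on (a, b); the factor m + 1 steepens both flanks, so that these bumps tend to
    the indicator of (a, b) as m grows. *)
Definition flat_bump (m : nat) (a b x : R) : R :=
  flat_exp 0 (m.+1%:R * x - m.+1%:R * a) * flat_exp 0 (- m.+1%:R * x + m.+1%:R * b).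

Lemma smooth_bump m a b : smooth (flat_bump m a b).
Proof. by apply: smoothM; apply: smooth_affine; exact: smooth_flat_exp. Qed.

Lemma bump_ge0 m a b x : 0 <= flat_bump m a b x.
Proof. by rewrite mulr_ge0 ?flat_exp_ge0. Qed.

Lemma bump_le1 m a b x : flat_bump m a b x <= 1.
Proof. by rewrite mulr_ile1 ?flat_exp_ge0 ?flat_exp0_le1. Qed.

Lemma bumpE m a b x : flat_bump m a b x =
  flat_exp 0 (m.+1%:R * (x - a)) * flat_exp 0 (m.+1%:R * (b - x)).
Proof. by rewrite /flat_bump mulNr !mulrBr [- _ + _]addrC. Qed.

Lemma bump_in m a b x : a < x < b ->
  flat_bump m a b x = expR (- (m.+1%:R * (x - a))^-1) * expR (- (m.+1%:R * (b - x))^-1).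
Proof.
move=> /andP[ax xb]; rewrite bumpE /flat_exp.
by rewrite !pmulr_rgt0 ?ltr0n// !subr_gt0 ax xb !expr0 !mul1r.
Qed.

Lemma bump_out m a b x : ~~ (a < x < b) -> flat_bump m a b x = 0.
Proof.
rewrite negb_and -!leNgt => /orP[xa|bx]; rewrite bumpE /flat_exp.
  by rewrite ifN ?mul0r// pmulr_rgt0 ?ltr0n// subr_gt0 -leNgt.
by rewrite mulrC ifN ?mul0r// pmulr_rgt0 ?ltr0n// subr_gt0 -leNgt.
Qed.

Lemma cvg_bump a b x : flat_bump m a b x @[m --> \oo] --> (\1_(`]a, b[%classic) x : R).
Proof.
rewrite indicE mem_setE in_itv/=; have [h|h] := boolP (a < x < b); last first.
  by under eq_fun do rewrite bump_out//; exact: cvg_cst.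
have /andP[ax xb] := h.
under eq_fun do rewrite bump_in//.
have c0 (c : R) : 0 < c -> expR (- (m.+1%:R * c)^-1) @[m --> \oo] --> (1 : R).
  move=> c0; suff : expR (- (m.+1%:R * c)^-1) @[m --> \oo] --> expR (- (0 * c^-1)).
    by rewrite mul0r oppr0 expR0.
  apply: continuous_cvg; first exact: continuous_expR.
  apply: cvgN; under eq_fun do rewrite invfM.
  by apply: cvgM; [exact: cvg_harmonic | exact: cvg_cst].
have xa0 : 0 < x - a by rewrite subr_gt0.
have bx0 : 0 < b - x by rewrite subr_gt0.
have h1 := cvgM (c0 _ xa0) (c0 _ bx0); rewrite mulr1 in h1; exact: h1.
Qed.

End flat_exponential.

Section test_functions.
Context {R : realType}.
Implicit Types f g phi : R -> R.

Lemma test_function_supp phi (a b : R) : smooth phi -> 0 < a ->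
  (forall x, ~~ (a <= x <= b) -> phi x = 0) -> test_function phi.
Proof.
move=> sphi a0 h; split=> //=.
have sub : closure [set x | phi x != 0] `<=` `[a, b].
  rewrite [X in _ `<=` X](closure_id _).1; last exact: itv_closed.
  apply: closure_subset => x /=; rewrite in_itv/=; apply: contraR => /h ->.
  by rewrite eqxx.
split; first by apply: (subclosed_compact _ (@segment_compact _ a b)) => //; exact: closed_closure.
apply: (subset_trans sub) => x /=; rewrite /Rpos/= !in_itv/= andbT => /andP[+ _].
exact: lt_le_trans.
Qed.

(** With c and d the extreme points of the support, the interval is (c / 2, d + 1): it stays away
    from 0, and the margins make phi vanish at its endpoints too. *)
Lemma test_functionP phi : test_function phi -> smooth phi /\
  exists a b : R, [/\ 0 < a, a < b & forall x, ~~ (a < x < b) -> phi x = 0].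
Proof.
move=> [sphi /= [cphi pphi]]; split=> //.
set K := closure _ in cphi pphi.
have phiK x : ~ K x -> phi x = 0.
  by move=> Kx; apply: contra_notP Kx => /eqP phix; exact: subset_closure.
have [K0|/nonemptyPn Kn0] := pselect (K !=set0); last first.
  by exists 1, 2; split=> // [|x _]; [rewrite ltr1n|apply: phiK; rewrite Kn0].
have idc : {within K, continuous (@idfun R)} by apply: continuous_subspaceT => x; exact: cvg_id.
have [c cK cmin] := compact_EVT_min K0 cphi idc.
have [d dK dmax] := compact_EVT_max K0 cphi idc.
have c0 : 0 < c by have := pphi _ (set_mem cK); rewrite /Rpos/= in_itv/= andbT.
exists (c / 2), (d + 1); split; first exact: divr_gt0.
  have : c <= d by apply: cmin.
  by lra.
move=> x xcd; apply: phiK => Kx; move/negP: xcd; apply.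
have /= cx := cmin x (mem_set Kx); have /= xd := dmax x (mem_set Kx).
by apply/andP; split; lra.
Qed.

Lemma test_functionD f g : test_function f -> test_function g ->
  test_function (fun x => f x + g x).
Proof.
move=> /test_functionP[sf [a [b [a0 ab fab]]]] /test_functionP[sg [c [d [c0 cd gcd]]]].
apply: (@test_function_supp _ (Num.min a c) (Num.max b d)).
- exact: smoothD.
- by rewrite lt_min a0 c0.
- move=> x xout; rewrite fab ?gcd ?addr0//; apply: contra xout => /andP[h1 h2].
  + by rewrite ge_min le_max (ltW h1) (ltW h2) !orbT.
  + by rewrite ge_min le_max (ltW h1) (ltW h2).
Qed.

Lemma test_functionZ (k : R) f : test_function f -> test_function (fun x => k * f x).
Proof.
move=> /test_functionP[sf [a [b [a0 ab fab]]]].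
apply: (@test_function_supp _ a b); [|exact: a0|].
  by apply: smoothM; [exact: smooth_cst|exact: sf].
move=> x xout; rewrite fab ?mulr0//; apply: contra xout => /andP[h1 h2].
by rewrite !ltW.
Qed.

Lemma test_functionB f g : test_function f -> test_function g ->
  test_function (fun x => f x - g x).
Proof.
move=> tf tg; rewrite (_ : (fun x => _) = (fun x => f x + (-1) * g x)).
  by apply: test_functionD => //; exact: test_functionZ.
by apply/funext => x; rewrite mulN1r.
Qed.

Lemma test_function0 : test_function (fun _ : R => 0).
Proof. by apply: (@test_function_supp _ 1 1); [exact: smooth_cst|exact: ltr01|]. Qed.

Lemma test_function_bump m (a b : R) : 0 < a -> test_function (flat_bump m a b).
Proof.
move=> a0; apply: (@test_function_supp _ a b); [exact: smooth_bump|exact: a0|].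
by move=> x xout; apply: bump_out; apply: contra xout => /andP[h1 h2]; rewrite !ltW.
Qed.

Lemma derive1_out phi (a b : R) : (forall x, ~~ (a < x < b) -> phi x = 0) ->
  forall x, ~~ (a <= x <= b) -> derive1 phi x = 0.
Proof.
move=> h x; rewrite negb_and -!ltNge => xab; apply: derive1_val.
apply: (@near_eq_is_derive _ _ _ (fun=> 0)) => //; case/orP: xab => [xa|bx].
- near=> y; rewrite h// negb_and -!leNgt; apply/orP; left; apply: ltW.
  by near: y; exact: lt_nbhsl.
- near=> y; rewrite h// negb_and -!leNgt; apply/orP; right; apply: ltW.
  by near: y; exact: lt_nbhsr.
Unshelve. all: by end_near. Qed.

Lemma test_function_derive1 phi : test_function phi -> test_function (derive1 phi).
Proof.
move=> /test_functionP[sf [a [b [a0 ab fab]]]].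
by apply: (@test_function_supp _ a b); [exact: smooth_derive1|exact: a0|exact: derive1_out].
Qed.

Lemma test_function_continuous phi : test_function phi -> continuous phi.
Proof. by move=> [sphi _]; exact: smooth_continuous. Qed.

End test_functions.

Lemma measurable_Rpos {R : realType} : measurable (@Rpos R : set (measurableTypeR R)).
Proof. exact: measurable_itv. Qed.
#[global] Hint Resolve measurable_Rpos : core.

Lemma RposE {R : realType} (x : R) : Rpos x = (0 < x) :> Prop.
Proof. by rewrite /Rpos /= in_itv /= andbT. Qed.

(** * Weak derivatives *)

Section Rintegral_complements.
Context d (T : measurableType d) (R : realType) (mu : {measure set T -> \bar R}).

Lemma ae_imp (P Q : T -> Prop) : (forall x, P x -> Q x) ->
  {ae mu, forall x, P x} -> {ae mu, forall x, Q x}.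
Proof. by move=> PQ; apply: filterS. Qed.

Lemma Rintegral_supp (A B : set T) (f : T -> R) : A `<=` B ->
  (forall x, B x -> ~ A x -> f x = 0) ->
  \int[mu]_(x in A) f x = \int[mu]_(x in B) f x.
Proof.
move=> AB f0; rewrite Rintegral_mkcond [RHS]Rintegral_mkcond.
congr Rintegral; apply/funext => x; rewrite !patchE.
case: ifPn => [/set_mem /AB xB|xA]; first by rewrite mem_set.
by case: ifPn => // /set_mem xB; rewrite f0//; move: xA; rewrite notin_setE.
Qed.

Lemma integrable_supp (A B : set T) (f : T -> R) : measurable A -> measurable B ->
  A `<=` B -> (forall x, B x -> ~ A x -> f x = 0) ->
  mu.-integrable A (EFin \o f) -> mu.-integrable B (EFin \o f).
Proof.
move=> mA mB AB f0 /(integrable_mkcond _ mA) h; apply/(integrable_mkcond _ mB).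
rewrite (_ : (EFin \o f) \_ B = (EFin \o f) \_ A)//; apply/funext => x; rewrite !patchE.
have [xA|xA] := boolP (x \in A); first by rewrite mem_set//; exact/AB/set_mem.
by case: ifPn => // /set_mem xB /=; rewrite f0//; move: xA; rewrite notin_setE.
Qed.

Lemma Rdominated_cvg (D : set T) (f_ : nat -> T -> R) (f g : T -> R) : measurable D ->
  (forall n, measurable_fun D (f_ n)) ->
  (forall x, D x -> f_ n x @[n --> \oo] --> f x) ->
  mu.-integrable D (EFin \o g) ->
  (forall n x, D x -> `|f_ n x| <= g x) ->
  \int[mu]_(x in D) f_ n x @[n --> \oo] --> \int[mu]_(x in D) f x.
Proof.
move=> mD mf_ f_f gi f_g.
have mf : measurable_fun D f by apply: (measurable_fun_cvg _ f_f).
have cf x : D x -> (f_ n x)%:E @[n --> \oo] --> (f x)%:E.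
  by move=> Dx; apply: cvg_EFin; [exact: nearW|exact: f_f].
have mEf_ n : measurable_fun D (EFin \o f_ n) by exact/measurable_EFinP.
have le n x : D x -> (`|(f_ n x)%:E| <= (g x)%:E)%E.
  by move=> Dx; rewrite lee_fin; exact: f_g.
have [|||fi _ h] := @dominated_convergence _ _ _ mu D mD (fun n x => (f_ n x)%:E)
  (EFin \o f) (EFin \o g) mEf_ _ _ gi.
- exact/measurable_EFinP.
- exact: aeW.
- by apply: aeW => x n Dx; exact: le.
apply: fine_cvg; rewrite fineK; last exact: integrable_fin_num.
exact: h.
Qed.

End Rintegral_complements.

(** * The fundamental lemma of the calculus of variations *)

Section du_Bois_Reymond.
Context {R : realType}.
Local Notation mu := (@lebesgue_measure R).
Implicit Types (w phi psi : R -> R) (a b : R).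

(** Lebesgue differentiation: w is almost everywhere the derivative of its primitive, which vanishes
    identically. *)
Lemma Rintegral_eq0_ae w : mu.-integrable setT (EFin \o w) ->
  (forall x, \int[mu]_(t in `]-oo, x]) w t = 0) -> {ae mu, forall x, w x = 0}.
Proof.
move=> wi w0; have wl := integrable_locally measurableT wi.
rewrite patch_setT in wl.
have wi' y : mu.-integrable `]-oo, y] (EFin \o w) by apply: integrableS wi.
apply: ae_imp (FTC1Ny wi' wl) => x [_ <-].
rewrite (_ : (fun x => _) = cst 0) ?derive1_cst//.
by apply/funext => y; rewrite w0.
Qed.

(** Testing against bumps that tend to the indicator of (a, b) gives, by dominated convergence, a
    zero integral over every [a, b] with 0 < a. The primitive of w restricted to
    [1 / (n + 1), n + 1] is then zero, and these intervals exhaust the half-line. *)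
Lemma Rintegral_test_ae0 w : locally_integrable Rpos w ->
  (forall phi, test_function phi -> \int[mu]_(x in Rpos) (w x * phi x) = 0) ->
  {ae mu, forall x, Rpos x -> w x = 0}.
Proof.
move=> [mw _ wK] wphi.
have wi a b : 0 < a -> mu.-integrable `[a, b] (EFin \o w).
  move=> a0; have sub : `[a, b] `<=` Rpos.
    by move=> x; rewrite RposE /= in_itv/= => /andP[+ _]; exact: lt_le_trans.
  apply/integrableP; split.
    by apply/measurable_EFinP; exact: (measurable_funS measurable_Rpos sub mw).
  exact: wK (@segment_compact _ _ _).
have w0 a b : 0 < a -> \int[mu]_(x in `[a, b]) w x = 0.
  move=> a0; pose wab := w \_ `[a, b].
  have wabi : mu.-integrable Rpos (EFin \o wab).
    apply: (@integrable_supp _ _ _ mu `[a, b]%classic Rpos wab) => //.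
    - by move=> x; rewrite RposE /= in_itv/= => /andP[+ _]; exact: lt_le_trans.
    - by move=> x _ xab; rewrite /wab patchE memNset.
    - by apply: eq_integrable (wi a b a0) => // x xab; rewrite /wab /= patchE xab.
  have cv : \int[mu]_(x in Rpos) (w x * flat_bump m a b x) @[m --> \oo] -->
      \int[mu]_(x in Rpos) (w x * \1_(`]a, b[%classic) x).
    apply: (@Rdominated_cvg _ _ _ mu Rpos (fun m x => w x * flat_bump m a b x) _
      (fun x => `|wab x|)) => //.
    - move=> n; apply: measurable_funM => //.
      apply: measurable_funTS; apply: continuous_measurable_fun.
      by apply: smooth_continuous; exact: smooth_bump.
    - by move=> x _; apply: cvgM; [exact: cvg_cst|exact: cvg_bump].
    - exact: integrable_norm.
    - move=> n x _; rewrite /= normrM [`|flat_bump _ _ _ _|]ger0_norm ?bump_ge0//.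
      have [xab|xab] := boolP (a < x < b); last by rewrite bump_out ?mulr0.
      rewrite /wab patchE mem_set/=; first by rewrite ler_piMr ?bump_le1.
      by move: xab => /andP[ax xb]; rewrite in_itv/= !ltW.
  have cv' : \int[mu]_(x in Rpos) (w x * flat_bump m a b x) @[m --> \oo] --> (0 : R).
    rewrite (_ : (fun m => _) = fun=> 0); first exact: cvg_cst.
    by apply/funext => m; apply: wphi; exact: test_function_bump.
  rewrite -[RHS](cvg_unique (@Rhausdorff R) cv cv').
  rewrite -Rintegral_itv_obnd_cbnd; last first.
    by apply: integrableS (wi a b a0) => //; apply: subset_itvr; rewrite bnd_simp.
  rewrite -Rintegral_itv_bndo_bndc; last first.
    by apply: integrableS (wi a b a0) => //; exact: subset_itv_oo_cc.
  rewrite -(@Rintegral_supp _ _ _ mu `]a, b[%classic Rpos).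
  - by apply: eq_Rintegral => x xab; rewrite indicE xab mulr1.
  - by move=> x; rewrite RposE /= in_itv/= => /andP[+ _]; exact: lt_trans.
  - by move=> x _ xab; rewrite indicE memNset// mulr0.
have ae_n n : {ae mu, forall x, `[n.+1%:R^-1, n.+1%:R]%classic x -> w x = 0}.
  set a : R := _^-1; set b : R := n.+1%:R.
  have a0 : 0 < a by rewrite invr_gt0.
  suff : {ae mu, forall x, (w \_ `[a, b]) x = 0}.
    by apply: ae_imp => x + xab; rewrite patchE mem_set.
  apply: Rintegral_eq0_ae.
    have := (integrable_mkcond (mu := mu) (EFin \o w) (measurable_itv `[a, b])).1 (wi a b a0).
    by rewrite restrict_EFin.
  move=> x; rewrite -Rintegral_mkcondr.
  rewrite (_ : _ `&` _ = `[a, Num.min x b]%classic) ?w0//.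
  apply/seteqP; split => y /=; rewrite !in_itv/= le_min.
    by move=> [-> /andP[-> ->]].
  by move=> /and3P[-> -> ->].
apply: ae_imp (ae_foralln ae_n) => x h; rewrite RposE => x0.
(* An index n above x + 1 / x places x in [1 / (n + 1), n + 1]. *)
have s0 : 0 <= x + x^-1 by apply: addr_ge0; rewrite ?invr_ge0 ltW.
have /ltW xn := archi_boundP s0.
apply: (h (Num.bound (x + x^-1))) => /=; rewrite in_itv/=; apply/andP; split.
  rewrite -[leRHS]invrK lef_pV2 ?posrE ?invr_gt0//.
  apply: (@le_trans _ _ (x + x^-1)); first by rewrite lerDr ltW.
  by apply: le_trans xn _; rewrite ler_nat.
apply: (@le_trans _ _ (x + x^-1)); first by rewrite lerDl invr_ge0 ltW.
by apply: le_trans xn _; rewrite ler_nat.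
Qed.

End du_Bois_Reymond.

(** * Primitives of test functions and the du Bois-Reymond lemma on the half-line *)

Section test_function_integrals.
Context {R : realType}.
Local Notation mu := (@lebesgue_measure R).
Implicit Types (w phi psi : R -> R) (a b : R).

Lemma test_function_measurable D phi : test_function phi -> measurable_fun D phi.
Proof.
move=> tphi; apply: measurable_funTS; apply: continuous_measurable_fun.
exact: test_function_continuous.
Qed.

Lemma test_function_integrable D phi : measurable D -> test_function phi ->
  mu.-integrable D (EFin \o phi).
Proof.
move=> mD tphi; have [_ [a [b [a0 ab phi0]]]] := test_functionP tphi.
apply: (@integrableS _ _ _ mu setT) => //.
apply: (@integrable_supp _ _ _ mu `[a, b]%classic) => //.
  move=> x _ xab; apply: phi0; apply/negP => /andP[ax xb]; apply: xab.
  by rewrite /= in_itv/= !ltW.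
apply: continuous_compact_integrable; first exact: segment_compact.
by apply: continuous_subspaceT; exact: test_function_continuous.
Qed.

Lemma test_functionM phi psi : test_function phi -> smooth psi ->
  test_function (fun x => phi x * psi x).
Proof.
move=> /test_functionP[sphi [a [b [a0 ab phi0]]]] spsi.
apply: (@test_function_supp _ _ a b); [exact: smoothM|exact: a0|].
move=> x xout; rewrite phi0 ?mul0r//; apply: contra xout => /andP[h1 h2].
by rewrite !ltW.
Qed.

Lemma test_function_sqint D phi : measurable D -> test_function phi ->
  sqint mu D phi.
Proof.
move=> mD tphi; split; first exact: test_function_measurable.
by apply: (test_function_integrable mD (test_functionM tphi tphi.1)).
Qed.

(** The primitive from -oo vanishes to the left of the support of psi, and to its right because the
    total integral is 0. *)
Lemma test_function_primitive psi : test_function psi ->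
  \int[mu]_(x in Rpos) psi x = 0 ->
  exists phi, test_function phi /\ derive1 phi = psi.
Proof.
move=> tpsi int0; have [spsi [a [b [a0 ab psi0]]]] := test_functionP tpsi.
pose phi x := \int[mu]_(t in `]-oo, x]) psi t.
have dphi x : derivable phi x 1 /\ derive1 phi x = psi x.
  apply: (@continuous_FTC1 _ psi -oo%O x (x + 1)) => //; first by rewrite ltrDl.
    exact: test_function_integrable.
  - exact: ltNyr.
  - exact: test_function_continuous.
have iphi (x : R) : is_derive x 1 phi (psi x).
  by have [d <-] := dphi x; rewrite derive1E; exact: derivableP.
exists phi; split; last by apply/funext => x; have [] := dphi x.
apply: (@test_function_supp _ _ a b); [exact: smooth_is iphi spsi|exact: a0|].
move=> x; rewrite negb_and -!ltNge => /orP[xa|bx].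
- rewrite /phi [LHS](_ : _ = \int[mu]_(t in `]-oo, x]) 0); last first.
    apply: eq_Rintegral => t; rewrite inE/= in_itv/= => tx; apply: psi0.
    by rewrite negb_and -!leNgt (le_trans tx (ltW xa)).
  by rewrite Rintegral_cst// mul0r.
- rewrite -int0 /phi (@Rintegral_supp _ _ _ mu _ setT)//.
    rewrite [RHS](@Rintegral_supp _ _ _ mu _ setT)// => t _.
    rewrite RposE => /negP t0; apply: psi0; apply: contra t0 => /andP[+ _].
    exact: lt_trans.
  move=> t _ /=; rewrite in_itv/= => /negP tx; apply: psi0.
  apply: contra tx => /andP[_ tb]; exact: ltW (lt_trans tb bx).
Qed.

Lemma sqint_integrable (D : set (measurableTypeR R)) w : measurable D -> (mu D < +oo)%E ->
  sqint mu D w -> mu.-integrable D (EFin \o w).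
Proof.
move=> mD Doo sw.
have s1 : sqint mu D (fun=> 1).
  split => //; apply/integrableP; split => //.
  under eq_integral do rewrite expr1n gee0_abs//.
  by rewrite integral_cst// mul1e.
apply: (@eq_integrable _ _ _ mu D mD _ _ _ (sqint_mul mD sw s1)) => x _.
by rewrite /= mulr1.
Qed.

Lemma sqintS (A B : set (measurableTypeR R)) w : measurable A -> measurable B -> A `<=` B ->
  sqint mu B w -> sqint mu A w.
Proof.
move=> mA mB AB [mw wi]; split; first exact: (measurable_funS mB).
exact: integrableS wi.
Qed.

Lemma sqint_locally w : sqint mu Rpos w -> locally_integrable Rpos w.
Proof.
move=> sw; split; [by case: sw | exact: interval_open |].
move=> K KR cK; have mK : measurable (K : set (measurableTypeR R)) by exact: compact_measurable.
have := @sqint_integrable K w mK (compact_finite_measure cK)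
  (sqintS mK measurable_Rpos KR sw).
by case/integrableP.
Qed.

(** The half-line has infinite measure: integrating over (0, n] shows that n c^2 stays bounded. *)
Lemma sqint_cst_eq0 (c : R) : sqint mu Rpos (fun=> c) -> c = 0.
Proof.
move=> sc; apply/eqP; rewrite -sqrf_eq0; apply/eqP.
have c2 n : c ^+ 2 * n%:R <= sqnorm mu Rpos (fun=> c).
  rewrite -lee_fin -sqnormE//.
  have mn : (mu `]0%R, n%:R] = n%:R%:E)%E.
    rewrite lebesgue_measure_itv/= lte_fin; case: ltP => [_|]; first by rewrite oppr0 adde0.
    by rewrite lern0 => /eqP ->.
  rewrite EFinM -mn -integral_cst//; apply: ge0_subset_integral => //.
  - by move=> x _; rewrite lee_fin sqr_ge0.
  - by move=> x; rewrite RposE/= in_itv/= => /andP[].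
apply/eqP; rewrite eq_le sqr_ge0 andbT leNgt; apply/negP => c0.
have := c2 (Num.bound (sqnorm mu Rpos (fun=> c) / c ^+ 2)).
rewrite mulrC -ler_pdivlMr//; apply/negP; rewrite -ltNge.
by apply: archi_boundP; rewrite divr_ge0 ?sqnorm_ge0 ?ltW.
Qed.

Lemma sqint_ae (D : set (measurableTypeR R)) v w : measurable D -> measurable_fun D v ->
  {ae mu, forall x, D x -> v x = w x} -> sqint mu D w -> sqint mu D v.
Proof.
move=> mD mv vw sw; apply/(sqintP mu mD mv); have /(sqintP mu mD sw.1) := sw.
rewrite (@ge0_ae_eq_integral _ _ _ mu D (fun x => (w x ^+ 2)%:E)
  (fun x => (v x ^+ 2)%:E))//.
- by apply/measurable_EFinP/measurable_funX; case: sw.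
- by apply/measurable_EFinP/measurable_funX.
- by move=> x _; rewrite lee_fin sqr_ge0.
- by move=> x _; rewrite lee_fin sqr_ge0.
- by apply: ae_imp vw => x + Dx => /(_ Dx) ->.
Qed.

Lemma locally_integrable_cst (c : R) : locally_integrable Rpos (fun=> c).
Proof.
split; [exact: measurable_cst | exact: interval_open |].
move=> K KR cK; rewrite integral_cst; last exact: compact_measurable.
by rewrite lte_mul_pinfty// compact_finite_measure.
Qed.

(** Otherwise the constant 1 would be orthogonal to all test functions, hence zero almost
    everywhere, hence square integrable on a set of infinite measure. *)
Lemma test_function_integral_neq0 :
  exists phi, test_function phi /\ \int[mu]_(x in Rpos) phi x != 0.
Proof.
apply: contrapT => h; suff : (1 : R) = 0 by apply/eqP; rewrite oner_eq0.
apply: sqint_cst_eq0; apply: (@sqint_ae _ _ (fun=> 0)) => //; last exact: sqint0.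
apply: (Rintegral_test_ae0 (locally_integrable_cst 1)) => phi tphi.
under eq_Rintegral do rewrite mul1r.
by apply/eqP; apply: contra_notT h => phi0; exists phi.
Qed.

(** Subtracting from psi the multiple of a fixed test function b0 with the same integral leaves the
    derivative of a test function. Hence w is almost everywhere a constant, and a square integrable
    constant on the half-line is 0. *)
Lemma sqint_orthogonal_ae0 w : sqint mu Rpos w ->
  (forall phi, test_function phi -> \int[mu]_(x in Rpos) (w x * derive1 phi x) = 0) ->
  {ae mu, forall x, Rpos x -> w x = 0}.
Proof.
move=> sw wphi.
have [b0 [tb0 m0]] := test_function_integral_neq0.
have ib0 := test_function_integrable measurable_Rpos tb0.
set m := Rintegral _ _ _ in m0.
pose c := (\int[mu]_(x in Rpos) (w x * b0 x)) / m.
have wc : {ae mu, forall x, Rpos x -> w x - c = 0}.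
  apply: Rintegral_test_ae0.
    apply: locally_integrableB; first exact: sqint_locally.
    exact: locally_integrable_cst.
  move=> psi tpsi.
  have ipsi := test_function_integrable measurable_Rpos tpsi.
  pose k := (\int[mu]_(x in Rpos) psi x) / m.
  have [||phi [tphi dphi]] := @test_function_primitive (fun x => psi x - k * b0 x).
  - by apply: test_functionB => //; exact: test_functionZ.
  - rewrite RintegralB//; last exact: integrableZl_EFin.
    by rewrite RintegralZl// /k divfK// subrr.
  - have := wphi _ tphi; rewrite dphi.
    have iwpsi := sqint_mul measurable_Rpos sw (test_function_sqint measurable_Rpos tpsi).
    have iwb0 := sqint_mul measurable_Rpos sw (test_function_sqint measurable_Rpos tb0).
    rewrite [LHS](_ : _ = \int[mu]_(x in Rpos) (w x * psi x - k * (w x * b0 x))); last first.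
      by apply: eq_Rintegral => x _; ring.
    rewrite RintegralB//; last exact: integrableZl_EFin.
    rewrite RintegralZl// => h0.
    rewrite [LHS](_ : _ = \int[mu]_(x in Rpos) (w x * psi x - c * psi x)); last first.
      by apply: eq_Rintegral => x _; ring.
    rewrite RintegralB//; last exact: integrableZl_EFin.
    by rewrite RintegralZl// -h0 /c /k; congr (_ - _); ring.
have c0 : c = 0.
  apply: sqint_cst_eq0; apply: (@sqint_ae _ _ w) => //.
  by apply: ae_imp wc => x /[apply] /eqP; rewrite subr_eq0 => /eqP.
by apply: ae_imp wc => x + x0; move=> /(_ x0) /eqP; rewrite c0 subr0 => /eqP.
Qed.

End test_function_integrals.

Lemma sqint_bounded_mul {d} {T : measurableType d} {R : realType}
    (mu : {measure set T -> \bar R}) (D : set T) (f g : T -> R) (M : R) :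
  measurable D -> measurable_fun D f -> (forall x, D x -> `|f x| <= M) ->
  sqint mu D g -> sqint mu D (fun x => f x * g x).
Proof.
move=> mD mf fM sg; have [mg gi] := sg; split; first exact: measurable_funM.
apply: (@le_integrable _ _ _ mu D mD _ (fun x => (M ^+ 2 * g x ^+ 2)%:E)).
- by apply/measurable_EFinP; apply: measurable_funX; exact: measurable_funM.
- move=> x Dx; rewrite lee_fin exprMn -!exprMn !ger0_norm ?sqr_ge0// !exprMn.
  rewrite ler_wpM2r ?sqr_ge0// -(real_normK (num_real (f x))).
  by rewrite lerXn2r ?nnegrE ?fM// (le_trans _ (fM x Dx)).
- exact: (@integrableZl_EFin _ _ _ mu D mD _ (fun x => g x ^+ 2)).
Qed.

(** * Absolutely continuous functions with square integrable derivative *)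

Section half_hoelder.
Context {R : realType}.
Variables (v : R -> R) (K : R).
Hypothesis vK : forall s t, 0 <= s -> s <= t -> (v t - v s) ^+ 2 <= K * (t - s).

Lemma half_hoelder_continuous : {within Rnneg, continuous v}.
Proof.
have vKn s t : 0 <= s -> 0 <= t -> (v t - v s) ^+ 2 <= K * `|t - s|.
  move=> s0 t0; case: (leP s t) => [st|/ltW ts].
    by rewrite ger0_norm ?subr_ge0//; exact: vK.
  by rewrite -sqrrN opprB distrC ger0_norm ?subr_ge0//; exact: vK.
have K0 : 0 <= K by have := vK (lexx 0) ler01; rewrite subr0 mulr1; exact/le_trans/sqr_ge0.
have K1 : 0 < K + 1 by rewrite ltr_wpDl.
apply/subspace_continuousP => x; rewrite /Rnneg /= in_itv/= andbT => x0.
apply/cvgrPdist_le => e e0; rewrite near_withinE.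
have d0 : 0 < e ^+ 2 / (K + 1) by rewrite divr_gt0 ?exprn_gt0.
near=> y; rewrite /Rnneg /= in_itv/= andbT => y0.
rewrite -(@ler_pXn2r _ 2) ?nnegrE ?(ltW e0)// real_normK ?num_real//.
apply: (le_trans (vKn y x y0 x0)).
apply: (@le_trans _ _ ((K + 1) * `|x - y|)); first by rewrite ler_wpM2r ?lerDl.
rewrite mulrC -ler_pdivlMr//.
Unshelve. all: by end_near. Qed.

Lemma half_hoelder_measurable : measurable_fun (Rpos : set (measurableTypeR R)) v.
Proof.
apply: open_continuous_measurable_fun; first exact: interval_open.
have := half_hoelder_continuous => /continuous_within_itvcyP[h _] x.
by rewrite inE /= => xpos; apply: h; rewrite inE.
Qed.

End half_hoelder.

(* On a uniform subdivision into n pieces the increments of H add up to at most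
   K * (X / n) * (A X - A 0); this replaces almost everywhere differentiation in
   the product and chain rules below. *)
Lemma telescope_cst {R : realType} (H A : R -> R) (K X : R) : 0 <= X ->
  (forall s t, 0 <= s -> s <= t -> t <= X -> `|H t - H s| <= K * (t - s) * (A t - A s)) ->
  H X = H 0.
Proof.
move=> X0 HA; pose C := K * X * (A X - A 0).
have small n : `|H X - H 0| * n.+1%:R <= C.
  pose t i : R := X * (i%:R / n.+1%:R).
  have t0 : t 0%N = 0 by rewrite /t mul0r mulr0.
  have tn : t n.+1 = X by rewrite /t divff ?mulr1// pnatr_eq0.
  have tS i : t i.+1 - t i = X / n.+1%:R.
    by rewrite /t -mulrBr -mulrBl -natrB// subSnn mul1r.
  have step : X / n.+1%:R >= 0 by rewrite divr_ge0.
  rewrite -{1}tn -{1}t0 -(telescope_sumr (fun i => H (t i)))//.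
  rewrite -ler_pdivlMr//; apply: le_trans (ler_norm_sum _ _ _) _.
  have -> : C / n.+1%:R = \sum_(0 <= i < n.+1) K * (X / n.+1%:R) * (A (t i.+1) - A (t i)).
    by rewrite -mulr_sumr (telescope_sumr (fun i => A (t i)))// t0 tn /C; ring.
  rewrite big_nat [leRHS]big_nat; apply: ler_sum => i /andP[_ iS]; rewrite -(tS i); apply: HA.
  - by rewrite /t mulr_ge0// divr_ge0.
  - by rewrite -subr_ge0 tS.
  - by rewrite -[leRHS]mulr1 /t ler_wpM2l// ler_pdivrMr// mul1r ler_nat.
apply/eqP; rewrite -subr_eq0 -normr_eq0; apply/eqP/le_anti; rewrite normr_ge0 andbT.
rewrite leNgt; apply/negP => d0.
have := small (Num.bound (C / `|H X - H 0|)); apply/negP; rewrite -ltNge mulrC.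
rewrite -ltr_pdivrMr//; apply: (@lt_trans _ _ (Num.bound (C / `|H X - H 0|))%:R).
  apply: archi_boundP; rewrite divr_ge0 ?normr_ge0//.
  by have := small 0%N; rewrite mulr1; exact/le_trans.
by rewrite ltr_nat.
Qed.

Section absolutely_continuous.
Context {R : realType}.
Local Notation mu := (@lebesgue_measure R).
Implicit Types (u v g h : R -> R) (c s t x : R).

(* u = c + v where v belongs to the completion of the test functions and has
   weak derivative g. *)
Definition ac c u g := sqint mu Rpos g /\
  forall x, 0 <= x -> u x = c + \int[mu]_(t in `]0, x]) g t.

Lemma itv_oc_Rpos s t : 0 <= s -> (`]s, t]%classic `<=` @Rpos R).
Proof. by move=> s0 x; rewrite RposE /= in_itv/= => /andP[+ _]; exact: le_lt_trans. Qed.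

Lemma sqint_itv g s t : 0 <= s -> sqint mu Rpos g -> sqint mu `]s, t] g.
Proof. by move=> s0; apply: sqintS => //; exact: itv_oc_Rpos. Qed.

Lemma itv_oc_lty s t : (mu `]s, t] < +oo)%E.
Proof. by rewrite lebesgue_measure_itv/=; case: ifPn => // _; rewrite -EFinB ltry. Qed.

Lemma integrable_itv g s t : 0 <= s -> sqint mu Rpos g ->
  mu.-integrable `]s, t] (EFin \o g).
Proof.
by move=> s0 sg; apply: sqint_integrable => //; [exact: itv_oc_lty|exact: sqint_itv].
Qed.

Lemma ac_diff c u g s t : ac c u g -> 0 <= s -> s <= t ->
  u t - u s = \int[mu]_(x in `]s, t]) g x.
Proof.
move=> [sg ug] s0 st; rewrite !ug//; last exact: le_trans st.
rewrite opprD addrACA subrr add0r; apply: Rintegral_itvB => //.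
  exact: integrable_itv.
Qed.

Lemma sqnorm_itvB g s t : sqint mu Rpos g -> 0 <= s -> s <= t ->
  sqnorm mu `]0, t] g - sqnorm mu `]0, s] g = sqnorm mu `]s, t] g.
Proof.
move=> sg s0 st; apply: Rintegral_itvB => //.
by have [] := @sqint_itv g 0 t (lexx _) sg.
Qed.

Lemma sqnorm_itv_le g s t : sqint mu Rpos g -> 0 <= s ->
  sqnorm mu `]s, t] g <= sqnorm mu Rpos g.
Proof.
move=> sg s0; rewrite -lee_fin -!sqnormE//; last exact: sqint_itv.
apply: ge0_subset_integral => //.
- by apply/measurable_EFinP; apply: measurable_funX; case: sg.
- by move=> x _; rewrite lee_fin sqr_ge0.
- exact: itv_oc_Rpos.
Qed.

(** Cauchy-Schwarz against the constant 1. The factor t - s is what brings the errors in the chain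
    and product rules below the threshold of [telescope_cst]. *)
Lemma sqr_Rintegral_norm_le g s t : sqint mu Rpos g -> 0 <= s -> s <= t ->
  (\int[mu]_(x in `]s, t]) `|g x|) ^+ 2 <= (t - s) * sqnorm mu `]s, t] g.
Proof.
move=> sg s0 st; have sgi := sqint_itv t s0 sg.
have sng : sqint mu `]s, t] (fun x => `|g x|).
  split; first by apply: measurableT_comp => //; case: sgi.
  by apply: eq_integrable sgi.2 => // x _; rewrite real_normK ?num_real.
have s1 : sqint mu `]s, t] (fun=> 1).
  split => //; apply/integrableP; split => //.
  under eq_integral do rewrite expr1n gee0_abs//.
  by rewrite integral_cst// mul1e itv_oc_lty.
have mI : measurable (`]s, t]%classic : set (measurableTypeR R)) by exact: measurable_itv.
have := cauchy_schwarz mI s1 sng.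
have -> : sqnorm mu `]s, t] (fun=> 1) = t - s.
  rewrite /sqnorm; under eq_Rintegral do rewrite expr1n.
  rewrite Rintegral_cst// mul1r.
  rewrite [X in fine X](_ : _ = (t - s)%:E)//.
  apply: (etrans (lebesgue_measure_itv `]s, t])); rewrite /= lte_fin; case: ltP => [_|ts]; first by rewrite EFinB.
  by have /eqP -> : t == s; [rewrite eq_le ts st|rewrite subrr].
under eq_Rintegral do rewrite mul1r.
move=> /le_trans; apply; rewrite [X in _ * X <= _](_ : _ = sqnorm mu `]s, t] g)//.
by apply: eq_Rintegral => x _; rewrite real_normK ?num_real.
Qed.

Lemma Rintegral_norm_subset g s t s' t' : sqint mu Rpos g -> 0 <= s -> s <= s' -> t' <= t ->
  \int[mu]_(x in `]s', t']) `|g x| <= \int[mu]_(x in `]s, t]) `|g x|.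
Proof.
move=> sg s0 ss' tt'.
have i1 := integrable_itv t s0 sg; have i2 := integrable_itv t' (le_trans s0 ss') sg.
rewrite /Rintegral fine_le//.
- by apply: integrable_fin_num => //; exact: (integrable_norm i2).
- by apply: integrable_fin_num => //; exact: (integrable_norm i1).
- apply: ge0_subset_integral => //.
    by have /(measurable_int _) := integrable_norm i1.
  by apply: subset_itv; rewrite bnd_simp.
Qed.

Lemma ac_diff_norm_le c u g s t : ac c u g -> 0 <= s -> s <= t ->
  `|u t - u s| <= \int[mu]_(x in `]s, t]) `|g x|.
Proof.
move=> ug s0 st; rewrite (ac_diff ug s0 st); apply: le_normr_Rintegral => //.
by apply: integrable_itv => //; case: ug.
Qed.

Lemma ac_diff_sqr_le c u g s t : ac c u g -> 0 <= s -> s <= t ->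
  (u t - u s) ^+ 2 <= sqnorm mu Rpos g * (t - s).
Proof.
move=> ug s0 st; rewrite -(real_normK (num_real _)).
apply: (@le_trans _ _ ((\int[mu]_(x in `]s, t]) `|g x|) ^+ 2)).
  rewrite lerXn2r ?nnegrE ?(ac_diff_norm_le ug)//.
  by apply: Rintegral_ge0 => x _; exact: normr_ge0.
apply: (le_trans (sqr_Rintegral_norm_le ug.1 s0 st)); rewrite mulrC.
by rewrite ler_wpM2r ?subr_ge0// sqnorm_itv_le//; case: ug.
Qed.

Lemma ac_continuous c u g : ac c u g -> {within Rnneg, continuous u}.
Proof. by move=> ug; apply: half_hoelder_continuous => s t; exact: (ac_diff_sqr_le ug). Qed.

Lemma ac_measurable c u g : ac c u g -> measurable_fun (Rpos : set (measurableTypeR R)) u.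
Proof. by move=> ug; apply: half_hoelder_measurable => s t; exact: (ac_diff_sqr_le ug). Qed.

Lemma ac0 c u g : ac c u g -> u 0 = c.
Proof. by move=> [_ ug]; rewrite ug// set_itvoc0 Rintegral_set0 addr0. Qed.

Lemma ac_eq c u g u' g' : {in Rpos, g =1 g'} -> (forall x, 0 <= x -> u x = u' x) ->
  ac c u g -> ac c u' g'.
Proof.
move=> gg uu [sg ug]; split; first exact: sqint_eq sg.
move=> x x0; rewrite -uu// ug//; congr (_ + _); apply: eq_Rintegral => t tx.
by apply: gg; apply/mem_set/(itv_oc_Rpos (lexx 0))/set_mem; exact: tx.
Qed.

Lemma ac_lin c1 c2 u1 u2 g1 g2 (a b : R) : ac c1 u1 g1 -> ac c2 u2 g2 ->
  ac (a * c1 + b * c2) (fun x => a * u1 x + b * u2 x) (fun x => a * g1 x + b * g2 x).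
Proof.
move=> [s1 h1] [s2 h2]; split; first by apply: sqintD => //; exact: sqintZ.
move=> x x0; have i1 := integrable_itv x (lexx 0) s1; have i2 := integrable_itv x (lexx 0) s2.
rewrite RintegralD//; last 2 first.
- by apply: integrableZl_EFin.
- by apply: integrableZl_EFin.
by rewrite !RintegralZl// h1// h2//; ring.
Qed.

(** The difference H of the two sides is constant by [telescope_cst], with A x the integral of g^2
    over (0, x]. If D is the integral of |g| over (s, t], the Taylor error of F and the oscillation
    of F' each contribute at most L D^2, and D^2 <= (t - s) (A t - A s). *)
Lemma ac_comp c u g (F F' : R -> R) (I : set R) (L M : R) : 0 <= L ->
  ac c u g -> (forall x, 0 <= x -> I (u x)) ->
  (forall a b, I a -> I b -> `|F b - F a - F' a * (b - a)| <= L * (b - a) ^+ 2) ->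
  (forall a b, I a -> I b -> `|F' b - F' a| <= L * `|b - a|) ->
  (forall a, I a -> `|F' a| <= M) ->
  ac (F c) (fun x => F (u x)) (fun x => F' (u x) * g x).
Proof.
move=> L0 ug uI FF F'L F'M; have [sg _] := ug.
have mF'u : measurable_fun (Rpos : set (measurableTypeR R)) (fun x => F' (u x)).
  apply: (@half_hoelder_measurable _ _ (L ^+ 2 * sqnorm mu Rpos g)) => s t s0 st.
  have t0 := le_trans s0 st.
  rewrite -(real_normK (num_real _)) -mulrA.
  apply: (@le_trans _ _ ((L * `|u t - u s|) ^+ 2)).
    by rewrite lerXn2r ?nnegrE ?mulr_ge0// F'L//; exact: uI.
  rewrite exprMn real_normK ?num_real// ler_wpM2l ?sqr_ge0//.
  exact: (ac_diff_sqr_le ug).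
have sF'ug : sqint mu Rpos (fun x => F' (u x) * g x).
  apply: (@sqint_bounded_mul _ _ _ _ _ _ _ M) => // x.
  by rewrite RposE => x0; apply: F'M; apply: uI; exact: ltW.
split => // X X0.
pose H x := F (u x) - \int[mu]_(t in `]0, x]) (F' (u t) * g t).
have : H X = H 0.
  apply: (@telescope_cst _ H (fun x => sqnorm mu `]0, x] g) (2 * L)) => // s t s0 st tX.
  have t0 := le_trans s0 st.
  have mI : measurable (`]s, t]%classic : set (measurableTypeR R)) by exact: measurable_itv.
  have ig := integrable_itv t s0 sg; have iF'ug := integrable_itv t s0 sF'ug.
  have ing := integrable_norm ig.
  set D := \int[mu]_(x in `]s, t]) `|g x|.
  have D0 : 0 <= D by apply: Rintegral_ge0 => x _; exact: normr_ge0.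
  have D2 : D ^+ 2 <= (t - s) * (sqnorm mu `]0, t] g - sqnorm mu `]0, s] g).
    by rewrite sqnorm_itvB//; exact: sqr_Rintegral_norm_le.
  have HE : H t - H s = (F (u t) - F (u s) - F' (u s) * (u t - u s)) +
      \int[mu]_(x in `]s, t]) ((F' (u s) - F' (u x)) * g x).
    rewrite [in RHS](_ : \int[mu]_(x in `]s, t]) ((F' (u s) - F' (u x)) * g x) =
        F' (u s) * (u t - u s) - \int[mu]_(x in `]s, t]) (F' (u x) * g x)); last first.
      rewrite (ac_diff ug s0 st) -RintegralZl// -RintegralB//; last exact: integrableZl_EFin.
      by apply: eq_Rintegral => x _; ring.
    rewrite -(@Rintegral_itvB _ _ (BRight 0) (BRight t) s)//; last first.
      exact: integrable_itv.
    rewrite /H; ring.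
  rewrite HE; apply: (@le_trans _ _ (2 * L * D ^+ 2)); last first.
    by rewrite -[leRHS]mulrA ler_wpM2l// mulr_ge0.
  apply: (le_trans (ler_normD _ _)); rewrite [2 * L]mulr_natl mulr2n mulrDl lerD//.
    apply: (le_trans (FF _ _ (uI _ s0) (uI _ t0))); rewrite ler_wpM2l//.
    rewrite -(real_normK (num_real _)) lerXn2r ?nnegrE//.
    exact: (ac_diff_norm_le ug).
  have idiff : mu.-integrable `]s, t] (fun x => ((F' (u s) - F' (u x)) * g x)%:E).
    apply: (@eq_integrable _ _ _ mu _ mI _ _ _
      (integrableB_EFin mI (integrableZl_EFin mI (F' (u s)) ig) iF'ug)).
    by move=> x _; rewrite /= mulrBl.
  apply: (le_trans (le_normr_Rintegral _ idiff)) => //.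
  rewrite expr2 mulrA -RintegralZl//; apply: le_Rintegral => //.
  - exact: integrable_norm.
  - exact: integrableZl_EFin.
  - move=> x; rewrite /= in_itv/= => /andP[sx xt]; rewrite normrM ler_wpM2r// distrC.
    have x0 : 0 <= x := le_trans s0 (ltW sx).
    apply: (le_trans (F'L _ _ (uI _ s0) (uI _ x0))); rewrite ler_wpM2l//.
    apply: (le_trans (ac_diff_norm_le ug s0 (ltW sx))).
    exact: Rintegral_norm_subset.
rewrite /H set_itvoc0 Rintegral_set0 subr0 (ac0 ug) => /eqP.
by rewrite subr_eq => /eqP.
Qed.

End absolutely_continuous.

(** * Product rule and identification of the weak derivative *)

Section weak_derivatives.
Context {R : realType}.
Local Notation mu := (@lebesgue_measure R).
Implicit Types (u v g h phi psi : R -> R) (c s t x : R).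

Lemma ac_bounded c u g X : ac c u g ->
  forall x, 0 <= x -> x <= X -> `|u x| <= `|c| + 1 + sqnorm mu Rpos g * X.
Proof.
move=> ug x x0 xX.
have uc : `|u x - c| <= 1 + sqnorm mu Rpos g * X.
  have := ac_diff_sqr_le ug (lexx 0) x0; rewrite (ac0 ug) subr0 => h.
  apply: (@le_trans _ _ (1 + (u x - c) ^+ 2)).
    rewrite -(real_normK (num_real (u x - c))); have := sqr_ge0 (`|u x - c| - 1).
    have := normr_ge0 (u x - c); nra.
  rewrite lerD2l; apply: (le_trans h); rewrite ler_wpM2l//; exact: sqnorm_ge0.
apply: (@le_trans _ _ (`|c| + `|u x - c|)); last by rewrite -addrA lerD2l.
by apply: le_trans (ler_normD _ _); rewrite addrC subrK.
Qed.

Lemma ac_sqint_mul c u g h X : ac c u g -> sqint mu Rpos h ->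
  sqint mu `]0, X] (fun x => u x * h x).
Proof.
move=> ug sh; have sub := @itv_oc_Rpos R 0 X (lexx 0).
have mI : measurable (`]0, X]%classic : set (measurableTypeR R)) by exact: measurable_itv.
apply: (@sqint_bounded_mul _ _ _ _ _ _ _ (`|c| + 1 + sqnorm mu Rpos g * X)) => //.
- by apply: (measurable_funS measurable_Rpos sub); exact: ac_measurable ug.
- by move=> x; rewrite /= in_itv/= => /andP[/ltW x0 xX]; exact: (ac_bounded ug).
- exact: sqint_itv.
Qed.

(** Write u t v t - u s v s as v t (u t - u s) + u s (v t - v s). Against the integral of v g + u h
    the error is at most 2 Dg Dh <= Dg^2 + Dh^2, where Dg and Dh integrate |g| and |h| over (s, t];
    [telescope_cst] concludes. *)
Lemma ac_prod c c' u v g h X : ac c u g -> ac c' v h -> 0 <= X ->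
  u X * v X = c * c' + \int[mu]_(x in `]0, X]) (v x * g x + u x * h x).
Proof.
move=> ug vh X0; have sg := ug.1; have sh := vh.1.
have ivg t : mu.-integrable `]0, t] (EFin \o (fun x => v x * g x)).
  by apply: sqint_integrable => //; [exact: itv_oc_lty|exact: (ac_sqint_mul _ vh)].
have iuh t : mu.-integrable `]0, t] (EFin \o (fun x => u x * h x)).
  by apply: sqint_integrable => //; [exact: itv_oc_lty|exact: (ac_sqint_mul _ ug)].
have isum t : mu.-integrable `]0, t] (EFin \o (fun x => v x * g x + u x * h x)).
  by apply: integrableD_EFin.
pose H x := u x * v x - \int[mu]_(t in `]0, x]) (v t * g t + u t * h t).
have : H X = H 0.
  apply: (@telescope_cst _ H (fun x => sqnorm mu `]0, x] g + sqnorm mu `]0, x] h) 1) => // s t s0 st tX.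
  have t0 := le_trans s0 st.
  have mI : measurable (`]s, t]%classic : set (measurableTypeR R)) by exact: measurable_itv.
  have sub : `]s, t]%classic `<=` `]0, t]%classic by apply: subset_itvr; rewrite bnd_simp.
  have ig := integrable_itv t s0 sg; have ih := integrable_itv t s0 sh.
  have ivg' : mu.-integrable `]s, t] (EFin \o (fun x => v x * g x)).
    by apply: integrableS (ivg t).
  have iuh' : mu.-integrable `]s, t] (EFin \o (fun x => u x * h x)).
    by apply: integrableS (iuh t).
  set Dg := \int[mu]_(x in `]s, t]) `|g x|; set Dh := \int[mu]_(x in `]s, t]) `|h x|.
  have Dg0 : 0 <= Dg by apply: Rintegral_ge0 => x _; exact: normr_ge0.
  have Dh0 : 0 <= Dh by apply: Rintegral_ge0 => x _; exact: normr_ge0.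
  have Dg2 : Dg ^+ 2 <= (t - s) * (sqnorm mu `]0, t] g - sqnorm mu `]0, s] g).
    by rewrite sqnorm_itvB//; exact: sqr_Rintegral_norm_le.
  have Dh2 : Dh ^+ 2 <= (t - s) * (sqnorm mu `]0, t] h - sqnorm mu `]0, s] h).
    by rewrite sqnorm_itvB//; exact: sqr_Rintegral_norm_le.
  have i1 : mu.-integrable `]s, t] (EFin \o (fun x => v t * g x - v x * g x)).
    by apply: integrableB_EFin => //; exact: integrableZl_EFin.
  have i2 : mu.-integrable `]s, t] (EFin \o (fun x => u s * h x - u x * h x)).
    by apply: integrableB_EFin => //; exact: integrableZl_EFin.
  have HE : H t - H s = \int[mu]_(x in `]s, t]) (v t * g x - v x * g x) +
      \int[mu]_(x in `]s, t]) (u s * h x - u x * h x).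
    rewrite RintegralB//; last exact: integrableZl_EFin.
    rewrite RintegralB//; last exact: integrableZl_EFin.
    rewrite !RintegralZl// -(ac_diff ug s0 st) -(ac_diff vh s0 st).
    have := @Rintegral_itvB _ _ (BRight 0) (BRight t) s (isum t) s0 st.
    rewrite [X in _ = X]RintegralD// /H => E.
    have -> : u t * v t - \int[mu]_(t in `]0, t]) (v t * g t + u t * h t) -
      (u s * v s - \int[mu]_(t in `]0, s]) (v t * g t + u t * h t)) =
      u t * v t - u s * v s - (\int[mu]_(t in `]0, t]) (v t * g t + u t * h t) -
      \int[mu]_(t in `]0, s]) (v t * g t + u t * h t)) by ring.
    by rewrite E; ring.
  rewrite HE mul1r; apply: (@le_trans _ _ (Dh * Dg + Dg * Dh)); last first.
    apply: (@le_trans _ _ (Dg ^+ 2 + Dh ^+ 2)).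
      by have := sqr_ge0 (Dg - Dh); nra.
    by apply: (le_trans (lerD Dg2 Dh2)); rewrite le_eqVlt; apply/orP; left; apply/eqP; ring.
  apply: (le_trans (ler_normD _ _)); apply: lerD.
  - apply: (le_trans (le_normr_Rintegral _ i1)) => //; rewrite -RintegralZl//; last exact: integrable_norm.
    apply: le_Rintegral => //; first exact: (integrable_norm i1).
      by apply: (integrableZl_EFin mI); exact: integrable_norm.
    move=> x; rewrite /= in_itv/= => /andP[sx xt]; rewrite -mulrBl normrM ler_wpM2r//.
    apply: (le_trans (ac_diff_norm_le vh (le_trans s0 (ltW sx)) xt)).
    by apply: Rintegral_norm_subset => //; exact: ltW.
  - apply: (le_trans (le_normr_Rintegral _ i2)) => //; rewrite -RintegralZl//; last exact: integrable_norm.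
    apply: le_Rintegral => //; first exact: (integrable_norm i2).
      by apply: (integrableZl_EFin mI); exact: integrable_norm.
    move=> x; rewrite /= in_itv/= => /andP[sx xt]; rewrite -mulrBl normrM ler_wpM2r// distrC.
    apply: (le_trans (ac_diff_norm_le ug s0 (ltW sx))).
    exact: Rintegral_norm_subset.
rewrite /H set_itvoc0 Rintegral_set0 subr0 (ac0 ug) (ac0 vh) => /eqP.
by rewrite subr_eq => /eqP.
Qed.

Lemma ac_test_function phi : test_function phi -> ac 0 phi (derive1 phi).
Proof.
move=> tphi; have tdphi := test_function_derive1 tphi; split.
  exact: test_function_sqint.
have [sphi [a [b [a0 ab phi0]]]] := test_functionP tphi.
have phi00 : phi 0 = 0 by apply: phi0; rewrite negb_and -leNgt ltW.
have cphi : continuous phi by exact: test_function_continuous.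
move=> x; rewrite add0r le_eqVlt => /predU1P[<-|x0].
  by rewrite phi00 set_itvoc0 Rintegral_set0.
have iphi := @test_function_integrable _ `[0, x]%classic _ (measurable_itv _) tdphi.
rewrite Rintegral_itv_obnd_cbnd; last first.
  by apply: integrableS iphi => //; apply: subset_itvr; rewrite bnd_simp.
rewrite /Rintegral (@continuous_FTC2 _ _ phi)//.
- by rewrite phi00 /= subr0.
- by apply: continuous_subspaceT; exact: test_function_continuous.
- split; first by move=> y _; exact: smooth_derivable.
  + by apply: cvg_at_right_filter; exact: cphi.
  + by apply: cvg_at_left_filter; exact: cphi.
Qed.

(** The product rule for u psi is integrated up to b, a point beyond the support of psi, so that
    both boundary terms vanish. *)
Lemma ac_is_weak_derivative c u g : ac c u g -> is_weak_derivative u g.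
Proof.
move=> ug; split; first by apply: sqint_locally; case: ug.
move=> psi tpsi; have apsi := ac_test_function tpsi.
have [spsi [a [b [a0 ab psi0]]]] := test_functionP tpsi.
have b0 := lt_trans a0 ab.
have dpsi0 := derive1_out psi0.
have sub := @itv_oc_Rpos R 0 b (lexx 0).
rewrite -(@Rintegral_supp _ _ _ mu `]0, b]%classic Rpos)//; last first.
  move=> x; rewrite RposE => x0 /= xb; rewrite dpsi0 ?mulr0//.
  by apply/negP => /andP[ax xb']; apply: xb; rewrite in_itv/= x0.
rewrite -[in RHS](@Rintegral_supp _ _ _ mu `]0, b]%classic Rpos)//; last first.
  move=> x; rewrite RposE => x0 /= xb; rewrite psi0 ?mulr0//.
  by apply/negP => /andP[ax xb']; apply: xb; rewrite in_itv/= x0 ltW.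
have := ac_prod ug apsi (ltW b0).
rewrite (psi0 b) ?ltxx ?andbF// !mulr0 add0r RintegralD//.
- move/esym/eqP; rewrite addrC addr_eq0 => /eqP ->; congr (- _).
  by apply: eq_Rintegral => x _; rewrite mulrC.
- by apply: sqint_integrable => //; [exact: itv_oc_lty|apply: (ac_sqint_mul _ apsi); case: ug].
- by apply: sqint_integrable => //; [exact: itv_oc_lty|apply: (ac_sqint_mul _ ug); case: apsi].
Qed.

Lemma locally_integrable_test g phi : locally_integrable Rpos g -> test_function phi ->
  mu.-integrable Rpos (fun x => (g x * phi x)%:E).
Proof.
move=> [mg _ gK] tphi; have [_ [a [b [a0 ab phi0]]]] := test_functionP tphi.
have mab : measurable (`[a, b]%classic : set (measurableTypeR R)) by exact: measurable_itv.
have sub : `[a, b] `<=` @Rpos R.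
  by move=> x; rewrite RposE /= in_itv/= => /andP[+ _]; exact: lt_le_trans.
apply: (@integrable_supp _ _ _ mu `[a, b]%classic Rpos (fun x => g x * phi x)) => //.
  move=> x _ xab; rewrite phi0 ?mulr0//; apply/negP => /andP[ax xb]; apply: xab.
  by rewrite /= in_itv/= !ltW.
apply: (@integrableMl _ _ _ mu _ mab (EFin \o g) phi).
- apply/integrableP; split; first by apply/measurable_EFinP; exact: (measurable_funS measurable_Rpos sub).
  exact: gK (@segment_compact _ _ _).
- exact: test_function_measurable.
- have : bounded_set (phi @` `[a, b]).
    apply: compact_bounded; apply: continuous_compact; last exact: segment_compact.
    by apply: continuous_subspaceT; exact: test_function_continuous.
  by move=> [M [Mr HM]]; exists M; split=> // y /HM h x xab; apply: h; exists x.
Qed.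

Lemma weak_derivative_unique u g h : is_weak_derivative u g -> is_weak_derivative u h ->
  {ae mu, forall x, Rpos x -> g x = h x}.
Proof.
move=> [lg ug] [lh uh].
have : {ae mu, forall x, Rpos x -> g x - h x = 0}.
  apply: Rintegral_test_ae0; first exact: locally_integrableB.
  move=> phi tphi; under eq_Rintegral do rewrite mulrBl.
  rewrite RintegralB//; [|exact: locally_integrable_test|exact: locally_integrable_test].
  by apply/eqP; rewrite subr_eq0 -eqr_opp -ug// -uh.
by apply: ae_imp => x /[apply] /eqP; rewrite subr_eq0 => /eqP.
Qed.

(** Since g is a weak derivative, the choice made in [weak_derivative] is one as well, and the
    fundamental lemma identifies the two. *)
Lemma ac_weak_derivative c u g : ac c u g ->
  measurable_fun (Rpos : set (measurableTypeR R)) (weak_derivative u) /\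
  {ae mu, forall x, Rpos x -> weak_derivative u x = g x}.
Proof.
move=> ug; have h : is_weak_derivative u (weak_derivative u).
  by apply: xgetPex; exists g; exact: ac_is_weak_derivative ug.
split; first by case: h => -[].
exact: weak_derivative_unique h (ac_is_weak_derivative ug).
Qed.

End weak_derivatives.

(** * The admissible class as the primitives of square integrable functions *)

Section admissible_functions.
Context {R : realType}.
Local Notation mu := (@lebesgue_measure R).
Implicit Types (u v g h phi psi theta : R -> R) (c s t x beta : R).
Let mpos := @measurable_Rpos R.

Lemma acB c1 c2 u1 u2 g1 g2 : ac c1 u1 g1 -> ac c2 u2 g2 ->
  ac (c1 - c2) (fun x => u1 x - u2 x) (fun x => g1 x - g2 x).
Proof.
move=> h1 h2; have := ac_lin 1 (-1) h1 h2; rewrite mul1r mulN1r.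
by apply: ac_eq => x _; rewrite mul1r mulN1r.
Qed.

Lemma sqr_cvg0 (f : nat -> R) : f n ^+ 2 @[n --> \oo] --> (0 : R) -> f n @[n --> \oo] --> (0 : R).
Proof.
move=> h; apply/cvgrPdist_le => e e0.
have e2 : 0 < e ^+ 2 by rewrite exprn_gt0.
have /cvgrPdist_le/(_ _ e2) := h; apply: filterS => n.
rewrite !sub0r !normrN ger0_norm ?sqr_ge0// -[f n ^+ 2]real_normK ?num_real//.
by rewrite ler_pXn2r// ?nnegrE// ltW.
Qed.

(** All functions share the value c at 0, so the squared difference at x is at most x times the
    squared L^2 distance of the derivatives. *)
Lemma ac_cvg (c : R) (u_ g_ : nat -> R -> R) u g : (forall n, ac c (u_ n) (g_ n)) ->
  ac c u g -> sqnorm mu Rpos (fun x => g_ n x - g x) @[n --> \oo] --> 0 ->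
  forall x, 0 <= x -> u_ n x @[n --> \oo] --> u x.
Proof.
move=> h_ h hg x x0.
apply: (@cvg_sub0 _ _ _ _ _ _ (fun=> u x)); last exact: cvg_cst.
apply: sqr_cvg0.
apply: (@squeeze_cvgr _ _ _ _ (fun=> 0) (fun n => sqnorm mu Rpos (fun x => g_ n x - g x) * x)).
- apply: nearW => n; rewrite sqr_ge0 /=.
  have := ac_diff_sqr_le (acB (h_ n) h) (lexx 0) x0.
  by rewrite (ac0 (h_ n)) (ac0 h) subrr !subr0.
- exact: cvg_cst.
- by rewrite -(mul0r x); apply: cvgM => //; exact: cvg_cst.
Qed.

Lemma H10_normE phi psi : test_function phi -> test_function psi ->
  H10_norm (phi \- psi) =
  Num.sqrt (sqnorm mu Rpos (fun x => derive1 phi x - derive1 psi x)).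
Proof.
move=> [sphi _] [spsi _]; congr Num.sqrt; apply: eq_Rintegral => x _; congr (_ ^+ 2).
by rewrite !derive1E deriveB//; exact: smooth_derivable.
Qed.

Lemma ac_primitive c g : sqint mu Rpos g ->
  ac c (fun x => c + \int[mu]_(t in `]0, x]) g t) g.
Proof. by []. Qed.

(** The derivatives of the approximating test functions are Cauchy in L^2. The primitive of their
    limit is also the pointwise limit of the test functions, hence equals theta - beta. *)
Lemma admissible_ac beta theta : admissible beta theta -> exists g, ac beta theta g.
Proof.
move=> [_ [phi [tphi phiC phicvg]]].
have s_ n : sqint mu Rpos (derive1 (phi n)).
  by apply: test_function_sqint => //; exact: test_function_derive1.
have [|g [k [sg _ _ cvg_g]]] := @riesz_fischer _ _ _ mu Rpos mpos _ s_.
  move=> e e0; have se0 : 0 < Num.sqrt e by rewrite sqrtr_gt0.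
  have [N NP] := phiC _ se0; exists N => m n Nm Nn.
  by have := NP m n Nm Nn; rewrite H10_normE// ltr_sqrt.
exists g; split=> // x x0; apply/eqP; rewrite addrC -subr_eq; apply/eqP.
have xnn : Rnneg x by rewrite /Rnneg /= in_itv/= x0.
have := ac_cvg (fun n => ac_test_function (tphi n)) (ac_primitive 0 sg) cvg_g x0.
by rewrite add0r => h; exact: (cvg_unique (@Rhausdorff R) (phicvg x xnn) h).
Qed.

Lemma derive1_lin phi psi (a b : R) : smooth phi -> smooth psi -> forall x,
  derive1 (fun x => a * phi x + b * psi x) x = a * derive1 phi x + b * derive1 psi x.
Proof.
move=> sphi spsi x; apply: derive1_val; apply: is_derive1D; apply: is_derive1Z;
  by apply: derivable_is; exact: smooth_derivable.
Qed.

Lemma test_function_lin phi psi (a b : R) : test_function phi -> test_function psi ->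
  test_function (fun x => a * phi x + b * psi x).
Proof. by move=> tphi tpsi; apply: test_functionD; exact: test_functionZ. Qed.

Lemma sqnorm_ae (f g : R -> R) : measurable_fun (Rpos : set (measurableTypeR R)) f ->
  measurable_fun (Rpos : set (measurableTypeR R)) g ->
  {ae mu, forall x, Rpos x -> f x = g x} -> sqnorm mu Rpos f = sqnorm mu Rpos g.
Proof.
move=> mf mg fg; congr fine; apply: ae_eq_integral => //.
- by apply/measurable_EFinP; exact: measurable_funX.
- by apply/measurable_EFinP; exact: measurable_funX.
- by apply: ae_imp fg => x fgx /fgx ->.
Qed.

(** Moving phi by t psi cannot bring the squared distance below d, hence lowers it by at most e; the
    discriminant of this quadratic in t gives the bound. *)
Lemma sqnorm_orthogonal_small g (d e : R) : sqint mu Rpos g ->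
  (forall phi, test_function phi -> d <= sqnorm mu Rpos (fun x => g x - derive1 phi x)) ->
  forall phi psi, test_function phi -> test_function psi ->
  sqnorm mu Rpos (fun x => g x - derive1 phi x) <= d + e ->
  (\int[mu]_(x in Rpos) ((g x - derive1 phi x) * derive1 psi x)) ^+ 2
    <= e * sqnorm mu Rpos (derive1 psi).
Proof.
move=> sg dmin phi psi tphi tpsi phie.
have sdp : sqint mu Rpos (derive1 psi).
  by apply: test_function_sqint => //; exact: test_function_derive1.
have sgp : sqint mu Rpos (fun x => g x - derive1 phi x).
  by apply: sqintB => //; apply: test_function_sqint => //; exact: test_function_derive1.
apply: quad_ge0 => t.
have := dmin _ (test_function_lin 1 (- t) tphi tpsi).
rewrite [X in _ <= X](_ : _ =
    sqnorm mu Rpos (fun x => (g x - derive1 phi x) + t * derive1 psi x)); last first.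
  apply: eq_Rintegral => x _; congr (_ ^+ 2).
  by rewrite (derive1_lin _ _ tphi.1 tpsi.1); ring.
by rewrite sqnormDZ//; lra.
Qed.

(* Riesz' projection argument: a minimizing sequence for the distance to g is
   Cauchy, and its residual is orthogonal to all derivatives of test functions,
   hence a constant, hence 0 since it is square integrable on a half-line. *)
Lemma sqint_derive_dense g : sqint mu Rpos g ->
  exists phi : nat -> R -> R, (forall n, test_function (phi n)) /\
    sqnorm mu Rpos (fun x => derive1 (phi n) x - g x) @[n --> \oo] --> 0.
Proof.
move=> sg.
pose S := [set sqnorm mu Rpos (fun x => g x - derive1 phi x) | phi in test_function].
have S0 : S !=set0.
  exists (sqnorm mu Rpos (fun x => g x - derive1 (fun=> 0) x)).
  by exists (fun=> 0) => //; exact: test_function0.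
have Slb : lbound S 0 by move=> _ [phi _ <-]; exact: sqnorm_ge0.
pose d := inf S.
have dmin phi : test_function phi -> d <= sqnorm mu Rpos (fun x => g x - derive1 phi x).
  by move=> tphi; apply: ge_inf; [exists 0|exists phi].
have /choice[phi phiP] n : exists phi, test_function phi /\
    sqnorm mu Rpos (fun x => g x - derive1 phi x) < d + n.+1%:R^-1.
  have [|_ [phi tphi <-] h] := @inf_adherent R S n.+1%:R^-1 _ (conj S0 (ex_intro _ 0 Slb)).
    by rewrite invr_gt0.
  by exists phi.
have tphi n := (phiP n).1.
have sdphi n : sqint mu Rpos (derive1 (phi n)).
  by apply: test_function_sqint => //; exact: test_function_derive1.
have sgphi n : sqint mu Rpos (fun x => g x - derive1 (phi n) x) by exact: sqintB.
have [|h [k [sh _ _ cvg_h]]] := @riesz_fischer _ _ _ mu Rpos mpos _ sdphi.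
  move=> e e0; have e4 : 0 <= 4 / e by rewrite divr_ge0 ?ltW.
  exists (Num.bound (4 / e)) => m n Nm Nn.
  (* By the parallelogram identity, and since the midpoint of [phi m] and [phi n] is at squared
     distance at least d from g, the squared distance between their derivatives is at most 2 / (m +
     1) + 2 / (n + 1). *)
  have small k : (Num.bound (4 / e) <= k)%N -> 2 * k.+1%:R^-1 < e / 2.
    move=> Nk; have : 4 / e < k.+1%:R.
      by apply: lt_le_trans (archi_boundP e4) _; rewrite ler_nat ltnW.
    rewrite ltr_pdivrMr// => h; rewrite ltr_pdivrMr// -mulrA; nra.
  have := small m Nm; have := small n Nn.
  have [_ hm] := phiP m; have [_ hn] := phiP n.
  have := dmin _ (test_function_lin 2^-1 2^-1 (tphi m) (tphi n)).
  have -> : sqnorm mu Rpos (fun x => derive1 (phi m) x - derive1 (phi n) x) =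
      sqnorm mu Rpos (fun x => (g x - derive1 (phi n) x) - (g x - derive1 (phi m) x)).
    by apply: eq_Rintegral => x _; congr (_ ^+ 2); ring.
  rewrite [X in _ <= X](_ : _ = sqnorm mu Rpos
      (fun x => 2^-1 * ((g x - derive1 (phi n) x) + (g x - derive1 (phi m) x)))); last first.
    apply: eq_Rintegral => x _; congr (_ ^+ 2).
    by rewrite (derive1_lin _ _ (tphi m).1 (tphi n).1); field.
  rewrite sqnormZ//; last exact: sqintD.
  rewrite sqnormB// sqnormD//.
  set I := Rintegral _ _ _; set A := sqnorm _ _ _ in hm *; set B := sqnorm _ _ _ in hn *.
  move: m.+1%:R^-1 n.+1%:R^-1 hm hn => p q; lra.
exists phi; split => //.
suff hg : {ae mu, forall x, Rpos x -> g x - h x = 0}.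
  under eq_fun => n.
    rewrite (@sqnorm_ae _ (fun x => derive1 (phi n) x - h x)); first over.
    - by apply: measurable_funB; [case: (sdphi n) | case: sg].
    - by apply: measurable_funB; [case: (sdphi n) | case: sh].
    - by apply: ae_imp hg => x /[apply] /eqP; rewrite subr_eq0 => /eqP ->.
  exact: cvg_h.
apply: sqint_orthogonal_ae0; first exact: sqintB.
move=> psi tpsi; set I := Rintegral _ _ _.
have sdp : sqint mu Rpos (derive1 psi).
  by apply: test_function_sqint => //; exact: test_function_derive1.
pose P := sqnorm mu Rpos (derive1 psi).
(* The residual g - h is split at the derivative of [phi n]: near minimality controls the first
   part, L^2 convergence the second. *)
have IP n : I ^+ 2 <= 2 * P * (n.+1%:R^-1 + sqnorm mu Rpos (fun x => derive1 (phi n) x - h x)).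
  have h1 := sqnorm_orthogonal_small sg dmin (tphi n) tpsi (ltW (phiP n).2).
  have sd := sqintB mpos (sdphi n) sh.
  have h2 := cauchy_schwarz mpos sd sdp.
  have -> : I = \int[mu]_(x in Rpos) ((g x - derive1 (phi n) x) * derive1 psi x) +
      \int[mu]_(x in Rpos) ((derive1 (phi n) x - h x) * derive1 psi x).
    rewrite -RintegralD//; [|exact: sqint_mul|exact: sqint_mul].
    by apply: eq_Rintegral => x _; ring.
  move: h1 h2; rewrite -/P; set X := Rintegral _ _ _; set Y := Rintegral _ _ _.
  set r := sqnorm _ _ _; move: n.+1%:R^-1 r P X Y => p r P' X Y h1 h2.
  by have := sqr_ge0 (X - Y); lra.
apply/eqP; rewrite -sqrf_eq0 eq_le sqr_ge0 andbT.
suff lim0 : 2 * P * (n.+1%:R^-1 + sqnorm mu Rpos (fun x => derive1 (phi n) x - h x))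
    @[n --> \oo] --> 2 * P * (0 + 0).
  rewrite addr0 mulr0 in lim0.
  by apply: (cvgr_to_ge lim0); exact: nearW.
apply: cvgM; first exact: cvg_cst.
by apply: cvgD => //; exact: cvg_harmonic.
Qed.

(** Test functions whose derivatives approach g in L^2 are Cauchy for [H10_norm], and they converge
    pointwise to theta - beta because both vanish at 0. *)
Lemma ac_admissible beta theta g : ac beta theta g -> admissible beta theta.
Proof.
move=> thg; split; first exact: ac_continuous thg.
have [phi [tphi phig]] := sqint_derive_dense thg.1.
exists phi; split => //.
- move=> e e0; have e2 : 0 < e ^+ 2 / 4 by rewrite divr_gt0// exprn_gt0.
  have /cvgrPdist_lt/(_ _ e2) [N _ NP] := phig; exists N => m n Nm Nn.
  have sd k : sqint mu Rpos (fun x => derive1 (phi k) x - g x).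
    apply: sqintB => //; last by case: thg.
    by apply: test_function_sqint => //; exact: test_function_derive1.
  rewrite H10_normE// -[ltRHS]gtr0_norm// -sqrtr_sqr ltr_sqrt ?exprn_gt0//.
  have small j : (N <= j)%N -> sqnorm mu Rpos (fun x => derive1 (phi j) x - g x) < e ^+ 2 / 4.
    by move=> /NP /=; rewrite sub0r normrN ger0_norm ?sqnorm_ge0.
  have := small m Nm; have := small n Nn.
  have -> : sqnorm mu Rpos (fun x => derive1 (phi m) x - derive1 (phi n) x) =
      sqnorm mu Rpos (fun x => (derive1 (phi m) x - g x) + (-1) * (derive1 (phi n) x - g x)).
    by apply: eq_Rintegral => x _; congr (_ ^+ 2); ring.
  have := sqnorm_triangle mpos (sd m) (sqintZ mpos (-1) (sd n)).
  rewrite (sqnormZ mpos (-1) (sd n)).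
  set A := sqnorm _ _ _; set B := sqnorm _ _ _; set C := sqnorm _ _ _.
  by move: A B C => A B C; lra.
- move=> x; rewrite /Rnneg /= in_itv/= andbT => x0.
  apply: (@ac_cvg 0 phi (fun n => derive1 (phi n)) (fun x => theta x - beta) g) => //.
    by move=> n; exact: ac_test_function.
  have := acB thg (ac_primitive beta (sqint0 mu mpos)); rewrite subrr.
  apply: ac_eq => y; first by move=> _; rewrite subr0.
  by move=> _; rewrite Rintegral_cst// mul0r addr0.
Qed.

End admissible_functions.

(** * Elementary inequalities *)

Section convexity_inequalities.
Context {R : realFieldType}.
Implicit Types (p q s t : R).

(** Joint convexity of p^2 / a, which also decreases in a. The gap at the exact midpoint is (p b - q
    a)^2 / (2 a b (a + b)). *)
Lemma quadratic_over_linear_midpoint p q (a b c : R) : 0 < a -> 0 < b ->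
  (a + b) / 2 <= c ->
  (2^-1 * (p + q)) ^+ 2 / c <= 2^-1 * (p ^+ 2 / a + q ^+ 2 / b).
Proof.
move=> a0 b0 abc; have ab0 : 0 < a + b by exact: addr_gt0.
apply: (@le_trans _ _ ((2^-1 * (p + q)) ^+ 2 / ((a + b) / 2))).
  rewrite ler_wpM2l ?sqr_ge0// lef_pV2 ?posrE//; last by rewrite divr_gt0.
  by apply: lt_le_trans abc; rewrite divr_gt0.
rewrite -subr_ge0 (_ : _ - _ = (p * b - q * a) ^+ 2 / (2 * a * b * (a + b))).
  by rewrite divr_ge0 ?sqr_ge0// ltW// !mulr_gt0.
by field; rewrite !gt_eqF.
Qed.

(** The function is the reciprocal of 1 / (1 - x^2) - 1/2. It equals 4 / (1 + x^2) - 2, which is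
    concave as long as 3 x^2 <= 1. *)
Lemma concave_ratio_midpoint s t : `|s| <= 2^-1 -> `|t| <= 2^-1 ->
  (2 * (1 - s ^+ 2) / (1 + s ^+ 2) + 2 * (1 - t ^+ 2) / (1 + t ^+ 2)) / 2 <=
  2 * (1 - (2^-1 * (s + t)) ^+ 2) / (1 + (2^-1 * (s + t)) ^+ 2).
Proof.
move=> s2 t2; set m := 2^-1 * (s + t).
have m2 : m ^+ 2 <= 4^-1.
  have : `|m| <= 2^-1.
    by rewrite /m normrM ger0_norm// (le_trans (ler_wpM2l _ (ler_normD s t)))//; lra.
  by rewrite ler_norml => /andP[]; nra.
have pos (x : R) : 0 < 1 + x ^+ 2 :> R by rewrite ltr_pwDl ?sqr_ge0.
rewrite -subr_ge0; pose d := 2^-1 * (s - t).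
have sE : s = m + d by rewrite /m /d; field.
have tE : t = m - d by rewrite /m /d; field.
rewrite [X in 0 <= X](_ : _ = 4 * d ^+ 2 * (1 - 3 * m ^+ 2 + d ^+ 2) /
   ((1 + m ^+ 2) * (1 + s ^+ 2) * (1 + t ^+ 2)) / 1); last first.
  by rewrite sE tE; field; rewrite -sE -tE !gt_eqF.
rewrite divr1 divr_ge0//; last by rewrite ltW// !mulr_gt0.
have d2 := sqr_ge0 d; apply: mulr_ge0; first exact: mulr_ge0.
by move: m2 d2; move: (m ^+ 2) (d ^+ 2) => x y; lra.
Qed.

(** Split p^2 / (1 - s^2) into p^2 / 2, whose midpoint gap is exactly (p - q)^2 / 8, and a remainder
    p^2 / a with a concave in s, which is jointly convex. *)
Lemma kinetic_midpoint p q s t : `|s| <= 2^-1 -> `|t| <= 2^-1 ->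
  (2^-1 * (p + q)) ^+ 2 / (1 - (2^-1 * (s + t)) ^+ 2) + 8^-1 * (p - q) ^+ 2 <=
  2^-1 * (p ^+ 2 / (1 - s ^+ 2) + q ^+ 2 / (1 - t ^+ 2)).
Proof.
move=> s2 t2; set m := 2^-1 * (s + t).
have m2 : `|m| <= 2^-1.
  by rewrite /m normrM ger0_norm// (le_trans (ler_wpM2l _ (ler_normD s t)))//; lra.
have sq (x : R) : `|x| <= 2^-1 -> 0 < 1 - x ^+ 2 :> R by rewrite ler_norml => /andP[]; nra.
have pos (x : R) : 0 < 1 + x ^+ 2 :> R by rewrite ltr_pwDl ?sqr_ge0.
have split_k (x r : R) : `|x| <= 2^-1 -> r ^+ 2 / (1 - x ^+ 2) =
    2^-1 * r ^+ 2 + r ^+ 2 / (2 * (1 - x ^+ 2) / (1 + x ^+ 2)).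
  by move=> /sq x0; field; rewrite !gt_eqF.
have g0 (x : R) : `|x| <= 2^-1 -> 0 < 2 * (1 - x ^+ 2) / (1 + x ^+ 2).
  by move=> /sq x0; rewrite divr_gt0// mulr_gt0.
have := quadratic_over_linear_midpoint p q (g0 s s2) (g0 t t2) (concave_ratio_midpoint s2 t2).
rewrite !split_k// -/m; set X := _ / _; set Y := _ / _; set Z := _ / _.
by move: X Y Z => X Y Z; lra.
Qed.

(** Bounds the failure of x sqrt(1 - x^2) to be affine, the cross term in sin(theta)^2 once it is
    written in u. With d = (s - t) / 2 the left-hand side is m (A + B - 2 M) + d (A - B), at most
    d^2 + 5/4 d^2, while the right-hand side is 4 d^2. *)
Lemma sqrt_product_midpoint s t m (A B M : R) : `|s| <= 2^-1 -> `|t| <= 2^-1 ->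
  m = 2^-1 * (s + t) -> 4 / 5 <= A -> 4 / 5 <= B -> 4 / 5 <= M ->
  A ^+ 2 = 1 - s ^+ 2 -> B ^+ 2 = 1 - t ^+ 2 -> M ^+ 2 = 1 - m ^+ 2 ->
  `|s * A + t * B - 2 * (m * M)| <= (s - t) ^+ 2.
Proof.
move=> s2 t2 mE A0 B0 M0 AE BE ME; pose d := 2^-1 * (s - t).
have sE : s = m + d by rewrite mE /d; field.
have tE : t = m - d by rewrite mE /d; field.
have -> : (s - t) ^+ 2 = 4 * d ^+ 2 by rewrite /d; field.
clearbody d.
have m2 : `|m| <= 2^-1.
  by rewrite mE normrM ger0_norm// (le_trans (ler_wpM2l _ (ler_normD s t)))//; lra.
have AB : `|A - B| <= 5 / 4 * `|d|.
  have : `|A - B| * (A + B) <= 2 * `|d|.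
    have -> : `|A - B| * (A + B) = `|4 * m * d|.
      rewrite -[A + B]ger0_norm; last by lra.
      rewrite -normrM -[RHS]normrN; congr (`|_|).
      have -> : (A - B) * (A + B) = A ^+ 2 - B ^+ 2 by ring.
      by rewrite AE BE sE tE; ring.
    rewrite !normrM [`|4|]ger0_norm// ler_wpM2r//; lra.
  by have := normr_ge0 (A - B); nra.
have AB2 : (A - B) ^+ 2 <= 25 / 16 * d ^+ 2.
  rewrite -(real_normK (num_real (A - B))) -(real_normK (num_real d)).
  by have := normr_ge0 (A - B); have := normr_ge0 d; nra.
have ABM : `|A + B - 2 * M| <= 2 * d ^+ 2.
  have : `|A + B - 2 * M| * (A + B + 2 * M) = 4 * d ^+ 2 + (A - B) ^+ 2.
    rewrite -[A + B + 2 * M]ger0_norm; last by lra.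
    rewrite -normrM -[4 * d ^+ 2 + _]ger0_norm; last by have := sqr_ge0 d; have := sqr_ge0 (A - B); lra.
    rewrite -normrN; congr (`|_|).
    have -> : - ((A + B - 2 * M) * (A + B + 2 * M)) =
      4 * M ^+ 2 - 2 * A ^+ 2 - 2 * B ^+ 2 + (A - B) ^+ 2 by ring.
    by rewrite ME AE BE sE tE; ring.
  by have := normr_ge0 (A + B - 2 * M); have := sqr_ge0 d; nra.
have -> : s * A + t * B - 2 * (m * M) = m * (A + B - 2 * M) + d * (A - B).
  by rewrite sE tE; ring.
apply: (le_trans (ler_normD _ _)); rewrite !normrM.
have h1 : `|m| * `|A + B - 2 * M| <= 2^-1 * (2 * d ^+ 2) by rewrite ler_pM.
have h2 : `|d| * `|A - B| <= 5 / 4 * d ^+ 2.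
  apply: (le_trans (ler_wpM2l (normr_ge0 d) AB)).
  by rewrite mulrCA -expr2 real_normK ?num_real.
by have := sqr_ge0 d; lra.
Qed.

End convexity_inequalities.

Section mean_value.
Context {R : realType}.
Variables (P : set R) (F F' : R -> R).
Hypothesis Pconvex : forall a b c : R, P a -> P b -> a <= c -> c <= b -> P c.
Hypothesis dF : forall x : R, P x -> is_derive x 1 F (F' x).

Lemma mean_value (a b : R) : P a -> P b ->
  exists2 c : R, P c /\ `|c - a| <= `|b - a| & F b - F a = F' c * (b - a).
Proof.
have main (x y : R) : P x -> P y -> x <= y ->
    exists2 c : R, x <= c <= y & F y - F x = F' c * (y - x).
  move=> Px Py xy.
  have dF' (z : R) : z \in `[x, y] -> is_derive z 1 F (F' z).
    by rewrite in_itv/= => /andP[xz zy]; apply: dF; exact: Pconvex Px Py xz zy.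
  have cF : {within `[x, y], continuous F}.
    by apply: derivable_within_continuous => z zxy; have [] := dF' z zxy.
  have oF (z : R) : z \in `]x, y[ -> is_derive z 1 F (F' z).
    by move=> zxy; apply: dF'; exact: subset_itv_oo_cc.
  have [c cxy h] := MVT_segment xy oF cF.
  by exists c => //; rewrite in_itv/= in cxy.
move=> Pa Pb; have [ab|/ltW ba] := leP a b.
  have [c /andP[ac cb] h] := main a b Pa Pb ab; exists c => //; split.
    exact: Pconvex Pa Pb ac cb.
  by rewrite !ger0_norm ?subr_ge0// lerD2r.
have [c /andP[bc ca] h] := main b a Pb Pa ba; exists c; first split.
- exact: Pconvex Pb Pa bc ca.
- by rewrite !ler0_norm ?subr_le0// lerN2 lerD2r.
- by rewrite -opprB h; ring.
Qed.

Lemma bounded_derive_lipschitz (M : R) : (forall x, P x -> `|F' x| <= M) ->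
  forall a b, P a -> P b -> `|F b - F a| <= M * `|b - a|.
Proof.
move=> F'M a b Pa Pb; have [c [Pc _] ->] := mean_value Pa Pb.
by rewrite normrM ler_wpM2r// F'M.
Qed.

Lemma lipschitz_derive_taylor (L : R) :
  (forall a b, P a -> P b -> `|F' b - F' a| <= L * `|b - a|) -> 0 <= L ->
  forall a b, P a -> P b -> `|F b - F a - F' a * (b - a)| <= L * (b - a) ^+ 2.
Proof.
move=> F'L L0 a b Pa Pb; have [c [Pc ca] ->] := mean_value Pa Pb.
rewrite -mulrBl normrM -(real_normK (num_real (b - a))) expr2 mulrA ler_wpM2r//.
by apply: (le_trans (F'L _ _ Pa Pc)); rewrite ler_wpM2l.
Qed.

End mean_value.

(** * Quantitative bounds for sin, cos and asin *)

Section trigonometric_bounds.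
Context {R : realType}.
Implicit Types x a b : R.

Lemma cos_max x : `|cos x| <= 1.
Proof. by rewrite ler_norml cos_geN1 cos_le1. Qed.

Lemma sin_lipschitz a b : `|sin b - sin a| <= `|b - a|.
Proof.
rewrite -[leRHS]mul1r.
apply: (@bounded_derive_lipschitz _ setT sin cos) => // x _.
exact: cos_max.
Qed.

Lemma cos_lipschitz a b : `|cos b - cos a| <= `|b - a|.
Proof.
rewrite -[leRHS]mul1r.
apply: (@bounded_derive_lipschitz _ setT cos (fun x => - sin x)) => // x _.
by rewrite normrN; exact: sin_max.
Qed.

Lemma sin_norm_le x : `|sin x| <= `|x|.
Proof. by have := sin_lipschitz 0 x; rewrite sin0 !subr0. Qed.

Lemma cos_ge1Bsqr x : 1 - x ^+ 2 <= cos x.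
Proof.
have [c [_ cx] h] := @mean_value R setT cos (fun x => - sin x)
  (fun _ _ _ _ _ _ _ => I) (fun x _ => is_derive_cos x) 0 x I I.
move: h cx; rewrite cos0 !subr0 => h cx.
have : `|cos x - 1| <= x ^+ 2.
  rewrite h normrM normrN -(real_normK (num_real x)) expr2 ler_wpM2r//.
  exact: le_trans (sin_norm_le c) cx.
by rewrite ler_norml => /andP[+ _]; lra.
Qed.

Lemma sin_taylor a b : `|sin b - sin a - cos a * (b - a)| <= 1 * (b - a) ^+ 2.
Proof.
apply: (@lipschitz_derive_taylor _ setT sin cos) => // x y _ _.
by rewrite mul1r; exact: cos_lipschitz.
Qed.

Lemma cos_taylor a b : `|cos b - cos a - - sin a * (b - a)| <= 1 * (b - a) ^+ 2.
Proof.
apply: (@lipschitz_derive_taylor _ setT cos (fun x => - sin x)) => // x y _ _.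
by rewrite mul1r -opprD normrN; exact: sin_lipschitz.
Qed.

(** The range of u on low energies. There sqrt(1 - x^2) >= sqrt(3) / 2 > 4/5, a rational bound used
    throughout, and the derivative of asin is Lipschitz. *)
Definition half_ball : set R := [set x | `|x| <= 2^-1].

Lemma half_ball_convex a b c : half_ball a -> half_ball b -> a <= c -> c <= b -> half_ball c.
Proof.
rewrite /half_ball /= !ler_norml => /andP[? ?] /andP[? ?] ac cb.
by apply/andP; split; lra.
Qed.

Lemma sqrt1Bsqr_ge x : half_ball x -> 4 / 5 <= Num.sqrt (1 - x ^+ 2).
Proof.
rewrite /half_ball /= => x2.
have h : (4 / 5) ^+ 2 <= 1 - x ^+ 2.
  by rewrite -(real_normK (num_real x)); have := normr_ge0 x; nra.
by rewrite -[leLHS]ger0_norm ?divr_ge0// -sqrtr_sqr ler_wsqrtr.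
Qed.

Lemma sqr_sqrt1Bsqr x : half_ball x -> Num.sqrt (1 - x ^+ 2) ^+ 2 = 1 - x ^+ 2.
Proof.
rewrite /half_ball /= => x2; apply: sqr_sqrtr.
by rewrite -(real_normK (num_real x)); have := normr_ge0 x; nra.
Qed.

Lemma sqrt1Bsqr_inv_lipschitz a b : half_ball a -> half_ball b ->
  `|(Num.sqrt (1 - b ^+ 2))^-1 - (Num.sqrt (1 - a ^+ 2))^-1| <= 2 * `|b - a|.
Proof.
move=> ha hb; have := sqrt1Bsqr_ge ha; have := sqrt1Bsqr_ge hb.
have := sqr_sqrt1Bsqr ha; have := sqr_sqrt1Bsqr hb.
set A := Num.sqrt (1 - a ^+ 2); set B := Num.sqrt _ => BE AE B0 A0.
have AB0 : 0 < A * B * (A + B) by rewrite !mulr_gt0// ?addr_gt0//; lra.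
have -> : B^-1 - A^-1 = (b - a) * (b + a) / (A * B * (A + B)).
  have -> : (b - a) * (b + a) = A ^+ 2 - B ^+ 2 by rewrite AE BE; ring.
  by field; rewrite !gt_eqF//; lra.
rewrite normrM normfV (gtr0_norm AB0) ler_pdivrMr// normrM [2 * _]mulrC -[leRHS]mulrA ler_wpM2l//.
apply: (@le_trans _ _ 1).
  by apply: (le_trans (ler_normD _ _)); move: ha hb; rewrite /half_ball/=; lra.
have AB : 16 / 25 <= A * B by rewrite (_ : 16 / 25 = 4 / 5 * (4 / 5)) ?ler_pM//; field.
nra.
Qed.

Lemma asin_taylor a b : half_ball a -> half_ball b ->
  `|asin b - asin a - (Num.sqrt (1 - a ^+ 2))^-1 * (b - a)| <= 2 * (b - a) ^+ 2.
Proof.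
apply: (@lipschitz_derive_taylor _ half_ball asin (fun x => (Num.sqrt (1 - x ^+ 2))^-1)) => //.
- exact: half_ball_convex.
- move=> x; rewrite /half_ball /= ler_norml => /andP[? ?]; apply: is_derive1_asin.
  by apply/andP; split; lra.
- exact: sqrt1Bsqr_inv_lipschitz.
Qed.

End trigonometric_bounds.

Lemma limn_einf_superadd {R : realType} (a b : nat -> \bar R) :
  (forall n, 0 <= a n)%E -> (forall n, 0 <= b n)%E ->
  (limn_einf a + limn_einf b <= limn_einf (fun n => a n + b n))%E.
Proof.
move=> a0 b0.
have einfs0 (u : nat -> \bar R) n : (forall n, 0 <= u n)%E -> (0 <= einfs u n)%E.
  by move=> u0; apply: le_ereal_inf_tmp => _ [m _ <-].
have lim0 (u : nat -> \bar R) : (forall n, 0 <= u n)%E -> (0 <= limn (einfs u))%E.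
  by move=> u0; apply: lime_ge; [exact: is_cvg_einfs|apply: nearW => n; exact: einfs0].
rewrite !limn_einf_lim -limeD; [|exact: is_cvg_einfs|exact: is_cvg_einfs|]; last first.
  by apply: ge0_adde_def; rewrite inE; exact: lim0.
apply: lee_lim; [|exact: is_cvg_einfs|].
  apply: is_cvgeD; [|exact: is_cvg_einfs|exact: is_cvg_einfs].
  by apply: ge0_adde_def; rewrite inE; exact: lim0.
apply: nearW => n; apply: le_ereal_inf_tmp => _ [m /= nm <-].
by apply: leeD; apply: ereal_inf_lbound; exists m.
Qed.

(** Inversion is continuous off 0, and the convention 0^-1 = 0 only concerns a measurable
    singleton. *)
Lemma measurable_inv {R : realType} : measurable_fun setT (fun x : R => x^-1).
Proof.
rewrite -(setUv [set (0 : R)]); apply/measurable_funU => //.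
  exact: measurableC.
split; first exact: measurable_fun_set1.
apply: open_continuous_measurable_fun.
  exact/closed_openC/accessible_closed_set1/hausdorff_accessible/Rhausdorff.
by move=> x; rewrite inE /= => /eqP x0; exact: inv_continuous.
Qed.

(** * The energy *)

Section integral_plus_seminorm.
Context {R : realType}.
Local Notation mu := (@lebesgue_measure R).
Local Notation mR := (measurableTypeR R).
Local Notation Rp := (Rpos : set (measurableTypeR R)).
Variable k : R.
Hypothesis k0 : 0 <= k.
Implicit Types (f q : R -> R).

Definition gagliardo_density f (x : R) : \bar R :=
  (\int[mu]_(y in Rpos) ((f x - f y) ^+ 2 / (x - y) ^+ 2)%:E)%E.

Definition seminorm_density f (x : R) : \bar R :=
  (\int[mu]_(y in Rpos) (k * ((f x - f y) ^+ 2 / (x - y) ^+ 2))%:E)%E.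

(** A single outer integral, so that Fatou's lemma and the midpoint inequality act on one
    nonnegative integrand; [total_energy_split] recovers the local and nonlocal terms. *)
Definition total_energy q f : \bar R :=
  (\int[mu]_(x in Rpos) ((q x)%:E + seminorm_density f x))%E.

Lemma quotient_ge0 f x y : 0 <= (f x - f y) ^+ 2 / (x - y) ^+ 2.
Proof. by rewrite divr_ge0// sqr_ge0. Qed.

Lemma seminorm_integrand_ge0 f x y : 0 <= k * ((f x - f y) ^+ 2 / (x - y) ^+ 2).
Proof. by rewrite mulr_ge0// quotient_ge0. Qed.

Lemma gagliardo_density_ge0 f x : (0 <= gagliardo_density f x)%E.
Proof. by apply: integral_ge0 => y _; rewrite lee_fin quotient_ge0. Qed.

Lemma seminorm_density_ge0 f x : (0 <= seminorm_density f x)%E.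
Proof. by apply: integral_ge0 => y _; rewrite lee_fin seminorm_integrand_ge0. Qed.

Lemma measurable_quotient f x : measurable_fun Rp f ->
  measurable_fun Rp (fun y => (f x - f y) ^+ 2 / (x - y) ^+ 2).
Proof.
move=> mf; apply: measurable_funM.
  by apply: measurable_funX; exact: measurable_funB.
apply: (measurableT_comp measurable_inv); apply: measurable_funX.
exact: measurable_funB.
Qed.

Lemma measurable_seminorm_integrand f x : measurable_fun Rp f ->
  measurable_fun Rp (fun y => k * ((f x - f y) ^+ 2 / (x - y) ^+ 2)).
Proof. by move=> mf; apply: measurable_funM => //; exact: measurable_quotient. Qed.

Lemma seminorm_densityE f x : measurable_fun Rp f ->
  seminorm_density f x = (k%:E * gagliardo_density f x)%E.
Proof.
move=> mf; rewrite /seminorm_density; under eq_integral do rewrite EFinM.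
rewrite ge0_integralZl_EFin// => [y _|]; first by rewrite lee_fin quotient_ge0.
by apply/measurable_EFinP; exact: measurable_quotient.
Qed.

(** Tonelli's theorem on the whole plane: f is extended by 0 outside the half-line, and an indicator
    restricts the inner variable. *)
Lemma measurable_gagliardo_density f : measurable_fun Rp f ->
  measurable_fun Rp (gagliardo_density f).
Proof.
move=> mf; pose F := f \_ Rp.
have mF : measurable_fun setT F by apply/(measurable_restrictT _ _).1.
pose h (z : mR * mR) : \bar R :=
  ((F z.1 - F z.2) ^+ 2 * ((z.1 - z.2) ^+ 2)^-1 * \1_Rp z.2)%:E.
have mh : measurable_fun setT h.
  apply/measurable_EFinP; apply: measurable_funM; last first.
    by apply: measurableT_comp; [exact: measurable_indic|exact: measurable_snd].
  apply: measurable_funM.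
    apply: measurable_funX; apply: measurable_funB.
      by apply: (measurableT_comp mF); exact: measurable_fst.
    by apply: (measurableT_comp mF); exact: measurable_snd.
  apply: (measurableT_comp measurable_inv); apply: measurable_funX.
  by apply: measurable_funB; [exact: measurable_fst|exact: measurable_snd].
have h0 z : (0 <= h z)%E.
  by rewrite lee_fin mulr_ge0// mulr_ge0 ?invr_ge0 ?sqr_ge0.
have mG := measurable_fun_fubini_tonelli_F (m2 := mu) h mh h0.
apply: (@eq_measurable_fun _ _ _ _ _ (fubini_F mu h)); last exact: measurable_funTS.
move=> x xpos; rewrite /fubini_F /gagliardo_density [RHS]integral_mkcond.
apply: eq_integral => y _; rewrite /h patchE indicE /F !patchE /= xpos.
by case: ifPn => ypos; rewrite ?mulr1 ?mulr0.
Qed.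

Lemma measurable_seminorm_density f : measurable_fun Rp f ->
  measurable_fun Rp (seminorm_density f).
Proof.
move=> mf; rewrite (_ : seminorm_density f = (fun x => k%:E * gagliardo_density f x)%E).
  by apply: measurable_funeM; exact: measurable_gagliardo_density.
by apply/funext => x; exact: seminorm_densityE.
Qed.

Lemma total_energy_ge0 q f : (forall x, Rpos x -> 0 <= q x) -> (0 <= total_energy q f)%E.
Proof.
move=> q0; apply: integral_ge0 => x xp; rewrite adde_ge0 ?seminorm_density_ge0//.
by rewrite lee_fin q0.
Qed.

Lemma total_energy_split q f : (forall x, Rpos x -> 0 <= q x) -> measurable_fun Rp q ->
  measurable_fun Rp f ->
  total_energy q f = (\int[mu]_(x in Rpos) (q x)%:E + k%:E * gagliardo f)%E.
Proof.
move=> q0 mq mf; rewrite /total_energy ge0_integralD//; last 3 first.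
- exact/measurable_EFinP.
- by move=> x _; exact: seminorm_density_ge0.
- exact: measurable_seminorm_density.
congr (_ + _)%E; under eq_integral do rewrite seminorm_densityE//.
rewrite ge0_integralZl_EFin// => [x _|]; first exact: gagliardo_density_ge0.
exact: measurable_gagliardo_density.
Qed.

Lemma le_total_energy q f : (forall x, Rpos x -> 0 <= q x) -> measurable_fun Rp q ->
  measurable_fun Rp f ->
  (\int[mu]_(x in Rpos) (q x)%:E <= total_energy q f)%E.
Proof.
move=> q0 mq mf; rewrite /total_energy; apply: ge0_le_integral => //.
- exact/measurable_EFinP.
- by apply: emeasurable_funD; [exact/measurable_EFinP|exact: measurable_seminorm_density].
- by move=> x _; rewrite leeDl// seminorm_density_ge0.
Qed.

(** Fatou's lemma is applied twice, in y for each fixed x and then in x. The inner use needs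
    convergence of [f_] at x itself, so the sines are assumed to converge everywhere on the
    half-line and only the local densities almost everywhere. *)
Lemma total_energy_fatou (q_ f_ : nat -> R -> R) q f (M : \bar R) :
  (forall n x, Rpos x -> 0 <= q_ n x) -> (forall n, measurable_fun Rp (q_ n)) ->
  (forall n, measurable_fun Rp (f_ n)) ->
  (forall x, Rpos x -> 0 <= q x) -> measurable_fun Rp q -> measurable_fun Rp f ->
  {ae mu, forall x, Rpos x -> q_ n x @[n --> \oo] --> q x} ->
  (forall x, Rpos x -> f_ n x @[n --> \oo] --> f x) ->
  (\forall n \near \oo, (total_energy (q_ n) (f_ n) <= M)%E) ->
  (total_energy q f <= M)%E.
Proof.
move=> q_0 mq_ mf_ q0 mq mf qq ff.
apply: fatou_ae_le => //.
- move=> n; apply: emeasurable_funD; first exact/measurable_EFinP.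
  exact: measurable_seminorm_density.
- by move=> n x xp; rewrite adde_ge0 ?seminorm_density_ge0// lee_fin q_0.
- by apply: emeasurable_funD; [exact/measurable_EFinP|exact: measurable_seminorm_density].
- by move=> x xp; rewrite adde_ge0 ?seminorm_density_ge0// lee_fin q0.
apply: ae_imp qq => x qx xp; have {}qx := qx xp.
pose a n := if 0 <= q_ n x then (q_ n x)%:E else 0%E.
have aE n : a n = (q_ n x)%:E by rewrite /a q_0.
have := @limn_einf_superadd R (fun n => (q_ n x)%:E) (fun n => seminorm_density (f_ n) x)
  (fun n => q_0 n x xp) (fun n => seminorm_density_ge0 _ _).
apply: le_trans; apply: leeD.
  have /cvg_limn_einf_sup[-> _] : (q_ n x)%:E @[n --> \oo] --> (q x)%:E.
    by apply: cvg_EFin; [exact: nearW | exact: qx].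
  by [].
apply: (le_trans _ (@fatou _ _ _ mu _ measurable_Rpos
  (fun n y => (k * ((f_ n x - f_ n y) ^+ 2 / (x - y) ^+ 2))%:E) _ _)).
- apply: ge0_le_integral => //.
  + by move=> y _; rewrite lee_fin seminorm_integrand_ge0.
  + by apply/measurable_EFinP; exact: measurable_seminorm_integrand.
  + rewrite /limn_einf; apply: measurableT_comp => //.
    apply: measurable_fun_limn_esup => n; apply: measurableT_comp => //.
    by apply/measurable_EFinP; exact: measurable_seminorm_integrand.
  + move=> y yp.
    have /cvg_limn_einf_sup[-> _] :
        (k * ((f_ n x - f_ n y) ^+ 2 / (x - y) ^+ 2))%:E @[n --> \oo] -->
        (k * ((f x - f y) ^+ 2 / (x - y) ^+ 2))%:E.
      apply: cvg_EFin; first exact: nearW.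
      apply: cvgM; first exact: cvg_cst.
      apply: cvgM; last exact: cvg_cst.
      by rewrite expr2; under eq_fun do rewrite expr2; apply: cvgM; apply: cvgB; exact: ff.
    by [].
- by move=> n; apply/measurable_EFinP; exact: measurable_seminorm_integrand.
- by move=> n y _; rewrite lee_fin seminorm_integrand_ge0.
Qed.

End integral_plus_seminorm.

(** * The integrable weight 1 / (1 + x^2) and a bound on the Gagliardo seminorm *)

Section weight.
Context {R : realType}.
Local Notation mu := (@lebesgue_measure R).
Local Notation Rp := (Rpos : set (measurableTypeR R)).
Implicit Types x y : R.

Definition weight x := (oneDsqr x)^-1.

Lemma weight_gt0 x : 0 < weight x.
Proof. by rewrite /weight invr_gt0 /oneDsqr ltr_pwDl// sqr_ge0. Qed.

Lemma weight_ge0 x : 0 <= weight x.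
Proof. exact/ltW/weight_gt0. Qed.

Lemma weight_le2 x : 0 < x -> x <= 2 -> 1 <= 5 * weight x.
Proof.
move=> x0 x2; rewrite /weight /oneDsqr ler_pdivlMr; last by rewrite ltr_pwDl// sqr_ge0.
by rewrite mul1r; nra.
Qed.

Lemma weight_le1 x : 0 < x -> x <= 1 -> 1 <= 2 * weight x.
Proof.
move=> x0 x2; rewrite /weight /oneDsqr ler_pdivlMr; last by rewrite ltr_pwDl// sqr_ge0.
by rewrite mul1r; nra.
Qed.

Lemma weight_ge1 x : 1 <= x -> (x ^+ 2)^-1 <= 2 * weight x.
Proof.
move=> x1; have x2 : 0 < x ^+ 2 by rewrite exprn_gt0//; lra.
rewrite /weight /oneDsqr ler_pdivlMr; last by rewrite ltr_pwDl// sqr_ge0.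
by rewrite mulrC ler_pdivrMr//; nra.
Qed.

Lemma measurable_weight (D : set (measurableTypeR R)) : measurable_fun D weight.
Proof.
apply: measurable_funTS; apply: continuous_measurable_fun.
exact: continuous_oneDsqrV.
Qed.

Lemma integral_weight : (\int[mu]_(x in Rpos) (weight x)%:E = (pi / 2)%:E)%E.
Proof.
rewrite -integral0y_oneDsqr -[RHS]integral_itv_obnd_cbnd//.
by apply/measurable_EFinP; exact: measurable_weight.
Qed.

Lemma integrable_weight : mu.-integrable Rpos (EFin \o weight).
Proof.
apply/integrableP; split; first by apply/measurable_EFinP; exact: measurable_weight.
under eq_integral do rewrite /= ger0_norm ?weight_ge0//.
by rewrite integral_weight ltry.
Qed.

(** The quotient is at most 25 L^2 times the product of the weights at x and y. If x, y <= 2 it is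
    at most L^2; if x, y >= 1 it is 0; if x < 1 and y > 2 then y - x >= y / 2, and it is at most 4
    L^2 / y^2. Each weight integrates to pi / 2. *)
Lemma gagliardo_lipschitz (f : R -> R) (L : R) : measurable_fun Rp f -> 0 <= L ->
  (forall x y, 0 < x -> 0 < y -> `|f x - f y| <= L * `|x - y|) ->
  (forall x, 1 <= x -> f x = f 1) ->
  (gagliardo f <= (25 * L ^+ 2 * (pi / 2) ^+ 2)%:E)%E.
Proof.
move=> mf L0 fL f1.
have diag x : f x - f x = 0 by rewrite subrr.
have quot_le x y : 0 < x -> 0 < y -> (f x - f y) ^+ 2 / (x - y) ^+ 2 <= L ^+ 2.
  move=> x0 y0; have [->|xy] := eqVneq x y.
    by rewrite diag expr0n mul0r sqr_ge0.
  rewrite ler_pdivrMr; last by rewrite exprn_even_gt0//= subr_eq0.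
  rewrite -exprMn -(real_normK (num_real (f x - f y))) -(real_normK (num_real (L * _))).
  by rewrite lerXn2r ?nnegrE// normrM (ger0_norm L0) fL.
have far x y : 0 < x -> x < 1 -> 2 < y ->
    (f x - f y) ^+ 2 / (x - y) ^+ 2 <= 25 * L ^+ 2 * weight x * weight y.
  move=> x0 x1 y2; have y1 : 1 <= y by lra.
  have xy0 : 0 < (x - y) ^+ 2 by rewrite exprn_even_gt0//= subr_eq0 lt_eqF//; lra.
  have fxy : (f x - f y) ^+ 2 <= L ^+ 2.
    rewrite -(real_normK (num_real (f x - f y))) lerXn2r ?nnegrE//.
    rewrite (f1 y y1); apply: (le_trans (fL x 1 x0 ltr01)).
    rewrite -[leRHS]mulr1 ler_wpM2l//.
    by rewrite ler0_norm; lra.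
  have y20 : 0 < y ^+ 2 by rewrite exprn_gt0//; lra.
  have : (f x - f y) ^+ 2 / (x - y) ^+ 2 <= L ^+ 2 * (4 * (y ^+ 2)^-1).
    apply: ler_pM => //; [exact: sqr_ge0|by rewrite invr_ge0 ltW|].
    rewrite -[leLHS]mul1r ler_pdivrMr// mulrAC ler_pdivlMr// mul1r.
    nra.
  move=> /le_trans; apply.
  have w1 := weight_le1 x0 (ltW x1); have w2 := weight_ge1 y1.
  have wx := weight_ge0 x; have wy := weight_ge0 y.
  apply: (@le_trans _ _ (L ^+ 2 * (8 * weight y))); first by rewrite ler_wpM2l ?sqr_ge0//; lra.
  rewrite [leRHS](_ : _ = L ^+ 2 * (25 * weight x * weight y)); last by ring.
  by rewrite ler_wpM2l ?sqr_ge0//; nra.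
have pointwise x y : 0 < x -> 0 < y ->
    (f x - f y) ^+ 2 / (x - y) ^+ 2 <= 25 * L ^+ 2 * weight x * weight y.
  move=> x0 y0; have L2 := sqr_ge0 L.
  have rhs0 : 0 <= 25 * L ^+ 2 * weight x * weight y by rewrite !mulr_ge0 ?weight_ge0.
  have near2 : x <= 2 -> y <= 2 -> (f x - f y) ^+ 2 / (x - y) ^+ 2 <=
      25 * L ^+ 2 * weight x * weight y.
    move=> x2 y2; apply: (le_trans (quot_le x y x0 y0)).
    rewrite [leRHS](_ : _ = L ^+ 2 * (5 * weight x * (5 * weight y))); last by ring.
    by rewrite ler_peMr// mulr_ege1// weight_le2.
  have [x1|x1] := leP 1 x; have [y1|y1] := leP 1 y.
  - by rewrite (f1 x x1) (f1 y y1) diag expr0n mul0r.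
  - have [x2|x2] := leP x 2; first by apply: near2 => //; lra.
    rewrite (_ : (f x - f y) ^+ 2 = (f y - f x) ^+ 2); last by ring.
    rewrite (_ : (x - y) ^+ 2 = (y - x) ^+ 2); last by ring.
    rewrite [leRHS]mulrAC; exact: far.
  - have [y2|y2] := leP y 2; first by apply: near2 => //; lra.
    exact: far.
  - by apply: near2; lra.
apply: (@le_trans _ _ (\int[mu]_(x in Rpos) (25 * L ^+ 2 * (pi / 2) * weight x)%:E)%E); last first.
  under eq_integral do rewrite EFinM.
  rewrite integralZl//; last exact: integrable_weight.
  by rewrite integral_weight -EFinM lee_fin le_eqVlt; apply/orP; left; apply/eqP; ring.
apply: ge0_le_integral => //.
- by move=> x _; apply: integral_ge0 => y _; rewrite lee_fin quotient_ge0.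
- exact: measurable_gagliardo_density.
- by apply/measurable_EFinP; apply: measurable_funM => //; exact: measurable_weight.
- move=> x; rewrite RposE => x0.
  apply: (@le_trans _ _ (\int[mu]_(y in Rpos) (25 * L ^+ 2 * weight x * weight y)%:E)%E); last first.
    under eq_integral do rewrite EFinM.
    rewrite integralZl//; last exact: integrable_weight.
    by rewrite integral_weight -EFinM lee_fin le_eqVlt; apply/orP; left; apply/eqP; ring.
  apply: ge0_le_integral => //.
  + by move=> y _; rewrite lee_fin quotient_ge0.
  + by apply/measurable_EFinP; exact: measurable_quotient.
  + by apply/measurable_EFinP; apply: measurable_funM => //; exact: measurable_weight.
  + by move=> y; rewrite RposE => y0; rewrite lee_fin; exact: pointwise.
Qed.

End weight.

(** * A nonnegative local density *)

Section energy_density.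
Context {R : realType}.
Local Notation mu := (@lebesgue_measure R).
Local Notation Rp := (Rpos : set (measurableTypeR R)).
Variables (k beta : R).
Implicit Types (x p th : R).

(* Since eta vanishes on [1, +oo), the term sin(eta - beta)^2 of the energy equals
   [sin beta ^+ 2 * tail] there; on (0, 1) it contributes a constant.  The defect,
   integrable and independent of theta, completes the square that makes the
   density nonnegative. *)
Definition tail x : R := \1_(`[1, +oo[%classic) x.

Lemma tail_lt1 x : x < 1 -> tail x = 0.
Proof. by move=> x1; rewrite /tail indicE memNset// /= in_itv/= andbT leNgt x1. Qed.

Lemma tail_ge1 x : 1 <= x -> tail x = 1.
Proof. by move=> x1; rewrite /tail indicE mem_set//= in_itv/= andbT. Qed.

Lemma measurable_tail (D : set (measurableTypeR R)) : measurable_fun D tail.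
Proof. by apply: measurable_indic. Qed.

Definition defect x : R := 4 * k ^+ 2 * beta ^+ 2 * (x ^+ 2)^-1 * tail x.

Definition density th p x : R :=
  2^-1 * p ^+ 2 + 2^-1 * sin th ^+ 2 +
  k * ((sin (th - beta) ^+ 2 - sin beta ^+ 2 * tail x) * x^-1) + defect x.

Hypothesis k0 : 0 <= k.
Hypothesis beta0 : 0 <= beta.
Hypothesis beta8 : beta <= 8^-1.

Lemma sin_beta_le : `|sin beta| <= beta.
Proof. by rewrite (le_trans (sin_norm_le _))// ger0_norm. Qed.

(** The difference is sin(th)^2 cos(2 beta) minus a cross term containing sin th. The bound must
    vanish with sin th: divided by x, a constant would not be integrable at infinity. *)
Lemma sqr_sinB_ge th :
  - (2 * beta * `|sin th|) <= sin (th - beta) ^+ 2 - sin beta ^+ 2.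
Proof.
have sb := sin_beta_le; have cb := cos_max beta; have ct := cos_max th.
have cs := cos2Dsin2 beta; have cst := cos2Dsin2 th.
have -> : sin (th - beta) ^+ 2 - sin beta ^+ 2 =
    sin th ^+ 2 * (cos beta ^+ 2 - sin beta ^+ 2) -
    2 * (sin th * cos th * (sin beta * cos beta)).
  rewrite sinB.
  have e : sin beta ^+ 2 = (cos th ^+ 2 + sin th ^+ 2) * sin beta ^+ 2.
    by rewrite cst mul1r.
  rewrite [in LHS]e; ring.
have h1 : 0 <= cos beta ^+ 2 - sin beta ^+ 2.
  have : sin beta ^+ 2 <= (8^-1) ^+ 2.
    rewrite -(real_normK (num_real (sin beta))) lerXn2r ?nnegrE//.
    exact: le_trans sb beta8.
  by move: cs; lra.
have h2 : sin th * cos th * (sin beta * cos beta) <= beta * `|sin th|.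
  apply: (le_trans (ler_norm _)); rewrite !normrM [leRHS]mulrC.
  apply: ler_pM; rewrite ?mulr_ge0//; first by rewrite ler_piMr.
  by apply: (@le_trans _ _ `|sin beta|) => //; rewrite ler_piMr.
have := mulr_ge0 (sqr_ge0 (sin th)) h1; move: h2; rewrite -[2 * beta * _]mulrA.
move: (sin th * cos th * _) (sin th ^+ 2 * _) (beta * `|_|) => X Y Z; lra.
Qed.

(** Below 1 the tail and the defect vanish and all terms are nonnegative. From 1 on, the negative
    part 2 k beta |sin th| / x is absorbed by half of the anisotropy and the defect. *)
Lemma density_ge th p x : 0 < x ->
  2^-1 * p ^+ 2 + 4^-1 * sin th ^+ 2 <= density th p x.
Proof.
move=> x0; rewrite /density /defect; have [x1|x1] := leP 1 x; last first.
  rewrite tail_lt1// !mulr0 addr0 subr0.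
  have : 0 <= k * (sin (th - beta) ^+ 2 * x^-1).
    by apply/mulr_ge0/mulr_ge0 => //; [exact: sqr_ge0|rewrite invr_ge0 ltW].
  by have := sqr_ge0 (sin th); lra.
rewrite tail_ge1// !mulr1.
have := sqr_sinB_ge th; set D := sin (th - beta) ^+ 2 - _ => hD.
have xi0 : 0 <= x^-1 by rewrite invr_ge0 ltW.
have h1 : - (2 * beta * `|sin th|) * (k * x^-1) <= D * (k * x^-1).
  by rewrite ler_wpM2r// mulr_ge0.
(* This square is what fixes the coefficient 4 of [defect]. *)
have h2 := sqr_ge0 (2^-1 * `|sin th| - 2 * beta * k * x^-1).
rewrite -exprVn -[X in 4^-1 * X](real_normK (num_real (sin th))).
rewrite -[X in _ + 2^-1 * X + _](real_normK (num_real (sin th))).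
move: {hD} h1 h2; move: D (x^-1) (`|sin th|) => D y s; nra.
Qed.

Lemma density_ge0 th p x : 0 < x -> 0 <= density th p x.
Proof.
move=> x0; apply: le_trans (density_ge th p x0).
by have := sqr_ge0 p; have := sqr_ge0 (sin th); lra.
Qed.

Lemma measurable_sin_comp (D : set (measurableTypeR R)) (f : R -> R) :
  measurable_fun D f -> measurable_fun D (fun x => sin (f x)).
Proof.
move=> mf; apply: measurableT_comp mf.
by apply: continuous_measurable_fun; exact: continuous_sin.
Qed.

Lemma measurable_defect (D : set (measurableTypeR R)) : measurable_fun D defect.
Proof.
apply: measurable_funM; last exact: measurable_tail.
apply: measurable_funM => //; apply: (measurableT_comp measurable_inv).
exact: measurable_funX.
Qed.

Lemma measurable_density (th p : R -> R) : measurable_fun Rp th -> measurable_fun Rp p ->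
  measurable_fun Rp (fun x => density (th x) (p x) x).
Proof.
move=> mth mp; apply: measurable_funD; last exact: measurable_defect.
apply: measurable_funD.
  apply: measurable_funD; apply: measurable_funM => //; apply: measurable_funX => //.
  exact: measurable_sin_comp.
apply: measurable_funM => //; apply: measurable_funM; last first.
  by apply: (measurableT_comp measurable_inv).
apply: measurable_funB; last by apply: measurable_funM => //; exact: measurable_tail.
by apply: measurable_funX; apply: measurable_sin_comp; exact: measurable_funB.
Qed.

Lemma defect_weight x : 0 < x -> 0 <= defect x <= 8 * k ^+ 2 * beta ^+ 2 * weight x.
Proof.
move=> x0; rewrite /defect; have K0 : 0 <= 4 * k ^+ 2 * beta ^+ 2.
  by apply/mulr_ge0/sqr_ge0/mulr_ge0/sqr_ge0.
have [x1|x1] := leP 1 x; last first.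
  rewrite tail_lt1// mulr0 lexx /=; apply: mulr_ge0 (weight_ge0 x); lra.
rewrite tail_ge1// mulr1 mulr_ge0 ?invr_ge0 ?sqr_ge0//=.
have := ler_wpM2l K0 (weight_ge1 x1); move: (weight x) (_^-1) => w y; lra.
Qed.

End energy_density.

(** * Reduction of the energy to a nonnegative one *)

Section energy_reduction.
Context {R : realType}.
Local Notation mu := (@lebesgue_measure R).
Local Notation Rp := (Rpos : set (measurableTypeR R)).

(** If f has infinite integral, so has the positive part of f + h, while its negative part is
    dominated by |h|; the integral of the signed sum is then +oo as well. *)
Lemma ge0_integralD_integrable (f h : R -> R) : measurable_fun Rp f ->
  (forall x, Rpos x -> 0 <= f x) -> mu.-integrable Rpos (EFin \o h) ->
  (\int[mu]_(x in Rpos) (f x + h x)%:E =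
   \int[mu]_(x in Rpos) (f x)%:E + \int[mu]_(x in Rpos) (h x)%:E)%E.
Proof.
move=> mf f0 ih.
have mpos := @measurable_Rpos R.
have [foo|] := ltP (\int[mu]_(x in Rpos) (f x)%:E)%E +oo%E.
  under eq_integral do rewrite EFinD.
  apply: integralD => //; apply/integrableP; split; first exact/measurable_EFinP.
  rewrite [X in (X < _)%E](_ : _ = (\int[mu]_(x in Rpos) (f x)%:E)%E)//.
  by apply: eq_integral => x; rewrite inE => xp; rewrite gee0_abs// lee_fin f0.
rewrite leye_eq => /eqP foo; rewrite foo.
have hfin := integrable_fin_num mpos ih.
rewrite addye; last by apply: contraTneq hfin => ->.
have mh : measurable_fun Rp h by apply/measurable_EFinP; exact: measurable_int ih.
have mfh : measurable_fun Rp (EFin \o (fun x => (f x + h x)%R)).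
  by apply/measurable_EFinP; exact: measurable_funD.
have pos : (\int[mu]_(x in Rpos) ((EFin \o (fun x => (f x + h x)%R))^\+ x) = +oo)%E.
  have habs : (\int[mu]_(x in Rpos) `|(h x)%:E| < +oo)%E by case/integrableP : ih.
  apply/eqP; rewrite -leye_eq -foo.
  have le1 : (\int[mu]_(x in Rpos) (f x)%:E <=
     \int[mu]_(x in Rpos) ((EFin \o (fun x => (f x + h x)%R))^\+ x) +
     \int[mu]_(x in Rpos) `|(h x)%:E|)%E.
    rewrite -ge0_integralD//; last 2 first.
    - exact: measurable_funepos.
    - by apply: measurableT_comp => //; exact/measurable_EFinP.
    apply: ge0_le_integral => //.
    - exact/measurable_EFinP.
    - apply: emeasurable_funD; first exact: measurable_funepos.
      by apply: measurableT_comp => //; exact/measurable_EFinP.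
    - move=> x xp; rewrite funeposE /= -EFin_max -EFinD lee_fin.
      have : f x + h x <= Num.max (f x + h x) 0 by rewrite le_max lexx.
      by have := ler_norm (- h x); rewrite normrN; lra.
  case: (ltP (\int[mu]_(x in Rpos) ((EFin \o (fun x => (f x + h x)%R))^\+ x)) +oo)%E => [poo|].
    have := lte_add_pinfty poo habs; move/(le_lt_trans le1); rewrite foo ltxx//.
  by rewrite foo.
rewrite integralE pos addye//.
have neg : (\int[mu]_(x in Rpos) ((EFin \o (fun x => (f x + h x)%R))^\- x) < +oo)%E.
  apply: (@le_lt_trans _ _ (\int[mu]_(x in Rpos) `|(h x)%:E|)%E); last by case/integrableP : ih.
  apply: ge0_le_integral => //.
  - exact: measurable_funeneg.
  - by apply: measurableT_comp => //; exact/measurable_EFinP.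
  - move=> x xp; rewrite funenegE /= -EFin_max lee_fin.
    rewrite ge_max normr_ge0 andbT; have := f0 x xp; have := ler_norm (- h x).
    by rewrite normrN; lra.
by apply: contraTneq neg => /(congr1 (@oppe R)); rewrite oppeK => ->.
Qed.

(** The derivative vanishes outside [0, 1], so its maximum there is a global Lipschitz constant. *)
Lemma smooth_lipschitz_cutoff (beta : R) (eta : R -> R) : cutoff beta eta ->
  exists2 L : R, 0 <= L & forall x y, `|eta x - eta y| <= L * `|x - y|.
Proof.
move=> [seta eta_bnd eta0 eta1 _].
have cd : {within `[0, 1], continuous (fun x => `|derive1 eta x|)}.
  apply: continuous_subspaceT => x; apply: (@continuous_comp _ _ _ (derive1 eta) (fun y => `|y|)).
    by apply: smooth_continuous; exact: smooth_derive1.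
  exact: norm_continuous.
have [c _ cmax] := EVT_max ler01 cd.
exists `|derive1 eta c|; first exact: normr_ge0.
have dbound x : `|derive1 eta x| <= `|derive1 eta c|.
  have [x0|x0] := ltP x 0.
    have -> : derive1 eta x = 0; last by rewrite normr0.
    apply: derive1_val; apply: (@near_eq_is_derive _ _ _ (fun=> beta)) => //.
    by near=> y; rewrite eta0// ltW//; near: y; exact: lt_nbhsl.
  have [x1|x1] := ltP 1 x.
    have -> : derive1 eta x = 0; last by rewrite normr0.
    apply: derive1_val; apply: (@near_eq_is_derive _ _ _ (fun=> 0)) => //.
    by near=> y; rewrite eta1// ltW//; near: y; exact: lt_nbhsr.
  by apply: cmax; rewrite in_itv/= x0.
move=> x y; apply: (@bounded_derive_lipschitz _ setT eta (derive1 eta)) => // z _.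
by apply: derivable_is; exact: smooth_derivable.
Unshelve. all: by end_near. Qed.

End energy_reduction.

Section energy_identity.
Context {R : realType}.
Local Notation mu := (@lebesgue_measure R).
Local Notation Rp := (Rpos : set (measurableTypeR R)).
Let mpos := @measurable_Rpos R.
Implicit Types (theta g : R -> R).

(** The derivative g is an argument of its own: any L^2 representative may be used, independently of
    the choice made in [weak_derivative]. *)
Definition reduced_energy (k1 k2 beta : R) theta g : \bar R :=
  total_energy k2 (fun x => density k1 beta (theta x) (g x) x) (fun x => sin (theta x - beta)).

(** The constant collects the integral of h and the nonlocal term of eta. Both are finite: h is
    dominated by a multiple of the weight, since near 0 the Lipschitz bound and eta 0 = beta give
    sin(eta - beta)^2 / x <= L^2, and from 1 on only the defect remains. *)
Lemma energyE (nu beta : R) (eta : R -> R) : 0 < nu -> 0 <= beta -> beta <= 8^-1 ->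
  cutoff beta eta -> exists C : R, forall theta g, ac beta theta g ->
  energy nu beta eta theta =
    (reduced_energy (nu / (4 * pi)) (nu / (8 * pi)) beta theta g + C%:E)%E.
Proof.
move=> nu0 b0 b8 cut; have pi0 := @pi_gt0 R.
set k1 := nu / (4 * pi); set k2 := nu / (8 * pi).
have k10 : 0 <= k1 by rewrite divr_ge0 ?mulr_ge0// ltW.
have k20 : 0 <= k2 by rewrite divr_ge0 ?mulr_ge0// ltW.
have [L L0 Leta] := smooth_lipschitz_cutoff cut.
have [seta _ eta0 eta1 _] := cut.
have meta : measurable_fun Rp eta.
  apply: measurable_funTS; apply: continuous_measurable_fun; exact: smooth_continuous.
have msin : measurable_fun Rp (fun x => sin (eta x - beta)).
  by apply: measurable_sin_comp; exact: measurable_funB.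
(* The original local integrand minus [density]; theta cancels. *)
pose h x := k1 * ((sin beta ^+ 2 * tail x - sin (eta x - beta) ^+ 2) * x^-1) - defect k1 beta x.
have mh : measurable_fun Rp h.
  apply: measurable_funB; last exact: measurable_defect.
  apply: measurable_funM => //; apply: measurable_funM; last first.
    by apply: (measurableT_comp measurable_inv).
  by apply: measurable_funB; [apply: measurable_funM => //; exact: measurable_tail|exact: measurable_funX].
have ih : mu.-integrable Rpos (EFin \o h).
  pose K := 2 * k1 * L ^+ 2 + 8 * k1 ^+ 2 * beta ^+ 2.
  apply: (@le_integrable _ _ _ mu _ mpos _ (fun x => (K * weight x)%:E)).
  - exact/measurable_EFinP.
  - move=> x; rewrite RposE => x0; rewrite lee_fin.
    have /andP[d0 dw] := defect_weight k1 beta x0.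
    have w0 := weight_ge0 x.
    have k1L : 0 <= k1 * L ^+ 2 by rewrite mulr_ge0// sqr_ge0.
    have kb : 0 <= 8 * k1 ^+ 2 * beta ^+ 2 by apply/mulr_ge0/sqr_ge0/mulr_ge0/sqr_ge0.
    have KE : K = 2 * (k1 * L ^+ 2) + 8 * k1 ^+ 2 * beta ^+ 2 by rewrite /K mulrA.
    have kLw := mulr_ge0 k1L w0.
    rewrite [leRHS]ger0_norm; last by rewrite mulr_ge0// KE; lra.
    rewrite /h; apply: (le_trans (ler_normB _ _)); rewrite [X in _ + X]ger0_norm//.
    rewrite KE [leRHS]mulrDl; apply: lerD => //.
    have [x1|x1] := leP 1 x.
      rewrite tail_ge1// eta1// add0r sinN sqrrN mulr1 subrr mul0r mulr0 normr0.
      by rewrite -mulrA mulr_ge0.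
    rewrite tail_lt1// mulr0 sub0r mulNr mulrN normrN ger0_norm; last first.
      by apply/mulr_ge0/mulr_ge0 => //; [exact: sqr_ge0|rewrite invr_ge0 ltW].
    have hs : sin (eta x - beta) ^+ 2 * x^-1 <= L ^+ 2.
      have x0' := ltW x0; rewrite ler_pdivrMr//; apply: (@le_trans _ _ ((L * x) ^+ 2)).
        rewrite -(real_normK (num_real (sin _))) lerXn2r ?nnegrE ?mulr_ge0//.
        apply: (le_trans (sin_norm_le _)); rewrite -(eta0 0)//.
        by have := Leta x 0; rewrite subr0 (gtr0_norm x0).
      by rewrite exprMn ler_wpM2l ?sqr_ge0// expr2 ler_piMl// ltW.
    apply: (le_trans (ler_wpM2l k10 hs)).
    rewrite [leRHS](_ : _ = k1 * L ^+ 2 * (2 * weight x)); last by rewrite -mulrA mulrCA.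
    by apply: ler_peMr => //; exact: weight_le1 (ltW x1).
  - by apply: integrableZl_EFin => //; exact: integrable_weight.
pose f x := sin (eta x - beta).
have Gfin : (gagliardo f \is a fin_num)%E.
  rewrite ge0_fin_numE; last first.
    by apply: integral_ge0 => x _; apply: integral_ge0 => y _; rewrite lee_fin quotient_ge0.
  apply: le_lt_trans (ltry _); apply: (@gagliardo_lipschitz _ _ L) => //.
    move=> x y x0 y0; apply: (le_trans (sin_lipschitz _ _)).
    by rewrite opprB addrA subrK.
  by move=> x x1; rewrite /f eta1// eta1.
exists (fine (\int[mu]_(x in Rpos) (h x)%:E)%E - k2 * fine (gagliardo f)).
move=> theta g thg.
have [mwd wdg] := ac_weak_derivative thg.
have mth := ac_measurable thg.
have mg : measurable_fun Rp g by case: thg => -[].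
rewrite /energy -/k1 -/k2 /reduced_energy total_energy_split//; last 3 first.
- by move=> x; rewrite RposE; exact: density_ge0.
- exact: measurable_density.
- by apply: measurable_sin_comp; exact: measurable_funB.
have -> : (\int[mu]_(x in Rpos) (2^-1 * weak_derivative theta x ^+ 2 +
    2^-1 * sin (theta x) ^+ 2 + k1 * ((sin (theta x - beta) ^+ 2 -
    sin (eta x - beta) ^+ 2) / x))%:E =
    \int[mu]_(x in Rpos) (density k1 beta (theta x) (g x) x)%:E +
    \int[mu]_(x in Rpos) (h x)%:E)%E.
  rewrite -(@ge0_ae_eq_integral _ _ _ mu _
    (fun x => (density k1 beta (theta x) (weak_derivative theta x) x)%:E)
    (fun x => (density k1 beta (theta x) (g x) x)%:E)) //.
  - rewrite -ge0_integralD_integrable//.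
    + by apply: eq_integral => x _; rewrite /density /h; congr EFin; ring.
    + exact: measurable_density.
    + by move=> x; rewrite RposE; exact: density_ge0.
  - by apply/measurable_EFinP; exact: measurable_density.
  - by apply/measurable_EFinP; exact: measurable_density.
  - by move=> x; rewrite RposE lee_fin; exact: density_ge0.
  - by move=> x; rewrite RposE lee_fin; exact: density_ge0.
  - by apply: ae_imp wdg => x + xp => /(_ xp) ->.
rewrite -[X in (_ + X + _ - _)%E]fineK; last exact: integrable_fin_num.
rewrite -[X in (_ - _ * X)%E]fineK// -EFinM EFinB addeA; congr (_ - _)%E.
by rewrite addeAC.
Qed.

(** * Low energy forces a small angle *)

Section low_energy.
Variables (k1 k2 beta : R).
Hypotheses (k10 : 0 <= k1) (k20 : 0 <= k2) (b0 : 0 <= beta) (b8 : beta <= 8^-1).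

Lemma reduced_energy_ge0 theta g : (0 <= reduced_energy k1 k2 beta theta g)%E.
Proof. by apply: total_energy_ge0 => // x; rewrite RposE; exact: density_ge0. Qed.

Lemma reduced_energy_bound theta g (E : R) : ac beta theta g ->
  (reduced_energy k1 k2 beta theta g <= E%:E)%E ->
  sqnorm mu Rpos g <= 2 * E /\
  sqint mu Rpos (fun x => sin (theta x)) /\
  sqnorm mu Rpos (fun x => sin (theta x)) <= 4 * E.
Proof.
move=> thg EE; have mth := ac_measurable thg.
have mg : measurable_fun Rp g by case: thg => -[].
have ms : measurable_fun Rp (fun x => sin (theta x)) by exact: measurable_sin_comp.
have le1 (c : R) (f : R -> R) : 0 < c -> measurable_fun Rp f ->
    (forall x, 0 < x -> c^-1 * f x ^+ 2 <= density k1 beta (theta x) (g x) x) ->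
    (\int[mu]_(x in Rpos) (f x ^+ 2)%:E <= (c * E)%:E)%E.
  move=> c0 mf fd.
  have : (\int[mu]_(x in Rpos) (c^-1 * f x ^+ 2)%:E <= E%:E)%E.
    apply: le_trans EE; apply: le_trans (le_total_energy k20 _ _ _) => //.
    - apply: ge0_le_integral => //.
      + by move=> x _; rewrite lee_fin mulr_ge0 ?sqr_ge0// invr_ge0 ltW.
      + by apply/measurable_EFinP; apply: measurable_funM => //; exact: measurable_funX.
      + by apply/measurable_EFinP; exact: measurable_density.
      + by move=> x; rewrite RposE => x0; rewrite lee_fin; exact: fd.
    - by move=> x; rewrite RposE; exact: density_ge0.
    - exact: measurable_density.
    - by apply: measurable_sin_comp; exact: measurable_funB.
  under eq_integral do rewrite EFinM.
  rewrite ge0_integralZl_EFin//; last 3 first.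
  - by move=> x _; rewrite lee_fin sqr_ge0.
  - by apply/measurable_EFinP; exact: measurable_funX.
  - by rewrite invr_ge0 ltW.
  by rewrite EFinM muleC lee_pdivrMr// muleC.
have gE : (\int[mu]_(x in Rpos) (g x ^+ 2)%:E <= (2 * E)%:E)%E.
  apply: le1 => // x x0; apply: le_trans (density_ge k10 b0 b8 _ _ x0).
  by rewrite lerDl mulr_ge0// sqr_ge0.
have sE : (\int[mu]_(x in Rpos) (sin (theta x) ^+ 2)%:E <= (4 * E)%:E)%E.
  apply: le1 => // x x0; apply: le_trans (density_ge k10 b0 b8 _ _ x0).
  by rewrite lerDr mulr_ge0// sqr_ge0.
have ss : sqint mu Rpos (fun x => sin (theta x)).
  by apply/(sqintP mu mpos ms); exact: le_lt_trans sE (ltry _).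
split; first by rewrite -lee_fin -sqnormE//; case: thg.
by split => //; rewrite -lee_fin -sqnormE.
Qed.

(* Modica-Mortola: the kinetic and anisotropy terms bound the total variation of
   cos theta by 3 E. *)
Lemma cos_low_energy theta g (E : R) : ac beta theta g -> 0 <= E ->
  (reduced_energy k1 k2 beta theta g <= E%:E)%E ->
  forall x, 0 <= x -> cos beta - 3 * E <= cos (theta x).
Proof.
move=> thg E0 EE x x0; have [gE [ss sE]] := reduced_energy_bound thg EE.
have [_ cth] : ac (cos beta) (fun x => cos (theta x)) (fun x => - sin (theta x) * g x).
  apply: (@ac_comp _ _ _ _ cos (fun x => - sin x) setT 1 1) => //.
  - by move=> a b _ _; exact: cos_taylor.
  - by move=> a b _ _; rewrite mul1r -opprD normrN; exact: sin_lipschitz.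
  - by move=> a _; rewrite normrN; exact: sin_max.
rewrite (cth x x0).
have mI : measurable (`]0, x]%classic : set (measurableTypeR R)) by exact: measurable_itv.
have sgI := sqint_itv x (lexx 0) thg.1; have ssI := sqint_itv x (lexx 0) ss.
have cs := cauchy_schwarz mI ssI sgI.
under eq_Rintegral do rewrite mulNr -mulN1r.
rewrite RintegralZl//; last exact: sqint_mul.
set I := Rintegral _ _ _ in cs *.
have : I ^+ 2 <= (3 * E) ^+ 2.
  (* Cauchy-Schwarz yields 8 E^2, rounded up to (3 E)^2 to avoid the square root of 8. *)
  apply: (le_trans cs); apply: (@le_trans _ _ (4 * E * (2 * E))); last by nra.
  apply: ler_pM; [exact: sqnorm_ge0|exact: sqnorm_ge0| |].
    by apply: le_trans sE; exact: sqnorm_itv_le.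
  by apply: le_trans gE; apply: sqnorm_itv_le => //; case: thg.
clear cs; move: I => I hI.
have E3 : 0 <= 3 * E by rewrite mulr_ge0.
have : `|I| <= 3 * E by rewrite -(@ler_pXn2r _ 2)// ?nnegrE// real_normK ?num_real.
by rewrite ler_norml mulN1r => /andP[_ ?]; lra.
Qed.

(** Since theta starts at beta < delta and is continuous, reaching |theta| >= delta would force
    |theta| = delta somewhere, where the lower bound on cos theta fails. *)
Lemma low_energy_small theta g (E delta : R) : ac beta theta g -> 0 <= E ->
  (reduced_energy k1 k2 beta theta g <= E%:E)%E ->
  beta < delta -> cos delta < cos beta - 3 * E ->
  forall x, 0 <= x -> `|theta x| < delta.
Proof.
move=> thg E0 EE bd cosd x x0; rewrite ltNge; apply/negP => dx.
have cth : {within `[0, x], continuous theta}.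
  apply: (continuous_subspaceW _ (ac_continuous thg)) => y.
  by rewrite /Rnneg /= !in_itv/= andbT => /andP[].
have th0 := ac0 thg.
suff [y y0 yd] : exists2 y, 0 <= y & `|theta y| = delta.
  have := cos_low_energy thg E0 EE y0.
  by rewrite -(cos_norm (theta y)) yd leNgt cosd.
have [tp|tn] := leP 0 (theta x).
  rewrite ger0_norm// in dx.
  have [|y + yE] := @IVT _ theta 0 x delta x0 cth.
    by rewrite th0 min_l ?max_r; [rewrite (ltW bd)| |]; lra.
  rewrite in_itv/= => /andP[y0 _]; exists y => //.
  by rewrite yE ger0_norm//; exact: ltW (le_lt_trans b0 bd).
rewrite ltr0_norm// in dx.
have [|y + yE] := @IVT _ theta 0 x (- delta) x0 cth.
  have d0 : 0 < delta := le_lt_trans b0 bd.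
  by rewrite th0 min_r ?max_l; have := b0; [move=> ?; apply/andP; split| |]; lra.
rewrite in_itv/= => /andP[y0 _]; exists y => //.
by rewrite yE normrN ger0_norm//; exact: ltW (le_lt_trans b0 bd).
Qed.

End low_energy.

End energy_identity.

(** * A competitor of energy of order beta^2 *)

Section comparison.
Context {R : realType}.
Local Notation mu := (@lebesgue_measure R).
Local Notation Rp := (Rpos : set (measurableTypeR R)).
Let mpos := @measurable_Rpos R.

(** Preferred to eta as a competitor because its Lipschitz constant is beta, so every term of its
    energy is quadratic in beta, uniformly over all choices of the cutoffs. *)
Definition ramp (beta x : R) : R := beta * (1 - Num.min x 1).
Definition ramp_derive (beta x : R) : R := - beta * \1_(`]0, 1]%classic) x.

Lemma min1_lipschitz (x y : R) : `|Num.min x 1 - Num.min y 1| <= `|x - y|.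
Proof.
have h1 := ler_norm (x - y); have h2 := ler_norm (y - x); rewrite distrC in h2.
have [x1|x1] := leP x 1; have [y1|y1] := leP y 1; rewrite ler_norml; apply/andP; split; lra.
Qed.

Lemma Rintegral_indic_itv (x : R) : 0 <= x ->
  \int[mu]_(t in `]0, x]) \1_(`]0, 1]%classic) t = Num.min x 1.
Proof.
have mI (y : R) : measurable (`]0, y]%classic : set (measurableTypeR R)) by exact: measurable_itv.
move=> x0; rewrite /Rintegral integral_indic//.
have -> : `]0, 1]%classic `&` `]0, x] = `]0, Num.min x 1]%classic.
  apply/seteqP; split => t /=; rewrite !in_itv/= le_min.
    by move=> [/andP[-> ->] /andP[_ ->]].
  by move=> /and3P[-> -> ->].
rewrite [X in fine X](_ : _ = (Num.min x 1)%:E)//.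
apply: (etrans (lebesgue_measure_itv `]0, Num.min x 1])); rewrite /= lte_fin.
case: ltP => [_|]; first by rewrite sube0.
by move=> m0; congr EFin; apply/eqP; rewrite eq_le m0 le_min x0 ler01.
Qed.

Lemma ramp_ac (beta : R) : ac beta (ramp beta) (ramp_derive beta).
Proof.
have mI : measurable (`]0, 1]%classic : set (measurableTypeR R)) by exact: measurable_itv.
have s1 : sqint mu Rpos (\1_(`]0, 1]%classic) : R -> R).
  have mi : measurable_fun Rp (\1_(`]0, 1]%classic : set (measurableTypeR R)) : _ -> R).
    exact: measurable_indic.
  apply/sqintP => //.
  under eq_integral.
    move=> x _; rewrite (_ : _ ^+ 2 = \1_(`]0, 1]%classic) x); last first.
      by rewrite indicE; case: (_ \in _); rewrite ?expr1n ?expr0n.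
    over.
  rewrite integral_indic//.
  apply: (@le_lt_trans _ _ (mu `]0, 1]%classic)); last exact: itv_oc_lty.
  apply: le_measure; rewrite ?inE//.
  by apply: measurableI => //; exact: measurable_itv.
split; first exact: sqintZ.
move=> x x0; rewrite RintegralZl//; last exact: (integrable_itv _ (lexx 0)).
by rewrite Rintegral_indic_itv// /ramp; ring.
Qed.

(** On (0, 1] the kinetic, anisotropy and 1/x terms are at most (1 + k1) beta^2, and 1 <= 2
    [weight]; beyond 1 only the defect is left, at most 8 k1^2 beta^2 times the weight. This is
    [K1]; the k2 part is [gagliardo_lipschitz] with L = beta. *)
Lemma ramp_energy (k1 k2 : R) : 0 <= k1 -> 0 <= k2 -> exists2 K : R, 0 <= K &
  forall beta : R, 0 <= beta -> beta <= 8^-1 ->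
  (reduced_energy k1 k2 beta (ramp beta) (ramp_derive beta) <= (K * beta ^+ 2)%:E)%E.
Proof.
move=> k10 k20; pose K1 := 2 + 2 * k1 + 8 * k1 ^+ 2.
have K10 : 0 <= K1 by rewrite /K1; have := sqr_ge0 k1; move: (k1 ^+ 2) => z; lra.
have pi2 : 0 <= pi / 2 :> R by rewrite divr_ge0 ?pi_ge0.
exists (K1 * (pi / 2) + k2 * (25 * (pi / 2) ^+ 2)).
  by apply: addr_ge0; apply: mulr_ge0 => //; apply/mulr_ge0/sqr_ge0.
move=> beta b0 b8; have racb := ramp_ac beta.
have mramp := ac_measurable racb.
have mrd : measurable_fun Rp (ramp_derive beta) by case: racb => -[].
have b2 := sqr_ge0 beta.
rewrite /reduced_energy total_energy_split//; last 3 first.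
- by move=> x; rewrite RposE; exact: density_ge0.
- exact: measurable_density.
- by apply: measurable_sin_comp; exact: measurable_funB.
rewrite mulrDl EFinD; apply: leeD; last first.
  rewrite (_ : _ * beta ^+ 2 = k2 * (25 * beta ^+ 2 * (pi / 2) ^+ 2)); last by ring.
  rewrite EFinM lee_wpmul2l ?lee_fin//; apply: gagliardo_lipschitz => //.
  - by apply: measurable_sin_comp; exact: measurable_funB.
  - move=> x y _ _; apply: (le_trans (sin_lipschitz _ _)).
    have -> : ramp beta x - beta - (ramp beta y - beta) =
      beta * (Num.min y 1 - Num.min x 1) by rewrite /ramp; ring.
    by rewrite normrM ger0_norm// distrC ler_wpM2l// min1_lipschitz.
  - by move=> x x1; rewrite /ramp !min_r.
apply: (@le_trans _ _ (\int[mu]_(x in Rpos) ((K1 * beta ^+ 2) * weight x)%:E)%E); last first.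
  under eq_integral do rewrite EFinM.
  rewrite integralZl//; last exact: integrable_weight.
  by rewrite integral_weight -EFinM lee_fin mulrAC.
apply: ge0_le_integral => //.
- by move=> x; rewrite RposE lee_fin; exact: density_ge0.
- by apply/measurable_EFinP; exact: measurable_density.
- by apply/measurable_EFinP; apply: measurable_funM => //; exact: measurable_weight.
move=> x; rewrite RposE => x0; rewrite lee_fin /density.
have /andP[_ dw] := defect_weight k1 beta x0; have w0 := weight_ge0 x.
have [x1|x1] := leP x 1; last first.
  rewrite /ramp min_r; last exact: ltW.
  rewrite subrr mulr0 sin0 add0r sinN sqrrN tail_ge1; last exact: ltW.
  rewrite mulr1 subrr mul0r mulr0 /ramp_derive indicE memNset; last first.
    by rewrite /= in_itv/= x0/= => h; move: x1; rewrite ltNge h.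
  rewrite mulr0 !expr0n /= !mulr0 !add0r; apply: (le_trans dw).
  rewrite ler_wpM2r// ler_wpM2r// /K1; move: (8 * k1 ^+ 2) => z; lra.
have w1 := weight_le1 x0 x1.
have rE : ramp beta x - beta = - (beta * x) by rewrite /ramp min_l//; ring.
have r2 : sin (ramp beta x) ^+ 2 <= beta ^+ 2.
  rewrite -(real_normK (num_real (sin _))) lerXn2r ?nnegrE//.
  apply: (le_trans (sin_norm_le _)); rewrite /ramp min_l// normrM ger0_norm//.
  by rewrite ler_piMr// ger0_norm; lra.
have xi0 : 0 <= x^-1 by rewrite invr_ge0 ltW.
have s2 : (sin (ramp beta x - beta) ^+ 2 - sin beta ^+ 2 * tail x) * x^-1 <= beta ^+ 2.
  apply: (@le_trans _ _ (sin (ramp beta x - beta) ^+ 2 * x^-1)).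
    rewrite ler_wpM2r// gerBl mulr_ge0 ?sqr_ge0//.
  rewrite ler_pdivrMr// rE sinN sqrrN.
  apply: (@le_trans _ _ ((beta * x) ^+ 2)).
    rewrite -(real_normK (num_real (sin _))) lerXn2r ?nnegrE ?mulr_ge0 ?(ltW x0)//.
    apply: (le_trans (sin_norm_le _)); rewrite ger0_norm// mulr_ge0// ltW//.
  by rewrite exprMn ler_wpM2l// expr2 ler_piMl// ltW.
have rd2 : ramp_derive beta x ^+ 2 = beta ^+ 2.
  by rewrite /ramp_derive indicE mem_set /= ?in_itv/= ?x0// mulr1 sqrrN.
rewrite rd2.
have hk := ler_wpM2l k10 s2.
have hb : (1 + k1) * beta ^+ 2 * 1 <= (1 + k1) * beta ^+ 2 * (2 * weight x).
  by rewrite ler_wpM2l// mulr_ge0// addr_ge0.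
have -> : K1 * beta ^+ 2 * weight x = (1 + k1) * beta ^+ 2 * (2 * weight x) +
    8 * k1 ^+ 2 * beta ^+ 2 * weight x by rewrite /K1; ring.
move: hb; set V := (1 + k1) * _ * (2 * _); rewrite mulr1 mulrDl mul1r.
move: hk dw r2; move: V (k1 * _) (k1 * beta ^+ 2) (defect _ _ _) (8 * _ * _ * _) => V X Y Z W.
move: (sin _ ^+ 2) => U; lra.
Qed.

End comparison.

(** * Convexity in the sine of the angle *)

Section convexity.
Context {R : realType}.
Local Notation mu := (@lebesgue_measure R).
Local Notation Rp := (Rpos : set (measurableTypeR R)).
Let mpos := @measurable_Rpos R.

Lemma ge0_integral_mid d (T : measurableType d) (m : {measure set T -> \bar R}) (D : set T)
    (a b c : T -> \bar R) : measurable D ->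
  (forall x, D x -> 0 <= a x)%E -> (forall x, D x -> 0 <= b x)%E ->
  (forall x, D x -> 0 <= c x)%E ->
  measurable_fun D a -> measurable_fun D b -> measurable_fun D c ->
  (forall x, D x -> a x <= (2^-1)%R%:E * (b x + c x))%E ->
  (\int[m]_(x in D) a x <= (2^-1)%R%:E * (\int[m]_(x in D) b x + \int[m]_(x in D) c x))%E.
Proof.
move=> mD a0 b0 c0 ma mb mc abc.
rewrite -ge0_integralD// -ge0_integralZl_EFin//; last 2 first.
- by move=> x Dx; rewrite adde_ge0 ?b0 ?c0.
- exact: emeasurable_funD.
apply: ge0_le_integral => //.
apply: emeasurable_funM => //; exact: emeasurable_funD.
Qed.

Section fixed_coefficient.
Variable k : R.
Hypothesis k0 : 0 <= k.

Lemma seminorm_density_mid (f1 f2 : R -> R) (x : R) :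
  measurable_fun Rp f1 -> measurable_fun Rp f2 ->
  (seminorm_density k (fun x => (2^-1 * (f1 x + f2 x))%R) x <=
   (2^-1)%R%:E * (seminorm_density k f1 x + seminorm_density k f2 x))%E.
Proof.
move=> m1 m2; have mm : measurable_fun Rp (fun x => 2^-1 * (f1 x + f2 x)).
  by apply: measurable_funM => //; exact: measurable_funD.
apply: ge0_integral_mid => //.
1-3: by move=> y _; rewrite lee_fin; apply: mulr_ge0 => //; apply: mulr_ge0; rewrite ?invr_ge0 sqr_ge0.
- apply/measurable_EFinP.
  exact: (measurable_seminorm_integrand k x mm).
1-2: by apply/measurable_EFinP; exact: measurable_seminorm_integrand.
move=> y _; rewrite -EFinD -EFinM lee_fin -mulrDr [leRHS]mulrCA ler_wpM2l//.
rewrite -mulrDl [leRHS]mulrA ler_wpM2r ?invr_ge0 ?sqr_ge0//.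
by have := sqr_ge0 (f1 x - f1 y - (f2 x - f2 y)); lra.
Qed.

(** The gain d comes from the local part alone; the nonlocal part is merely convex in f. *)
Lemma total_energy_mid (q q1 q2 d f1 f2 : R -> R) :
  (forall x, Rpos x -> 0 <= q x) -> (forall x, Rpos x -> 0 <= q1 x) ->
  (forall x, Rpos x -> 0 <= q2 x) -> (forall x, Rpos x -> 0 <= d x) ->
  measurable_fun Rp q -> measurable_fun Rp q1 -> measurable_fun Rp q2 ->
  measurable_fun Rp d -> measurable_fun Rp f1 -> measurable_fun Rp f2 ->
  (forall x, Rpos x -> q x + d x <= 2^-1 * (q1 x + q2 x)) ->
  (total_energy k q (fun x => (2^-1 * (f1 x + f2 x))%R) + \int[mu]_(x in Rpos) (d x)%:E <=
   (2^-1)%R%:E * (total_energy k q1 f1 + total_energy k q2 f2))%E.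
Proof.
move=> q0 q10 q20 d0 mq mq1 mq2 md mf1 mf2 qqq.
have mm : measurable_fun Rp (fun x => 2^-1 * (f1 x + f2 x)).
  by apply: measurable_funM => //; exact: measurable_funD.
have md' (q' f : R -> R) : measurable_fun Rp q' -> measurable_fun Rp f ->
    measurable_fun Rp (fun x => (q' x)%:E + seminorm_density k f x)%E.
  by move=> ? ?; apply: emeasurable_funD; [exact/measurable_EFinP|exact: measurable_seminorm_density].
have ge0 (q' f : R -> R) : (forall x, Rpos x -> 0 <= q' x) -> forall x, Rpos x ->
    (0 <= (q' x)%:E + seminorm_density k f x)%E.
  by move=> h x xp; rewrite adde_ge0 ?seminorm_density_ge0// lee_fin h.
rewrite /total_energy -ge0_integralD; [|exact: mpos|exact: ge0|exact: md'| |exact/measurable_EFinP];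
  last by move=> x xp; rewrite lee_fin d0.
apply: ge0_integral_mid => //.
- by move=> x xp; rewrite adde_ge0 ?ge0// lee_fin d0.
- exact: ge0.
- exact: ge0.
- by apply: emeasurable_funD; [exact: md'|exact/measurable_EFinP].
- exact: md'.
- exact: md'.
move=> x xp; have := seminorm_density_mid x mf1 mf2.
move: (seminorm_density _ _ _) (seminorm_density _ _ _) (seminorm_density _ _ _) => b b1 b2 bb.
by rewrite addeAC addeACA muleDr//; apply: leeD => //; rewrite -!EFinD -EFinM lee_fin qqq.
Qed.

Lemma total_energy_eq (q q' f f' : R -> R) : (forall x, Rpos x -> q x = q' x) ->
  (forall x, Rpos x -> f x = f' x) -> total_energy k q f = total_energy k q' f'.
Proof.
move=> qq ff; apply: eq_integral => x /set_mem xp; rewrite qq//; congr (_ + _)%E.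
by apply: eq_integral => y /set_mem yp; rewrite !ff.
Qed.

End fixed_coefficient.

(** From cos a >= 1 - a^2 the cosine is positive, and its square 1 - sin(a)^2 is at least 3/4 >
    (4/5)^2. *)
Lemma sin_half (a : R) : `|a| <= 2^-1 -> `|sin a| <= 2^-1 /\ 4 / 5 <= cos a.
Proof.
move=> a2; have s2 := le_trans (sin_norm_le a) a2; split=> //.
have sq (x : R) : `|x| <= 2^-1 -> x ^+ 2 <= 4^-1 :> R.
  by rewrite ler_norml => /andP[? ?]; nra.
have := cos_ge1Bsqr a; have := cos2Dsin2 a; have := sq _ s2; have := sq _ a2.
move: (cos a) (sin a ^+ 2) (a ^+ 2) => C S A *; rewrite leNgt; apply/negP => C45; nra.
Qed.

(* In the variable u = sin(theta - beta), with derivative p, the kinetic term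
   p^2 / (1 - u^2) is jointly strongly convex, and sin theta is
   sin beta * sqrt(1 - u^2) + cos beta * u, whose square is convex for small beta. *)
Lemma density_mid (k beta th1 th2 g1 g2 x : R) : 0 <= k -> 0 <= beta -> beta <= 8^-1 -> 0 < x ->
  `|th1 - beta| <= 2^-1 -> `|th2 - beta| <= 2^-1 ->
  forall p1 p2 m, p1 = cos (th1 - beta) * g1 -> p2 = cos (th2 - beta) * g2 ->
  m = 2^-1 * (sin (th1 - beta) + sin (th2 - beta)) ->
  density k beta (beta + asin m) ((Num.sqrt (1 - m ^+ 2))^-1 * (2^-1 * (p1 + p2))) x +
    16^-1 * (p1 - p2) ^+ 2 <=
  2^-1 * (density k beta th1 g1 x + density k beta th2 g2 x).
Proof.
move=> k0 b0 b8 x0 a1 a2 p1 p2 m p1E p2E mE.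
have [s1 c1] := sin_half a1; have [s2 c2] := sin_half a2.
have C1 := cos2Dsin2 (th1 - beta); have C2 := cos2Dsin2 (th2 - beta).
have m2 : `|m| <= 2^-1.
  by rewrite mE normrM ger0_norm// (le_trans (ler_wpM2l _ (ler_normD _ _)))//; lra.
have M0 := sqrt1Bsqr_ge m2; have M2 := sqr_sqrt1Bsqr m2.
have sm : sin (asin m) = m by apply: asinK; move: m2; rewrite ler_norml in_itv/= => /andP[? ?]; lra.
have cm : cos (asin m) = Num.sqrt (1 - m ^+ 2).
  by apply: cos_asin; move: m2; rewrite ler_norml => /andP[? ?]; lra.
have sS : 0 <= sin beta <= 8^-1.
  have := sin_beta_le b0; rewrite ler_norml => /andP[_ sb].
  rewrite (le_trans sb b8) andbT; apply: sin_ge0_pi; rewrite b0/=.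
  by have := @pi_ge2 R; lra.
have cS : 0 <= cos beta by have := cos_ge1Bsqr beta; nra.
have SC := cos2Dsin2 beta; have CM := cos_max beta.
have potE th : sin th = sin beta * cos (th - beta) + cos beta * sin (th - beta).
  by rewrite -sinD addrC subrK.
have kin := kinetic_midpoint p1 p2 s1 s2.
have rp := sqrt_product_midpoint s1 s2 mE c1 c2 M0 _ _ M2.
have {rp} := rp ltac:(lra) ltac:(lra); rewrite ler_norml => /andP[rp _].
have gE c (s p g : R) : 4 / 5 <= c -> c ^+ 2 + s ^+ 2 = 1 -> p = c * g -> g ^+ 2 = p ^+ 2 / (1 - s ^+ 2).
  move=> c45 cs ->; have -> : 1 - s ^+ 2 = c ^+ 2 by rewrite -cs addrK.
  by rewrite exprMn mulrAC divff ?mul1r// expf_neq0// gt_eqF//; lra.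
rewrite /density (gE _ _ _ _ c1 C1 p1E) (gE _ _ _ _ c2 C2 p2E).
rewrite (potE th1) (potE th2) (potE (beta + asin m)) [beta + asin m]addrC addrK sm cm.
rewrite exprMn exprVn M2 [(1 - m ^+ 2)^-1 * _]mulrC.
move: kin rp; rewrite -mE.
move: (_ / (1 - m ^+ 2)) (p1 ^+ 2 / _) (p2 ^+ 2 / _) ((p1 - p2) ^+ 2) => P P1 P2 D kin rp.
(* With S = sin beta, C = cos beta, u-values s and t, the gap is (C^2 - S^2) (s - t)^2 / 4 plus S C
   times a term that is at least - (s - t)^2. It is nonnegative because C^2 - S^2 >= 1/2 and S C <=
   1/8, which is where beta <= 1/8 is spent. *)
have pot : (sin beta * Num.sqrt (1 - m ^+ 2) + cos beta * m) ^+ 2 <=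
    2^-1 * ((sin beta * cos (th1 - beta) + cos beta * sin (th1 - beta)) ^+ 2 +
            (sin beta * cos (th2 - beta) + cos beta * sin (th2 - beta)) ^+ 2).
  move: rp M2 C1 C2 SC sS CM mE cS; move: (Num.sqrt _) (cos beta) (sin beta) => M C S.
  move: (cos _) (sin _) (cos _) (sin _) => B t A s rp MM AA BB SC sS CM mE cS.
  have {}AA : A ^+ 2 = 1 - s ^+ 2 by rewrite -AA addrK.
  have {}BB : B ^+ 2 = 1 - t ^+ 2 by rewrite -BB addrK.
  have sqE (u v : R) : (S * u + C * v) ^+ 2 = S ^+ 2 * u ^+ 2 + C ^+ 2 * v ^+ 2 + 2 * (S * C) * (v * u).
    by ring.
  rewrite !sqE AA BB MM.
  have SC0 : 0 <= S * C by case/andP: sS => ? _; exact: mulr_ge0.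
  have SC8 : S * C <= 8^-1 by move: CM; rewrite ler_norml => /andP[_ C1']; case/andP: sS => ? ?; nra.
  have CS : 2^-1 <= C ^+ 2 - S ^+ 2 by case/andP: sS => ? ?; nra.
  have := ler_wpM2l SC0 rp; have := ler_wpM2r (sqr_ge0 (s - t)) CS.
  have := ler_wpM2r (sqr_ge0 (s - t)) SC8; rewrite mE.
  move: (S * C) (S ^+ 2) (C ^+ 2) => K S2 C2 h1 h2 h3.
  rewrite -subr_ge0 (_ : _ - _ = (C2 - S2) * (s - t) ^+ 2 / 4 +
    K * (s * A + t * B - 2 * (2^-1 * (s + t) * M))); last by field.
  lra.
have exch : (m ^+ 2 - sin beta ^+ 2 * tail x) / x <=
    2^-1 * ((sin (th1 - beta) ^+ 2 - sin beta ^+ 2 * tail x) / x +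
            (sin (th2 - beta) ^+ 2 - sin beta ^+ 2 * tail x) / x).
  rewrite -mulrDl [leRHS]mulrA ler_wpM2r ?invr_ge0 ?(ltW x0)// mE.
  by have := sqr_ge0 (sin (th1 - beta) - sin (th2 - beta)); lra.
have := ler_wpM2l k0 exch; rewrite [leRHS]mulrCA [k * (_ + _)]mulrDr; move: pot.
move: (defect _ _ _) ((_ * Num.sqrt _ + _) ^+ 2) ((_ + cos beta * sin (th1 - _)) ^+ 2)
  ((_ + _ * sin (th2 - _)) ^+ 2) => T Q Q1 Q2.
move: (k * _) (k * _) (k * _) => Y Y1 Y2; lra.
Qed.

Lemma sin_ac (beta : R) theta g : ac beta theta g ->
  ac 0 (fun x => sin (theta x - beta)) (fun x => cos (theta x - beta) * g x).
Proof.
move=> tg; rewrite [X in ac X](_ : 0 = sin (beta - beta)); last by rewrite subrr sin0.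
apply: (@ac_comp _ _ _ _ (fun t => sin (t - beta)) (fun t => cos (t - beta)) setT 1 1) => //.
- move=> a b _ _; have := sin_taylor (a - beta) (b - beta).
  by rewrite (_ : b - beta - (a - beta) = b - a)//; ring.
- move=> a b _ _; rewrite mul1r; apply: (le_trans (cos_lipschitz _ _)).
  by rewrite (_ : b - beta - (a - beta) = b - a)//; ring.
- by move=> a _; exact: cos_max.
Qed.

Lemma half_ball_asinK (a : R) : `|a| <= 2^-1 -> asin (sin a) = a.
Proof.
rewrite ler_norml => /andP[? ?]; apply: sinK; rewrite in_itv/=.
by have := @pi_ge2 R; lra.
Qed.

Lemma asin_ac (beta : R) u p : ac 0 u p -> (forall x, 0 <= x -> `|u x| <= 2^-1) ->
  ac beta (fun x => beta + asin (u x)) (fun x => (Num.sqrt (1 - u x ^+ 2))^-1 * p x).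
Proof.
move=> up u2; rewrite [X in ac X](_ : beta = beta + asin 0); last first.
  by rewrite -[in asin 0]sin0 half_ball_asinK ?normr0 ?invr_ge0// addr0.
apply: (@ac_comp _ _ _ _ (fun t => beta + asin t) (fun t => (Num.sqrt (1 - t ^+ 2))^-1)
  (@half_ball R) 2 2) => //.
- by move=> a b ha hb; rewrite opprD addrACA subrr add0r; exact: asin_taylor.
- exact: sqrt1Bsqr_inv_lipschitz.
- move=> a ha; have := sqrt1Bsqr_ge ha => h; rewrite ger0_norm ?invr_ge0 ?sqrtr_ge0//.
  by rewrite invf_ple ?posrE//; lra.
Qed.

End convexity.

(** * Minimizers *)

Section direct_method.
Context {R : realType}.
Local Notation mu := (@lebesgue_measure R).
Local Notation Rp := (Rpos : set (measurableTypeR R)).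
Let mpos := @measurable_Rpos R.
Variables (k1 k2 beta : R).
Hypotheses (k10 : 0 <= k1) (k20 : 0 <= k2) (b0 : 0 <= beta) (b8 : beta <= 8^-1).
Implicit Types theta g : R -> R.
Local Notation J := (reduced_energy k1 k2 beta).

Definition sin_derive theta g (x : R) : R := cos (theta x - beta) * g x.

Definition near_beta theta := forall x : R, 0 <= x -> `|theta x - beta| <= 2^-1.

Lemma sin_near_beta theta : near_beta theta ->
  forall x, 0 <= x -> `|sin (theta x - beta)| <= 2^-1.
Proof. by move=> h x x0; have [] := sin_half (h x x0). Qed.

(** The competitor is beta + asin m, with m the midpoint of the two sines; the local gain of
    [density_mid] integrates to the squared L^2 distance of their derivatives. *)
Lemma reduced_energy_mid theta1 g1 theta2 g2 :
  ac beta theta1 g1 -> ac beta theta2 g2 -> near_beta theta1 -> near_beta theta2 ->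
  exists theta g, ac beta theta g /\
  (J theta g + (16^-1 * sqnorm mu Rpos (fun x => sin_derive theta1 g1 x - sin_derive theta2 g2 x))%:E
   <= (2^-1)%:E * (J theta1 g1 + J theta2 g2))%E.
Proof.
move=> tg1 tg2 n1 n2.
set p1 := sin_derive theta1 g1; set p2 := sin_derive theta2 g2.
have a1 : ac 0 _ p1 := sin_ac tg1; have a2 : ac 0 _ p2 := sin_ac tg2.
pose m (x : R) := 2^-1 * (sin (theta1 x - beta) + sin (theta2 x - beta)).
have am : ac 0 m (fun x => 2^-1 * (p1 x + p2 x)).
  have := ac_lin 2^-1 2^-1 a1 a2; rewrite mulr0 addr0.
  by apply: ac_eq => x _; rewrite /m mulrDr.
have m2 x : 0 <= x -> `|m x| <= 2^-1.
  move=> x0; rewrite /m normrM ger0_norm// (le_trans (ler_wpM2l _ (ler_normD _ _)))//.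
  by have := sin_near_beta n1 x0; have := sin_near_beta n2 x0; lra.
have tg := asin_ac beta am m2.
exists (fun x => beta + asin (m x)), (fun x => (Num.sqrt (1 - m x ^+ 2))^-1 * (2^-1 * (p1 x + p2 x))).
split=> //.
have [[mt1 mt2] mt] := (ac_measurable tg1, ac_measurable tg2, ac_measurable tg).
have mg1 : measurable_fun Rp g1 by case: tg1 => -[].
have mg2 : measurable_fun Rp g2 by case: tg2 => -[].
have mg : measurable_fun Rp (fun x => (Num.sqrt (1 - m x ^+ 2))^-1 * (2^-1 * (p1 x + p2 x))).
  by case: tg => -[].
have mp1 : measurable_fun Rp p1 by case: a1 => -[].
have mp2 : measurable_fun Rp p2 by case: a2 => -[].
have s12 : sqint mu Rpos (fun x => p1 x - p2 x) by apply: sqintB => //; [case: a1|case: a2].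
have msin theta : measurable_fun Rp theta -> measurable_fun Rp (fun x => sin (theta x - beta)).
  by move=> ?; apply: measurable_sin_comp; exact: measurable_funB.
have -> : (16^-1 * sqnorm mu Rpos (fun x => p1 x - p2 x))%:E =
    (\int[mu]_(x in Rpos) (16^-1 * (p1 x - p2 x) ^+ 2)%:E)%E.
  rewrite EFinM -sqnormE// -ge0_integralZl_EFin//.
  - by move=> x _; rewrite lee_fin sqr_ge0.
  - by apply/measurable_EFinP; apply: measurable_funX; case: s12.
rewrite /reduced_energy.
have sinE q : total_energy k2 q (fun x => sin (beta + asin (m x) - beta)) = total_energy k2 q m.
  apply: total_energy_eq => // x; rewrite RposE => x0; rewrite addrC addKr asinK// in_itv/=.
  by have := m2 x (ltW x0); rewrite ler_norml => /andP[? ?]; lra.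
rewrite sinE.
apply: total_energy_mid => //.
- by move=> x; rewrite RposE; exact: density_ge0.
- by move=> x; rewrite RposE; exact: density_ge0.
- by move=> x; rewrite RposE; exact: density_ge0.
- by move=> x _; apply/mulr_ge0/sqr_ge0.
- exact: measurable_density.
- exact: measurable_density.
- exact: measurable_density.
- by apply: measurable_funM => //; apply: measurable_funX; case: s12.
- exact: msin.
- exact: msin.
- move=> x; rewrite RposE => x0.
  by apply: density_mid => //; [exact/n1/ltW|exact/n2/ltW].
Qed.

Lemma density_cvg (x : R) (th p : nat -> R) (th0 p0 : R) : th n @[n --> \oo] --> th0 ->
  p n @[n --> \oo] --> p0 -> density k1 beta (th n) (p n) x @[n --> \oo] --> density k1 beta th0 p0 x.
Proof.
move=> tc pc; have sqr_cvg (u : nat -> R) (l : R) : u n @[n --> \oo] --> l ->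
    u n ^+ 2 @[n --> \oo] --> l ^+ 2.
  by move=> h; rewrite expr2; under eq_fun do rewrite expr2; exact: cvgM.
have sin_cvg (u : nat -> R) (l : R) : u n @[n --> \oo] --> l -> sin (u n) @[n --> \oo] --> sin l.
  by move=> h; apply: continuous_cvg h; exact: continuous_sin.
apply: cvgD; last exact: cvg_cst.
apply: cvgD.
  by apply: cvgD; apply: cvgM (cvg_cst _) _; apply: sqr_cvg => //; exact: sin_cvg.
apply: cvgM (cvg_cst _) _; apply: cvgM; last exact: cvg_cst.
apply: cvgB; last exact: cvg_cst.
by apply: sqr_cvg; apply: sin_cvg; apply: cvgB => //; exact: cvg_cst.
Qed.

(** A level below which angles stay where theta - beta can be recovered from its sine. *)
Variable E : R.
Hypothesis low_near : forall theta g, ac beta theta g -> (J theta g <= E%:E)%E -> near_beta theta.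

(** The midpoint competitor cannot go below the minimum, which is finite, so the derivatives of the
    two sines agree in L^2. Both sines vanish at 0, hence coincide, and asin recovers the angles. *)
Lemma reduced_minimizer_unique theta1 g1 theta2 g2 :
  ac beta theta1 g1 -> ac beta theta2 g2 -> (J theta1 g1 <= E%:E)%E ->
  (forall theta g, ac beta theta g -> J theta1 g1 <= J theta g)%E ->
  (J theta2 g2 <= J theta1 g1)%E ->
  forall x, 0 <= x -> theta2 x = theta1 x.
Proof.
move=> tg1 tg2 JE Jmin J21 x x0.
have n1 := low_near tg1 JE; have n2 := low_near tg2 (le_trans J21 JE).
have [theta [g [tg]]] := reduced_energy_mid tg1 tg2 n1 n2.
set s := sqnorm _ _ _ => mid.
have s0 : s <= 0.
  have := Jmin _ _ tg; have := reduced_energy_ge0 k10 k20 b0 b8 theta1 g1.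
  have := reduced_energy_ge0 k10 k20 b0 b8 theta2 g2.
  move: mid J21 JE; move: (J theta g) (J theta1 g1) (J theta2 g2) => [a||] [b||] [c||] //=.
  by rewrite -!EFinD -!EFinM !lee_fin; lra.
have := ac_diff_sqr_le (acB (sin_ac tg1) (sin_ac tg2)) (lexx 0) x0.
rewrite (ac0 tg1) (ac0 tg2) !subrr !subr0 -/s => h.
have /eqP : (sin (theta1 x - beta) - sin (theta2 x - beta)) ^+ 2 = 0.
  by apply/eqP; rewrite eq_le sqr_ge0 andbT (le_trans h)// mulr_le0_ge0.
rewrite sqrf_eq0 subr_eq0 => /eqP /(congr1 asin).
by rewrite !half_ball_asinK ?n1 ?n2// => /(congr1 (+%R^~ beta)); rewrite !subrK.
Qed.

(** The midpoint inequality makes the derivatives of the sines Cauchy in L^2. Their limit has a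
    primitive u, the sines converge to u pointwise, and a subsequence of derivatives converges
    almost everywhere, so Fatou's lemma applies to beta + asin u. *)
Lemma reduced_minimizer_exists theta0 g0 : ac beta theta0 g0 -> (J theta0 g0 < E%:E)%E ->
  exists theta g, ac beta theta g /\
    forall theta' g', ac beta theta' g' -> (J theta g <= J theta' g')%E.
Proof.
move=> tg0 J0E.
pose S : set (\bar R) := [set z | exists theta g, ac beta theta g /\ z = J theta g].
have Jge theta g := reduced_energy_ge0 k10 k20 b0 b8 theta g.
have inf0 : (0 <= ereal_inf S)%E by apply: le_ereal_inf_tmp => _ [theta [g [_ ->]]].
have infE : (ereal_inf S < E%:E)%E.
  by apply: le_lt_trans J0E; apply: ereal_inf_lbound; exists theta0, g0.
have inf_fin : ereal_inf S \is a fin_num.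
  by rewrite ge0_fin_numE//; apply: lt_trans infE (ltry _).
pose j := fine (ereal_inf S).
have jE : ereal_inf S = j%:E by rewrite fineK.
have jle theta g : ac beta theta g -> (j%:E <= J theta g)%E.
  by move=> tg; rewrite -jE; apply: ereal_inf_lbound; exists theta, g.
have jltE : 0 < E - j by rewrite subr_gt0 -lte_fin -jE.
(* Positive, vanishing in the limit, and at most E - j, so that the whole minimizing sequence lies
   in the sublevel. *)
pose e n : R := (E - j) * n.+1%:R^-1.
have e0 n : 0 < e n by rewrite mulr_gt0// invr_gt0.
have eE n : e n <= E - j.
  by rewrite /e ler_piMr// ?(ltW jltE)// invf_le1// ler1n.
have ecvg : e n @[n --> \oo] --> 0.
  rewrite -[X in _ --> X](mulr0 (E - j)); apply: cvgM; first exact: cvg_cst.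
  exact: cvg_harmonic.
have /choice[w wP] n : exists w : (R -> R) * (R -> R),
    ac beta w.1 w.2 /\ (J w.1 w.2 <= (j + e n)%:E)%E.
  have [_ [theta [g [tg ->]]]] := lb_ereal_inf_adherent (e0 n) inf_fin.
  by rewrite jE => /ltW h; exists (theta, g).
have wn n : near_beta (w n).1.
  have [tg h] := wP n; apply: (low_near tg); apply: (le_trans h).
  by rewrite lee_fin; have := eE n; lra.
pose p n := sin_derive (w n).1 (w n).2.
have ap n : ac 0 (fun x => sin ((w n).1 x - beta)) (p n) := sin_ac (wP n).1.
have sp n : sqint mu Rpos (p n) by case: (ap n).
have pC : sqcauchy mu Rpos p.
  (* The midpoint energy is at least j, so the squared distance is at most 8 (e m + e n). *)
  move=> eps eps0; have eps16 : 0 < eps / 16 by rewrite divr_gt0.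
  have [N _ NP] := cvgr_lt _ ecvg _ eps16.
  exists N => m n Nm Nn.
  have [theta [g [tg]]] := reduced_energy_mid (wP m).1 (wP n).1 (wn m) (wn n).
  rewrite -/(p m) -/(p n); set s := sqnorm _ _ _ => mid.
  have := jle _ _ tg; have := (wP m).2; have := (wP n).2; have := NP m Nm; have := NP n Nn.
  move: mid => /=; move: (Jge theta g) (Jge (w m).1 (w m).2) (Jge (w n).1 (w n).2).
  move: (J theta g) (J (w m).1 (w m).2) (J (w n).1 (w n).2) (e m) (e n).
  move=> [a||] [b||] [c||] //= em en _ _ _.
  by rewrite -!EFinD -!EFinM !lee_fin; lra.
have [q [k [sq nk pq sqp]]] := riesz_fischer mpos sp pC.
have kcvg : k n @[n --> \oo] --> \oo.
  by apply/cvgnyPge => A; exists A => // n /= An; exact: leq_trans (nk n).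
pose u (x : R) := 0 + \int[mu]_(t in `]0, x]) q t.
have uq : ac 0 u q := ac_primitive 0 sq.
have ucvg x : 0 <= x -> sin ((w (k n)).1 x - beta) @[n --> \oo] --> u x.
  move=> x0; apply: (@cvg_comp _ _ _ k (fun n => sin ((w n).1 x - beta))) kcvg _.
  exact: (ac_cvg ap uq sqp).
have u2 x : 0 <= x -> `|u x| <= 2^-1.
  move=> x0; have h := cvg_norm (ucvg x x0).
  apply: (cvgr_to_le (h _)); apply: nearW => n; exact: sin_near_beta.
have tg := asin_ac beta uq u2.
exists (fun x => beta + asin (u x)), (fun x => (Num.sqrt (1 - u x ^+ 2))^-1 * q x).
split; first exact: tg.
move=> theta' g' tg'; apply: le_trans (jle _ _ tg').
have asin_cvg x : 0 <= x -> (w (k n)).1 x @[n --> \oo] --> beta + asin (u x).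
  move=> x0; rewrite (_ : (fun n => _) = (fun n => beta + asin (sin ((w (k n)).1 x - beta)))).
    apply: cvgD; first exact: cvg_cst.
    apply: continuous_cvg (ucvg x x0); apply: continuous_asin.
    by have := u2 x x0; rewrite ler_norml => /andP[? ?]; lra.
  by apply/funext => n; rewrite half_ball_asinK ?wn// addrC subrK.
apply/lee_addgt0Pr => eps eps0.
rewrite /reduced_energy.
have mw n : measurable_fun Rp (w n).1 := ac_measurable (wP n).1.
have mt := ac_measurable tg.
have mwg n : measurable_fun Rp (w n).2 by case: (wP n).1 => -[].
have mg : measurable_fun Rp (fun x => (Num.sqrt (1 - u x ^+ 2))^-1 * q x) by case: tg => -[].
have msin theta : measurable_fun Rp theta -> measurable_fun Rp (fun x => sin (theta x - beta)).
  by move=> ?; apply: measurable_sin_comp; exact: measurable_funB.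
apply: (@total_energy_fatou _ _ k20 (fun n x => density k1 beta ((w (k n)).1 x) ((w (k n)).2 x) x)
  (fun n x => sin ((w (k n)).1 x - beta))).
- by move=> n x; rewrite RposE; exact: density_ge0.
- by move=> n; exact: measurable_density.
- by move=> n; exact: msin.
- by move=> x; rewrite RposE; exact: density_ge0.
- exact: measurable_density.
- exact: msin.
- apply: ae_imp pq => x pq xp; have x0 : 0 <= x by move: xp; rewrite RposE => /ltW.
  have {}pq := pq xp.
  apply: density_cvg; first exact: asin_cvg.
  have u1 := u2 x x0; have us : -1 <= u x <= 1.
    by move: u1; rewrite ler_norml => /andP[? ?]; lra.
  (* Only the derivative of the sine is known to converge; as the cosine is at least 4/5, dividing
     by it gives convergence of the derivative of the angle. *)
  have cw n : (w (k n)).2 x = (cos ((w (k n)).1 x - beta))^-1 * p (k n) x.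
    have [_ c45] := sin_half (wn (k n) x x0).
    by rewrite /p /sin_derive mulKf// gt_eqF//; lra.
  under eq_fun do rewrite cw.
  apply: cvgM pq; rewrite -cos_asin//; apply: cvgV.
    rewrite cos_asin// gt_eqF//; apply: lt_le_trans (sqrt1Bsqr_ge u1); lra.
  apply: continuous_cvg; first exact: continuous_cos.
  rewrite [X in _ --> X](_ : _ = beta + asin (u x) - beta); last by rewrite addrC addKr.
  by apply: cvgB; [exact: asin_cvg|exact: cvg_cst].
- move=> x; rewrite RposE => /ltW x0.
  rewrite addrC addKr asinK ?in_itv/=; first exact: ucvg.
  by have := u2 x x0; rewrite ler_norml => /andP[? ?]; lra.
- have ecvgk : e (k n) @[n --> \oo] --> 0 by exact: cvg_comp kcvg ecvg.
  near=> n; have := (wP (k n)).2; rewrite -EFinD => /le_trans; apply.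
  by rewrite lee_fin lerD2l ltW//; near: n; exact: cvgr_lt ecvgk _ eps0.
Unshelve. all: by end_near.
Qed.

End direct_method.

(** * Minimizers of the original energy and the choice of the threshold *)

Section minimizers.
Context {R : realType}.
Implicit Types theta g eta : R -> R.

(** Admissible functions and [ac] pairs correspond to each other, and the two energies differ by a
    real constant, which cancels in comparisons even with infinite values. *)
Lemma minimizerP (nu beta : R) eta theta : 0 < nu -> 0 <= beta -> beta <= 8^-1 ->
  cutoff beta eta ->
  minimizer nu beta eta theta <-> exists2 g, ac beta theta g & forall theta' g',
    ac beta theta' g' -> (reduced_energy (nu / (4 * pi)) (nu / (8 * pi)) beta theta g <=
                          reduced_energy (nu / (4 * pi)) (nu / (8 * pi)) beta theta' g')%E.
Proof.
move=> nu0 b0 b8 cut; have [C CE] := energyE nu0 b0 b8 cut; split.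
  move=> [adm min]; have [g tg] := admissible_ac adm; exists g; first exact: tg.
  move=> theta' g' tg'.
  have : (energy nu beta eta theta <= energy nu beta eta theta')%E.
    by rewrite min; apply: ereal_inf_lbound; exists theta'; first exact: ac_admissible tg'.
  by rewrite (CE _ _ tg) (CE _ _ tg') leeD2rE.
move=> [g tg min]; split; first exact: ac_admissible tg.
apply/eqP; rewrite eq_le; apply/andP; split; last first.
  by apply: ereal_inf_lbound; exists theta; first exact: ac_admissible tg.
apply: le_ereal_inf_tmp => _ [theta' /admissible_ac[g' tg'] <-].
rewrite (CE _ _ tg) (CE _ _ tg') leeD2rE; first exact: min tg'.
exact: fin_numE.
Qed.

(** With E = (K + 1) beta^2 one has cos beta - 3 E >= 1 - (3 K + 4) beta^2, and beta^2 <= beta turns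
    this into the linear smallness condition. *)
Lemma small_low_energy (k1 k2 beta K delta : R) theta g : 0 <= k1 -> 0 <= k2 -> 0 <= K ->
  0 <= beta -> beta <= 8^-1 -> beta < delta -> (3 * K + 4) * beta < 1 - cos delta ->
  ac beta theta g ->
  (reduced_energy k1 k2 beta theta g <= ((K + 1) * beta ^+ 2)%:E)%E ->
  forall x, 0 <= x -> `|theta x| < delta.
Proof.
move=> k10 k20 K0 b0 b8 bd Kb tg JE.
apply: (low_energy_small k10 k20 b0 b8 tg _ JE bd).
  by apply/mulr_ge0/sqr_ge0; lra.
have := cos_ge1Bsqr beta; have bb : beta ^+ 2 <= beta.
  by rewrite expr2 ler_piMl//; lra.
have : (3 * K + 4) * beta ^+ 2 <= (3 * K + 4) * beta by rewrite ler_wpM2l//; lra.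
lra.
Qed.

Lemma cos_lt1 (delta : R) : 0 < delta -> delta <= 1 -> cos delta < 1.
Proof.
by move=> d0 d1; rewrite -cos0 ltr_cos// in_itv/=; have := @pi_ge2 R; lra.
Qed.

End minimizers.

Theorem theorem4 (R : realType) (eta : R -> R -> R)
  (heta : forall beta : R, 0 < beta <= pi / 2 -> cutoff beta (eta beta))
  (nu : R) (hnu : 0 < nu) :
  exists (beta0 : R) (theta : R -> R -> R),
    [/\ 0 < beta0 <= pi / 2,
        forall beta : R, 0 < beta <= beta0 ->
          minimizer nu beta (eta beta) (theta beta) /\
          (forall t : R -> R, minimizer nu beta (eta beta) t ->
             forall x : R, 0 <= x -> t x = theta beta x)
      & {uniform Rnneg, theta beta @[beta --> 0^'+] --> (fun=> 0)}].
Proof.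
have pi0 := @pi_gt0 R.
set k1 := nu / (4 * pi); set k2 := nu / (8 * pi).
have k10 : 0 <= k1 by rewrite divr_ge0 ?(ltW hnu)// mulr_ge0// ltW.
have k20 : 0 <= k2 by rewrite divr_ge0 ?(ltW hnu)// mulr_ge0// ltW.
have [K K0 rampK] := ramp_energy k10 k20.
have K4 : 0 < 3 * K + 4 by lra.
(* The extra factor 2 makes beta <= c delta imply a strict inequality. *)
pose c (delta : R) := (1 - cos delta) / (2 * (3 * K + 4)).
have c0 delta : 0 < delta -> delta <= 1 -> 0 < c delta.
  by move=> d0 d1; rewrite divr_gt0 ?mulr_gt0// subr_gt0 cos_lt1.
have cP delta beta : 0 < delta -> delta <= 1 -> beta <= c delta ->
    (3 * K + 4) * beta < 1 - cos delta.
  move=> d0 d1; rewrite ler_pdivlMr ?mulr_gt0// => h.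
  by have := cos_lt1 d0 d1; lra.
have quarter : 0 < 4^-1 :> R /\ 4^-1 <= 1 :> R by lra.
(* The bound 1/8 serves the convexity estimates; c(1/4) gives |theta| < 1/4, so |theta - beta| <=
   1/4 + 1/8 < 1/2. *)
pose beta0 := Num.min 8^-1 (c 4^-1).
have beta00 : 0 < beta0 by rewrite lt_min c0 ?quarter.1 ?quarter.2// invr_gt0 ltr0n.
have beta08 : beta0 <= 8^-1 by rewrite ge_min lexx.
have pih : beta0 <= pi / 2 by have := @pihalf_ge1 R; lra.
have cut beta : 0 < beta -> beta <= beta0 -> cutoff beta (eta beta).
  by move=> b0 bb; apply: heta; rewrite b0 (le_trans bb).
(* The level (K + 1) beta^2 lies strictly above the energy of the ramp, as existence requires. *)
have low_near beta : 0 < beta -> beta <= beta0 -> forall theta g, ac beta theta g ->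
    (reduced_energy k1 k2 beta theta g <= ((K + 1) * beta ^+ 2)%:E)%E -> near_beta beta theta.
  move=> b0 bb theta g tg JE x x0.
  have b8 := le_trans bb beta08.
  have bc : beta <= c 4^-1 by rewrite (le_trans bb)// ge_min lexx orbT.
  have := small_low_energy k10 k20 K0 (ltW b0) b8 _ (cP _ _ quarter.1 quarter.2 bc) tg JE x0.
  have b4 : beta < 4^-1 by lra.
  by move=> /(_ b4); rewrite ltr_norml ler_norml => /andP[? ?]; lra.
have ex beta : 0 < beta -> beta <= beta0 -> exists t, minimizer nu beta (eta beta) t.
  move=> b0 bb; have b8 := le_trans bb beta08.
  have [|theta [g [tg gmin]]] := reduced_minimizer_exists k10 k20 (ltW b0) b8
    (low_near _ b0 bb) (ramp_ac beta).
    apply: (le_lt_trans (rampK _ (ltW b0) b8)).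
    by rewrite lte_fin ltr_pM2r ?exprn_gt0// ltrDl.
  by exists theta; apply/(minimizerP _ hnu (ltW b0) b8 (cut _ b0 bb)); exists g.
(* The default value is only taken where no minimizer exists, hence never for 0 < beta <= beta0. *)
pose theta beta := xget (cst 0) [set t | minimizer nu beta (eta beta) t].
have thetaP beta : 0 < beta -> beta <= beta0 -> minimizer nu beta (eta beta) (theta beta).
  by move=> b0 bb; exact: (xgetPex _ (ex _ b0 bb)).
have low beta t g : 0 < beta -> beta <= beta0 -> ac beta t g ->
    (forall t' g', ac beta t' g' ->
       reduced_energy k1 k2 beta t g <= reduced_energy k1 k2 beta t' g')%E ->
    (reduced_energy k1 k2 beta t g <= ((K + 1) * beta ^+ 2)%:E)%E.
  move=> b0 bb tg tmin; apply: (le_trans (tmin _ _ (ramp_ac beta))).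
  apply: (le_trans (rampK _ (ltW b0) (le_trans bb beta08))).
  by rewrite lee_fin ler_wpM2r ?sqr_ge0// lerDl.
exists beta0, theta; split; first by rewrite beta00.
  move=> beta /andP[b0 bb]; have b8 := le_trans bb beta08.
  have := thetaP _ b0 bb; split=> // t.
  move=> /(minimizerP _ hnu (ltW b0) b8 (cut _ b0 bb))[g2 tg2 min2].
  have /(minimizerP _ hnu (ltW b0) b8 (cut _ b0 bb))[g1 tg1 min1] := thetaP _ b0 bb.
  apply: (reduced_minimizer_unique k10 k20 (ltW b0) b8 (low_near _ b0 bb) tg1 tg2).
  - exact: low.
  - exact: min1.
  - exact: min2.
move=> Q /uniform_nbhs[V [entV VQ]].
have [eps /= eps0 epsV] : exists2 eps : R, 0 < eps & forall y, `|y| < eps -> V (0, y).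
  have [eps eps0 h] := entV; exists eps => // y ye; apply: h => /=.
  by rewrite /ball /= sub0r normrN.
(* Capped at 1 so that cos delta < 1, that is 0 < c delta. *)
pose delta := Num.min eps 1.
have d0 : 0 < delta by rewrite lt_min eps0 ltr01.
have d1 : delta <= 1 by rewrite ge_min lexx orbT.
near=> beta; apply: VQ => y; rewrite /Rnneg /= in_itv/= andbT => y0.
have b0 : 0 < beta by near: beta; exact: nbhs_right_gt.
have bb : beta <= beta0 by near: beta; exact: nbhs_right_le.
have bd : beta < delta by near: beta; exact: nbhs_right_lt.
have bc : beta <= c delta by near: beta; exact/nbhs_right_le/c0.
have b8 := le_trans bb beta08.
have /(minimizerP _ hnu (ltW b0) b8 (cut _ b0 bb))[g tg tmin] := thetaP _ b0 bb.
apply: epsV; apply: (@lt_le_trans _ _ delta); last by rewrite ge_min lexx.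
apply: (small_low_energy k10 k20 K0 (ltW b0) b8 bd (cP _ _ d0 d1 bc) tg) => //.
exact: low.
Unshelve. all: by end_near.
Qed.
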